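(* Let $n\ge 2$, $R\ge 1$, $\eta\in[1,n]$, $\varepsilon,\delta\in(0,1)$. Let $X=\{x_1,\dots,x_n\}\subset\mathbb{R}^d$ be $n$ distinct points with $\|x_i\|_2\le R$ for all $i$, let $\mathbf{p},\mathbf{q}\in\Delta_n$, and put $$\varepsilon'=\min\Big(1,\ \frac{\varepsilon\eta}{50\,(4R^2\eta+\log\frac{n}{\eta\varepsilon})}\Big)$$ (so that $\varepsilon'=\tilde\Omega(\varepsilon R^{-2})$). The algorithm Nys-Sink (described in the context), run on $X,\mathbf{p},\mathbf{q},\varepsilon,\eta$, returns a feasible matrix $\hat P\in\mathcal{M}(\mathbf{p},\mathbf{q})$ (in factored form) and scalars $\hat W\in\mathbb{R}$ and $r\in\mathbb{N}$, runs in time $\tilde O\big(nr\big(r+\tfrac{\eta R^4}{\varepsilon}\big)\big)$, uses $O(n(r+d))$ space, and always satisfies $$|V_C(\hat P)-W_\eta(\mathbf{p},\mathbf{q})|\le\varepsilon,\qquad \mathsf{KL}(\hat P\|P^\eta)\le\eta\varepsilon,\qquad |\hat W-W_\eta(\mathbf{p},\mathbf{q})|\le\varepsilon .$$ Moreover, for a universal constant $c$, with probability at least $1-\delta$, $$r\le c\cdot r^*(X,\eta,\varepsilon')\,\log\tfrac{n}{\delta}.$$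
   Context: $\Delta_n=\{v\in\mathbb{R}^n_{\ge0}:\sum_i v_i=1\}$; $\mathbf 1$ is the all-ones vector. $\mathcal{M}(\mathbf p,\mathbf q)=\{P\in\mathbb{R}_{\ge0}^{n\times n}:P\mathbf 1=\mathbf p,\ P^\top\mathbf 1=\mathbf q\}$. $H(P)=\sum_{ij}P_{ij}\log\frac1{P_{ij}}$ (with $0\log\frac10=0$). $C_{ij}=\|x_i-x_j\|_2^2$. For a matrix $M$, $V_M(P)=\langle M,P\rangle-\eta^{-1}H(P)$. $W_\eta(\mathbf p,\mathbf q)=\min_{P\in\mathcal M(\mathbf p,\mathbf q)}V_C(P)$, and $P^\eta$ is its unique minimizer. $\mathsf{KL}(P\|Q)=\sum_{ij}P_{ij}\log\frac{P_{ij}}{Q_{ij}}$. $\|A\|_{\mathrm{op}}$ is the operator norm. Kernel and approximation rank: $K\in\mathbb{R}^{n\times n}$, $K_{ij}=e^{-\eta\|x_i-x_j\|_2^2}$, with eigenvalues $\lambda_1(K)\ge\dots\ge\lambda_n(K)$; effective dimension $d_{\mathrm{eff}}(\tau)=\sum_{j=1}^n\frac{\lambda_j(K)}{\lambda_j(K)+\tau n}$ for $\tau>0$; $r^*(X,\eta,\varepsilon')=d_{\mathrm{eff}}\big(\frac{\varepsilon'}{2n}e^{-4\eta R^2}\big)$. Asymptotic notation: $O(\cdot)$ hides universal constants; $\tilde O,\tilde\Omega$ additionally hide polylogarithmic factors in $R,\eta,n,\varepsilon^{-1}$. Time counts arithmetic operations and evaluations of the kernel $e^{-\eta\|x-x'\|^2}$.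 Nyström approximation: for a subset $\{\tilde x_1,\dots,\tilde x_s\}\subseteq X$, $\tilde K=VA^{-1}V^\top$ with $V_{ij}=e^{-\eta\|x_i-\tilde x_j\|^2}$ ($n\times s$), $A_{jj'}=e^{-\eta\|\tilde x_j-\tilde x_{j'}\|^2}$ ($s\times s$). It satisfies $K\succeq\tilde K\succeq0$, is stored via $V$ and the Cholesky factor of $A$, and matrix-vector products with it cost $O(ns)$ once these are available. Subroutine Nyström$(X,\eta,s)$: selects at random a subset of $s$ points of $X$ (all of $X$ if $s\ge n$) by the recursive approximate leverage-score sampling algorithm (Algorithm 2) of Musco and Musco (2017), and outputs the corresponding $\tilde K$. Known guarantee, to be used as a black box: it takes $O(ns^2+s^3)$ time and $O(n(s+d))$ space, and for all $\tau,\delta'>0$, if $s\ge400\,d_{\mathrm{eff}}(\tau)\log\frac{3n}{\delta'}$ then $\|K-\tilde K\|_{\mathrm{op}}\le\tau n$ with probability at least $1-\delta'$. Subroutine AdaptiveNyström$(X,\eta,\tau)$: for $s=2,4,8,\dots$ compute $\tilde K\leftarrow$ Nyström$(X,\eta,s)$, and stop the first time $1-\min_i\tilde K_{ii}\le\tau$; output $\tilde K$ and $r=\mathrm{rank}(\tilde K)$. Subroutine Sinkhorn$(\tilde K,\mathbf p,\mathbf q,\delta_0)$: set $t=\delta_0/8$, $D_1=D_2=I$, $\mathbf p'=(1-t)\mathbf p+\frac tn\mathbf 1$, $\mathbf q'=(1-t)\mathbf q+\frac tn\mathbf 1$. While $\|D_1\tilde KD_2\mathbf 1-\mathbf p'\|_1+\|(D_1\tilde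 KD_2)^\top\mathbf 1-\mathbf q'\|_1>\delta_0/2$, alternately (starting with rows) replace $(D_1)_{ii}\leftarrow\mathbf p'_i/(\tilde KD_2\mathbf 1)_i$ for all $i$, or $(D_2)_{jj}\leftarrow\mathbf q'_j/((D_1\tilde K)^\top\mathbf 1)_j$ for all $j$. With $\tilde P=D_1\tilde KD_2$, output $D_1,D_2$ and $\hat W=\eta^{-1}\big(\sum_i\log(D_1)_{ii}\,(\tilde P\mathbf 1)_i+\sum_j\log(D_2)_{jj}\,(\tilde P^\top\mathbf 1)_j\big)$. Known fact, to be used as a black box: the loop stops after $O\big(\delta_0^{-1}\log\frac{n}{\delta_0\min_{ij}\tilde K_{ij}}\big)$ iterations when $\tilde K$ has positive entries. Subroutine Round$(F,\mathbf p,\mathbf q)$: let $F'=\mathrm{diag}(x)F$ with $x_i=\min(\mathbf p_i/(F\mathbf 1)_i,1)$; $F''=F'\mathrm{diag}(y)$ with $y_j=\min(\mathbf q_j/(F'^\top\mathbf 1)_j,1)$; $e_r=\mathbf p-F''\mathbf 1$, $e_c=\mathbf q-F''^\top\mathbf 1$; output $F''+e_re_c^\top/\|e_r\|_1$ (just $F''$ if $e_r=0$). Algorithm Nys-Sink: (1) compute $\varepsilon'$ as in the claim; (2) $(\tilde K,r)\leftarrow$ AdaptiveNyström$(X,\eta,\frac{\varepsilon'}2e^{-4\eta R^2})$; (3) $(D_1,D_2,\hat W)\leftarrow$ Sinkhorn$(\tilde K,\mathbf p,\mathbf q,\varepsilon')$; (4) $\hat P\leftarrow$ Round$(D_1\tilde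 KD_2,\mathbf p,\mathbf q)$; output $\hat P,\hat W,r$. All matrices are kept in factored form. *)

(* Defs.v *)
(* MathComp + MathComp-Analysis, over an arbitrary [R : realType]. *)
From HB Require Import structures.
From mathcomp Require Import all_boot all_order all_algebra.
From mathcomp Require Import all_classical all_reals all_analysis.
Set Implicit Arguments.
Unset Strict Implicit.
Unset Printing Implicit Defensive.
Import Order.TTheory GRing.Theory Num.Theory.
Local Open Scope ring_scope.
Local Open Scope classical_set_scope.

(** * Norms *)

(* The norm that MathComp-Analysis puts on matrices is the max norm. *)
Definition norm2 (R : realType) (m : nat) (v : 'cV[R]_m) : R :=
  Num.sqrt (\sum_i v i 0 ^+ 2).

Definition normL1 (R : realType) (m : nat) (v : 'cV[R]_m) : R :=
  \sum_i `|v i 0|.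

Definition opnorm (R : realType) (m n : nat) (A : 'M[R]_(m, n)) : R :=
  sup [set norm2 (A *m v) | v in [set v : 'cV[R]_n | norm2 v <= 1]].

(** * Entropic optimal transport *)

Definition simplex (R : realType) (n : nat) : set 'cV[R]_n :=
  [set v | (forall i, 0 <= v i 0) /\ \sum_i v i 0 = 1].

Definition ones (R : realType) (n : nat) : 'cV[R]_n := const_mx 1.

Definition couplings (R : realType) (n : nat) (p q : 'cV[R]_n) : set 'M[R]_n :=
  [set P : 'M[R]_n | [/\ forall i j, 0 <= P i j,
               P *m ones R n = p & P^T *m ones R n = q]].

Definition entropy (R : realType) (n : nat) (P : 'M[R]_n) : R :=
  \sum_i \sum_j P i j * ln (P i j)^-1.

Definition cost_mx (R : realType) (n d : nat) (X : 'I_n -> 'cV[R]_d) : 'M[R]_n :=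
  \matrix_(i, j) norm2 (X i - X j) ^+ 2.

Definition objective (R : realType) (n : nat) (M : 'M[R]_n) (eta : R)
    (P : 'M[R]_n) : R :=
  \sum_i \sum_j M i j * P i j - eta^-1 * entropy P.

(* For p and q in the simplex the set below is a singleton, since the objective
   is continuous and strictly convex on the nonempty compact set of couplings;
   the default value 0 is then not used. *)
Definition P_eta (R : realType) (n d : nat) (X : 'I_n -> 'cV[R]_d) (eta : R)
    (p q : 'cV[R]_n) : 'M[R]_n :=
  xget 0 [set P | couplings p q P /\
    forall Q, couplings p q Q ->
      objective (cost_mx X) eta P <= objective (cost_mx X) eta Q].

Definition W_eta (R : realType) (n d : nat) (X : 'I_n -> 'cV[R]_d) (eta : R)
    (p q : 'cV[R]_n) : R :=
  objective (cost_mx X) eta (P_eta X eta p q).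

(* Infinite unless P is absolutely continuous with respect to Q. *)
Definition KL (R : realType) (n : nat) (P Q : 'M[R]_n) : \bar R :=
  if [exists i, [exists j, (P i j != 0) && (Q i j == 0)]] then +oo%E
  else (\sum_i \sum_j P i j * ln (P i j / Q i j))%:E.

(** * Gaussian kernel and effective dimension *)

Definition gauss (R : realType) (d : nat) (eta : R) (x y : 'cV[R]_d) : R :=
  expR (- eta * norm2 (x - y) ^+ 2).

Definition kernel_mx (R : realType) (n d : nat) (X : 'I_n -> 'cV[R]_d)
    (eta : R) : 'M[R]_n :=
  \matrix_(i, j) gauss eta (X i) (X j).

(* Eigenvalues with multiplicity, in nonincreasing order, of a matrix whose
   characteristic polynomial splits over R (e.g. a symmetric one). *)
Definition eigenvalues (R : realType) (n : nat) (A : 'M[R]_n) : seq R :=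
  xget [::] [set s : seq R | sorted >=%R s /\
    char_poly A = \prod_(x <- s) ('X - x%:P)].

Definition d_eff (R : realType) (n d : nat) (X : 'I_n -> 'cV[R]_d)
    (eta tau : R) : R :=
  \sum_(l <- eigenvalues (kernel_mx X eta)) l / (l + tau * n%:R).

Definition r_star (R : realType) (n d : nat) (X : 'I_n -> 'cV[R]_d)
    (eta Rad eps' : R) : R :=
  d_eff X eta (eps' / (2 * n%:R) * expR (- 4 * eta * Rad ^+ 2)).

Definition eps_prime (R : realType) (n : nat) (Rad eta eps : R) : R :=
  Num.min 1 (eps * eta /
    (50 * (4 * Rad ^+ 2 * eta + ln (n%:R / (eta * eps))))).

(* A generic polylogarithmic factor of degree k in Rad, eta, n and 1/eps; it is
   at least 1 when Rad, eta, n >= 1 and eps <= 1. *)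
Definition polylog (R : realType) (k n : nat) (Rad eta eps : R) : R :=
  (1 + ln Rad + ln eta + ln n%:R + ln eps^-1) ^+ k.

(** * Cost model

    A straight-line computation is represented by its value, the number of
    operations (arithmetic operations, comparisons, elementary functions and
    kernel evaluations) it performs and the number of memory words it uses.
    Real numbers are only ever produced by the one-operation primitives
    [radd], ..., [rlt] below; reading, copying and writing stored data is free. *)

Record timed (A : Type) := Timed { cval : A; ctime : nat; cspace : nat }.

Class Sized (A : Type) := words : A -> nat.
#[global] Instance words_real (R : realType) : Sized R := fun _ => 1%N.
#[global] Instance words_bool : Sized bool := fun _ => 1%N.
#[global] Instance words_mx (R : realType) (m n : nat) : Sized 'M[R]_(m, n) :=
  fun _ => (m * n)%N.
#[global] Instance words_pair (A B : Type) (_ : Sized A) (_ : Sized B) :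
  Sized (A * B) := fun x => (words x.1 + words x.2)%N.

Definition ret (A : Type) (x : A) : timed A := Timed x 0 0.

(* The value of [m] occupies memory while it is being computed and until the
   end of the continuation. *)
Definition bind (A B : Type) {SA : Sized A} (m : timed A) (f : A -> timed B) :
    timed B :=
  let c := f (cval m) in
  Timed (cval c) (ctime m + ctime c)
       (words (cval m) + maxn (cspace m) (cspace c)).

Notation "'let$' x ':=' m 'in' f" := (bind m (fun x => f))
  (at level 200, x name, m at level 200, f at level 200).

(* [c], whose storage is then released, followed by [c']. *)
Definition after (A B : Type) {SA : Sized A} (c : timed A) (c' : timed B) :
    timed B :=
  Timed (cval c') (ctime c + ctime c')
       (maxn (words (cval c) + cspace c) (cspace c')).

Definition radd (R : realType) (x y : R) : timed R := Timed (x + y) 1 0.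
Definition rsub (R : realType) (x y : R) : timed R := Timed (x - y) 1 0.
Definition rmul (R : realType) (x y : R) : timed R := Timed (x * y) 1 0.
Definition rdiv (R : realType) (x y : R) : timed R := Timed (x / y) 1 0.
Definition rmin (R : realType) (x y : R) : timed R := Timed (Num.min x y) 1 0.
Definition rabs (R : realType) (x : R) : timed R := Timed `|x| 1 0.
Definition rln (R : realType) (x : R) : timed R := Timed (ln x) 1 0.
Definition rexp (R : realType) (x : R) : timed R := Timed (expR x) 1 0.
Definition rle (R : realType) (x y : R) : timed bool := Timed (x <= y) 1 0.
Definition rlt (R : realType) (x y : R) : timed bool := Timed (x < y) 1 0.

Definition tab (R : realType) (n : nat) (f : 'I_n -> timed R) : timed 'cV[R]_n :=
  Timed (\col_i cval (f i)) (\sum_i ctime (f i)) (\max_i (cspace (f i)).+1).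

Definition csum (R : realType) (n : nat) (f : 'I_n -> timed R) : timed R :=
  Timed (\sum_i cval (f i)) (\sum_i (ctime (f i)).+1) (\max_i (cspace (f i)).+1).

(* The accumulator starts at 1. *)
Definition cmin1 (R : realType) (n : nat) (f : 'I_n -> timed R) : timed R :=
  Timed (\big[Num.min/1]_i cval (f i)) (\sum_i (ctime (f i)).+1)
       (\max_i (cspace (f i)).+1).

(* The state is overwritten at each step, so that at most two consecutive
   states are live. *)
Fixpoint cfold (I St : Type) {SSt : Sized St} (body : I -> St -> timed St)
    (l : seq I) (st : St) : timed St :=
  if l is i :: l' then
    let c := body i st in
    let c' := cfold body l' (cval c) in
    Timed (cval c') (ctime c + ctime c')
         (maxn (words st + words (cval c) + cspace c) (cspace c'))
  else Timed st 0 (words st).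

(* Unbounded loops take a bound [fuel] on the number of iterations, and return
   None when it is exhausted; any two results [Some _] agree. *)
Fixpoint while (St : Type) {SSt : Sized St} (test : St -> timed bool)
    (body : St -> timed St) (fuel : nat) (st : St) : option (timed St) :=
  if fuel is fuel'.+1 then
    let t := test st in
    if cval t then
      let c := body st in
      omap (fun c' : timed St =>
              Timed (cval c') (ctime t + ctime c + ctime c')
                (maxn (words st + maxn (words (cval t) + cspace t)
                                       (words (cval c) + cspace c))
                      (cspace c')))
           (while test body fuel' (cval c))
    else Some (Timed st (ctime t) (words st + (words (cval t) + cspace t)))
  else None.

Definition pbind (A B : Type) {SA : Sized A} (m : option (timed A))
    (f : A -> option (timed B)) : option (timed B) :=
  if m is Some c then omap (fun c' => bind c (fun _ => c')) (f (cval c))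
  else None.

Notation "'let?' x ':=' m 'in' f" := (pbind m (fun x => f))
  (at level 200, x name, m at level 200, f at level 200).

(** * Nystrom approximation in factored form *)

(* The indices of the selected points, the n x s block [fV] of the kernel
   matrix, and the Cholesky factor [fL] of the s x s block A. *)
Record nys_factor (R : realType) (n : nat) := NysFactor {
  pts : seq 'I_n;
  fV : 'M[R]_(n, size pts);
  fL : 'M[R]_(size pts)
}.

#[global] Instance words_factor (R : realType) (n : nat) : Sized (nys_factor R n) :=
  fun F => (size (pts F) + words (fV F) + words (fL F))%N.

Definition Ktilde (R : realType) (n : nat) (F : nys_factor R n) : 'M[R]_n :=
  fV F *m invmx (fL F *m (fL F)^T) *m (fV F)^T.

Record nystrom_factor (R : realType) (n d : nat) (X : 'I_n -> 'cV[R]_d)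
    (eta : R) (s : nat) (F : nys_factor R n) : Prop := {
  nf_size : size (pts F) = minn s n;
  nf_uniq : uniq (pts F);
  nf_V : fV F = \matrix_(i, j) gauss eta (X i) (X (tnth (in_tuple (pts F)) j));
  nf_trig : is_trig_mx (fL F);
  nf_diag : forall j, 0 < fL F j j;
  nf_chol : fL F *m (fL F)^T =
    \matrix_(j, j') gauss eta (X (tnth (in_tuple (pts F)) j))
                              (X (tnth (in_tuple (pts F)) j'))
}.

(* What is assumed, with constant CN in the O(.) bounds, of the random subset
   selection: [ny s w] is the call with parameter [s], where [w] is the random
   seed.  The joint law of the calls for different values of [s] is arbitrary;
   independent calls are a particular case. *)
Record nystrom_guarantee (R : realType) (n d : nat) (X : 'I_n -> 'cV[R]_d)
    (eta CN : R) (disp : measure_display) (Om : measurableType disp)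
    (Pr : probability Om R) (ny : nat -> Om -> timed (nys_factor R n)) : Prop := {
  ny_factor : forall s w, (0 < s)%N -> nystrom_factor X eta s (cval (ny s w));
  ny_time : forall s w, (0 < s)%N ->
    (ctime (ny s w))%:R <= CN * (n * s ^ 2 + s ^ 3)%:R;
  ny_space : forall s w, (0 < s)%N ->
    (cspace (ny s w))%:R <= CN * (n * (s + d))%:R;
  ny_measurable : forall s (l : seq 'I_n), (0 < s)%N ->
    measurable [set w | pts (cval (ny s w)) = l];
  ny_accuracy : forall s (tau delta' : R), (0 < s)%N -> 0 < tau -> 0 < delta' ->
    400 * d_eff X eta tau * ln (3 * n%:R / delta') <= s%:R ->
    ((1 - delta')%:E <= Pr [set w |
      (opnorm (kernel_mx X eta - Ktilde (cval (ny s w))) <= tau * n%:R)%R])%E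
}.

Definition set_entry (R : realType) (m : nat) (b : 'cV[R]_m) (j : 'I_m) (x : R) :
    'cV[R]_m :=
  \col_k (if k == j then x else b k 0).

(* Solution b of M b = a for a triangular M; the coordinates, initially 0, are
   computed in the order [l]. *)
Definition trsolve (R : realType) (m : nat) (M : 'M[R]_m) (l : seq 'I_m)
    (a : 'cV[R]_m) : timed 'cV[R]_m :=
  cfold (fun (j : 'I_m) (b : 'cV[R]_m) =>
    let$ s := csum (fun k => rmul (M j k) (b k 0)) in
    let$ t := rsub (a j 0) s in
    let$ x := rdiv t (M j j) in
    ret (set_entry b j x)) l 0.

Definition forward (R : realType) (m : nat) (L : 'M[R]_m) (a : 'cV[R]_m) :=
  trsolve L (enum 'I_m) a.
Definition backward (R : realType) (m : nat) (L : 'M[R]_m) (a : 'cV[R]_m) :=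
  trsolve L^T (rev (enum 'I_m)) a.

(* Matrix-vector product with the (symmetric) matrix [Ktilde F]. *)
Definition matvec (R : realType) (n : nat) (F : nys_factor R n) (v : 'cV[R]_n) :
    timed 'cV[R]_n :=
  let$ a := tab (fun j => csum (fun i => rmul (fV F i j) (v i 0))) in
  let$ b := forward (fL F) a in
  let$ c := backward (fL F) b in
  tab (fun i => csum (fun j => rmul (fV F i j) (c j 0))).

(** * AdaptiveNystrom *)

(* 1 - min_i (Ktilde F)_ii <= tau *)
Definition stop_test (R : realType) (n : nat) (F : nys_factor R n) (tau : R) :
    timed bool :=
  let$ m := cmin1 (fun i : 'I_n =>
    let$ b := forward (fL F) (row i (fV F))^T in
    csum (fun k => rmul (b k 0) (b k 0))) in
  let$ g := rsub 1 m in
  rle g tau.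

Fixpoint adaptive_nystrom (R : realType) (n : nat) (ny : nat -> timed (nys_factor R n))
    (tau : R) (fuel s : nat) : option (timed (nys_factor R n)) :=
  if fuel is fuel'.+1 then
    let c := let$ F := ny s in let$ b := stop_test F tau in ret (F, b) in
    if (cval c).2 then Some (after c (ret (cval c).1))
    else omap (after c) (adaptive_nystrom ny tau fuel' (2 * s)%N)
  else None.

(** * Sinkhorn *)

Definition smooth (R : realType) (n : nat) (t : R) (p : 'cV[R]_n) : 'cV[R]_n :=
  (1 - t) *: p + (t / n%:R) *: ones R n.

Definition scaled (R : realType) (n : nat) (K : 'M[R]_n) (D : 'cV[R]_n * 'cV[R]_n) :
    'M[R]_n :=
  diag_mx D.1^T *m K *m diag_mx D.2^T.

Definition sinkhorn_err (R : realType) (n : nat) (K : 'M[R]_n) (p q : 'cV[R]_n)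
    (D : 'cV[R]_n * 'cV[R]_n) : R :=
  normL1 (scaled K D *m ones R n - p) + normL1 ((scaled K D)^T *m ones R n - q).

Fixpoint sinkhorn_iter (R : realType) (n : nat) (K : 'M[R]_n) (p q : 'cV[R]_n)
    (k : nat) : 'cV[R]_n * 'cV[R]_n :=
  if k is k'.+1 then
    let D := sinkhorn_iter K p q k' in
    if odd k' then (D.1, \col_j (q j 0 / (K^T *m D.1) j 0))
    else (\col_i (p i 0 / (K *m D.2) i 0), D.2)
  else (ones R n, ones R n).

(* The known convergence rate, with constant CS.  For entries larger than 1 the
   logarithm could be negative. *)
Definition sinkhorn_rate (R : realType) (CS : R) : Prop :=
  forall (n : nat) (K : 'M[R]_n) (p q : 'cV[R]_n) (delta0 : R),
    (2 <= n)%N -> (forall i j, 0 < K i j <= 1) ->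
    simplex p -> simplex q -> 0 < delta0 <= 1 ->
    let p' := smooth (delta0 / 8) p in
    let q' := smooth (delta0 / 8) q in
    let Kmin := \big[Num.min/1]_i \big[Num.min/1]_j K i j in
    exists k : nat,
      k%:R <= CS * delta0^-1 * ln (n%:R / (delta0 * Kmin)) /\
      sinkhorn_err K p' q' (sinkhorn_iter K p' q' k) <= delta0 / 2.

Definition csmooth (R : realType) (n : nat) (t : R) (p : 'cV[R]_n) :
    timed 'cV[R]_n :=
  let$ a := rsub 1 t in
  let$ b := rdiv t n%:R in
  tab (fun i => let$ x := rmul a (p i 0) in radd x b).

(* Row sums of D1 Ktilde D2, as the entrywise product of D1 and Ktilde D2 1;
   exchanging [d1] and [d2] gives the column sums. *)
Definition marginal (R : realType) (n : nat) (F : nys_factor R n) (d1 d2 : 'cV[R]_n) :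
    timed 'cV[R]_n :=
  let$ u := matvec F d2 in tab (fun i => rmul (d1 i 0) (u i 0)).

Definition dist1 (R : realType) (n : nat) (u v : 'cV[R]_n) : timed R :=
  csum (fun i => let$ x := rsub (u i 0) (v i 0) in rabs x).

(* The boolean tells whether the next update is one of the rows. *)
Definition sk_state (R : realType) (n : nat) : Type :=
  ('cV[R]_n * 'cV[R]_n * bool)%type.
#[global] Instance words_sk_state (R : realType) (n : nat) :
  Sized (sk_state R n) := @words_pair _ _ (@words_pair _ _ _ _) _.

Definition sk_test (R : realType) (n : nat) (F : nys_factor R n) (p' q' : 'cV[R]_n)
    (delta0 : R) (st : sk_state R n) : timed bool :=
  let: (d1, d2, _) := st in
  let$ u := marginal F d1 d2 in
  let$ a := dist1 u p' in
  let$ v := marginal F d2 d1 in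
  let$ b := dist1 v q' in
  let$ e := radd a b in
  let$ h := rdiv delta0 2 in
  rlt h e.

Definition sk_body (R : realType) (n : nat) (F : nys_factor R n) (p' q' : 'cV[R]_n)
    (st : sk_state R n) : timed (sk_state R n) :=
  let: (d1, d2, rows) := st in
  if rows then
    let$ u := matvec F d2 in
    let$ d1' := tab (fun i => rdiv (p' i 0) (u i 0)) in
    ret (d1', d2, false)
  else
    let$ v := matvec F d1 in
    let$ d2' := tab (fun j => rdiv (q' j 0) (v j 0)) in
    ret (d1, d2', true).

Definition sk_value (R : realType) (n : nat) (F : nys_factor R n) (eta : R)
    (d1 d2 : 'cV[R]_n) : timed R :=
  let$ u := marginal F d1 d2 in
  let$ a := csum (fun i => let$ l := rln (d1 i 0) in rmul l (u i 0)) in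
  let$ v := marginal F d2 d1 in
  let$ b := csum (fun j => let$ l := rln (d2 j 0) in rmul l (v j 0)) in
  let$ c := radd a b in
  rdiv c eta.

Definition sinkhorn (R : realType) (n : nat) (fuel : nat) (F : nys_factor R n)
    (eta : R) (p q : 'cV[R]_n) (delta0 : R) :
    option (timed ('cV[R]_n * 'cV[R]_n * R)) :=
  let? t := Some (rdiv delta0 8) in
  let? p' := Some (csmooth t p) in
  let? q' := Some (csmooth t q) in
  let? st := while (sk_test F p' q' delta0) (sk_body F p' q') fuel
               (ones R n, ones R n, true) in
  let: (d1, d2, _) := st in
  let? W := Some (sk_value F eta d1 d2) in
  Some (ret (d1, d2, W)).

(** * Round *)

(* The matrix diag(gl) Ktilde diag(gr) + ge gf^T. *)
Record plan (R : realType) (n : nat) := Plan {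
  gF : nys_factor R n;
  gl : 'cV[R]_n;
  gr : 'cV[R]_n;
  ge : 'cV[R]_n;
  gf : 'cV[R]_n
}.

#[global] Instance words_plan (R : realType) (n : nat) : Sized (plan R n) :=
  fun G => (words (gF G) + words (gl G) + words (gr G) + words (ge G)
            + words (gf G))%N.

Definition plan_mx (R : realType) (n : nat) (G : plan R n) : 'M[R]_n :=
  scaled (Ktilde (gF G)) (gl G, gr G) + ge G *m (gf G)^T.

Definition round_plan (R : realType) (n : nat) (F : nys_factor R n) (d1 d2 : 'cV[R]_n)
    (p q : 'cV[R]_n) : timed (plan R n) :=
  let$ u := marginal F d1 d2 in
  let$ x := tab (fun i => let$ z := rdiv (p i 0) (u i 0) in rmin z 1) in
  let$ l := tab (fun i => rmul (x i 0) (d1 i 0)) in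
  let$ v := marginal F d2 l in
  let$ y := tab (fun j => let$ z := rdiv (q j 0) (v j 0) in rmin z 1) in
  let$ r := tab (fun j => rmul (d2 j 0) (y j 0)) in
  let$ u'' := marginal F l r in
  let$ er := tab (fun i => rsub (p i 0) (u'' i 0)) in
  let$ v'' := marginal F r l in
  let$ ec := tab (fun j => rsub (q j 0) (v'' j 0)) in
  let$ m := csum (fun i => rabs (er i 0)) in
  let$ b := rle m 0 in
  let$ f := tab (fun j => if b then ret 0 else rdiv (ec j 0) m) in
  ret (Plan F l r er f).

(** * Nys-Sink *)

Record output (R : realType) (n : nat) := Output {
  out_plan : plan R n;
  out_W : R;
  out_r : nat
}.

Definition ceps (R : realType) (n : nat) (Rad eta eps : R) : timed R :=
  let$ a := rmul Rad Rad in
  let$ b := rmul 4 a in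
  let$ c := rmul b eta in
  let$ e := rmul eta eps in
  let$ f := rdiv n%:R e in
  let$ g := rln f in
  let$ h := radd c g in
  let$ k := rmul 50 h in
  let$ m := rdiv e k in
  rmin 1 m.

Definition ctau (R : realType) (Rad eta eps' : R) : timed R :=
  let$ a := rmul Rad Rad in
  let$ b := rmul (- 4) eta in
  let$ c := rmul b a in
  let$ e := rexp c in
  let$ h := rdiv eps' 2 in
  rmul h e.

(* Here the kernel matrix of the input points is only accessible through [ny].
   The rank of Ktilde is returned as the number of selected points. *)
Definition nys_sink_body (R : realType) (n : nat) (ny : nat -> timed (nys_factor R n))
    (Rad eta eps : R) (p q : 'cV[R]_n) (fuel : nat) : option (timed (output R n)) :=
  let? eps' := Some (ceps n Rad eta eps) in
  let? tau := Some (ctau Rad eta eps') in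
  let? F := adaptive_nystrom ny tau fuel 2 in
  let? DW := sinkhorn fuel F eta p q eps' in
  let: (d1, d2, W) := DW in
  let? G := Some (round_plan F d1 d2 p q) in
  Some (ret (Output G W (size (pts F)))).

(* The input (n points of R^d, p, q, and the scalars Rad, eta, eps) also
   occupies memory. *)
Definition nys_sink (R : realType) (n d : nat) (ny : nat -> timed (nys_factor R n))
    (Rad eta eps : R) (p q : 'cV[R]_n) (fuel : nat) : option (timed (output R n)) :=
  omap (fun c : timed (output R n) =>
          Timed (cval c) (ctime c) (n * d + 2 * n + 3 + cspace c))
       (nys_sink_body ny Rad eta eps p q fuel).

Definition nys_sink_returns (R : realType) (n d : nat)
    (ny : nat -> timed (nys_factor R n)) (Rad eta eps : R) (p q : 'cV[R]_n)
    (c : timed (output R n)) : Prop :=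
  exists fuel, nys_sink d ny Rad eta eps p q fuel = Some c.

(* Main.v *)
Require Import Defs.
From HB Require Import structures.
From mathcomp Require Import all_boot all_order all_algebra.
From mathcomp Require Import all_classical all_reals all_analysis.
From mathcomp Require Import ring lra zify.
From mathcomp Require complex.
Set Implicit Arguments.
Unset Strict Implicit.
Unset Printing Implicit Defensive.
Import Order.TTheory GRing.Theory Num.Theory.
Import numFieldNormedType.Exports.
Local Open Scope ring_scope.
Local Open Scope classical_set_scope.

(* Write L = 4 R^2 eta + ln (n / (eta eps)) and let Kt be the accepted Nystrom
   matrix.  The residual K - Kt is a Schur complement of the Gaussian kernel
   matrix, hence positive semidefinite, so the diagonal test of AdaptiveNystrom
   bounds all its entries; thus ln Kt differs from - eta C by at most eps'.
   A scaling D1 Kt D2 minimizes the objective of the cost - ln Kt / eta among the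
   matrices with the same marginals, and rounding moves a matrix in l1 norm by at
   most twice its marginal error.  The modulus of continuity of x ln (1/x) turns
   this into errors O(eps' L) in the objective, both when D1 Kt D2 is rounded to
   the marginals (p, q) and when the optimal plan is rounded to the marginals of
   D1 Kt D2.  The bound on KL follows from minimality of the optimal plan along
   segments.  On the probabilistic side, every run accepts at the first power of
   two above 400 d_eff(tau) ln (3 n / delta), with tau n the tolerance of the test,
   on the event of the Nystrom guarantee, because a diagonal entry is at most the
   operator norm.  As K has trace n, d_eff(tau) >= 1 / (1 + tau), which absorbs
   additive constants. *)


(** * The function x ln(1/x) *)

(** The scaling is optimal only for its own marginals, and its mass need not be 1, so its
    regularized value cannot be compared with [W_eta] directly; rounding the optimal plan towards
    these marginals supplies the comparison without a stability theorem for [W_eta]. Since x ln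
    (1/x) has infinite slope at 0, its modulus carries a free threshold theta: slope about ln
    (1/theta), plus an error theta for each of the n^2 entries. The choice n^2 theta = eta eps / 50
    keeps ln (1/theta) below 2 L, and the factor 50 in eps' then leaves room for all errors. For KL,
    positivity of the optimal plan is not known beforehand: points inside the segment keep the
    denominators positive, and the parameter tends to 0 only after the supports have been compared.
    As the run stops at its first accepted size, acceptance at one given size already bounds the
    returned rank; a single call is inspected, so arbitrary joint laws of the calls are covered. *)

Lemma ln_le_subr1 (R : realType) (x : R) : 0 < x -> ln x <= x - 1.
Proof. by move=> x0; have := @le_ln1Dx R (x - 1); rewrite subrKC; apply; lra. Qed.

Lemma mul_ln_ratio_le (R : realType) (a b : R) : 0 <= a -> 0 < b ->
  a * ln (b / a) <= b - a.
Proof.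
rewrite le_eqVlt => /predU1P[<-|a0] b0; first by rewrite mul0r; lra.
have := @ln_le_subr1 R (b / a) (divr_gt0 b0 a0) => /(ler_wpM2l (ltW a0)).
by rewrite mulrBr mulrCA mulfV ?gt_eqF // !mulr1.
Qed.

Definition negxlnx (R : realType) (x : R) := x * ln x^-1.

(** Split [(x + h) * ln (1 / (x + h))] along [x] and [h]; each logarithm grows when [x + h] is
    replaced by one summand. *)
Lemma negxlnxD_le (R : realType) (x h : R) : 0 <= x -> 0 <= h ->
  negxlnx (x + h) <= negxlnx x + negxlnx h.
Proof.
rewrite /negxlnx le_eqVlt => /predU1P[<-|x0]; first by rewrite mul0r !add0r.
rewrite le_eqVlt => /predU1P[<-|h0]; first by rewrite mul0r !addr0.
have xh : 0 < x + h by lra.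
rewrite !lnV ?posrE // !mulrN -opprD lerN2 mulrDl lerD //.
  by apply: ler_wpM2l; [lra | rewrite ler_ln ?posrE //; lra].
by apply: ler_wpM2l; [lra | rewrite ler_ln ?posrE //; lra].
Qed.

(** Sum of the tangent bounds [x * ln ((x + h) / x) <= h] and [h * ln (x + h) <= h * (x + h - 1)],
    in which the terms [h] cancel. *)
Lemma negxlnx_le_add (R : realType) (x h : R) : 0 <= x -> 0 <= h ->
  negxlnx x <= negxlnx (x + h) + h * (x + h).
Proof.
rewrite /negxlnx le_eqVlt => /predU1P[<-|x0].
  rewrite mul0r !add0r le_eqVlt => /predU1P[<-|h0]; first by rewrite !mul0r add0r.
  rewrite lnV ?posrE // -mulrDr mulr_ge0 ?ltW //.
  by have := ln_le_subr1 h0; lra.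
rewrite le_eqVlt => /predU1P[<-|h0]; first by rewrite mul0r !addr0.
have xh : 0 < x + h by lra.
have h1 := @mul_ln_ratio_le R x (x + h) (ltW x0) xh.
have h2 : h * ln (x + h) <= h * (x + h - 1).
  by apply: ler_wpM2l; [lra | exact: ln_le_subr1].
rewrite !lnV ?posrE //; rewrite ln_div ?posrE // in h1; nra.
Qed.

(** The right-hand side is the tangent at [theta] of the concave function [negxlnx]. It trades the
    infinite slope at 0 for [ln theta^-1] and an additive [theta]. *)
Lemma negxlnx_le (R : realType) (h theta : R) : 0 <= h -> 0 < theta ->
  negxlnx h <= h * ln theta^-1 + theta - h.
Proof.
rewrite /negxlnx le_eqVlt => /predU1P[<-|h0] t0; first by rewrite !mul0r; lra.
have := @mul_ln_ratio_le R h theta (ltW h0) t0.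
by rewrite ln_div ?posrE // !lnV ?posrE //; nra.
Qed.

(** For [x <= y] the increment is bounded above by subadditivity and the tangent at [theta], below
    by [negxlnx_le_add]. The range [0, 2] accommodates scalings, whose mass is only known to be at
    most 2. *)
Lemma negxlnx_modulus (R : realType) (x y theta : R) :
  0 <= x <= 2 -> 0 <= y <= 2 -> 0 < theta <= 1 ->
  `|negxlnx x - negxlnx y| <= `|x - y| * (ln theta^-1 + 2) + theta.
Proof.
move=> hx hy ht.
have lt0 : 0 <= ln theta^-1 by rewrite ln_ge0 // invf_ge1; lra.
wlog xy : x y hx hy / x <= y.
  move=> H; case: (leP x y) => [|/ltW] h; first exact: H.
  by rewrite distrC (distrC x); apply: H.
have [h yE h0] : exists2 h, y = x + h & 0 <= h by exists (y - x); lra.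

subst y.
have e1 := @negxlnxD_le R x h (proj1 (andP hx)) h0.
have e2 := @negxlnx_le_add R x h (proj1 (andP hx)) h0.
have e3 := @negxlnx_le R h theta h0 (proj1 (andP ht)).
rewrite (distrC x) addrAC subrr add0r (ger0_norm h0) ler_norml.
have hL : 0 <= h * ln theta^-1 by apply: mulr_ge0.
have h2 : 0 <= h * (2 - (x + h)) by apply: mulr_ge0; lra.
by apply/andP; split; lra.
Qed.

(** * The regularized transport plan *)

Lemma mul_onesE (R : realType) (m n : nat) (A : 'M[R]_(m, n)) i :
  (A *m ones R n) i 0 = \sum_j A i j.
Proof. by rewrite mxE; apply: eq_bigr => j _; rewrite mxE mulr1. Qed.

Lemma couplingsP (R : realType) (n : nat) (p q : 'cV[R]_n) (P : 'M[R]_n) :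
  couplings p q P <-> [/\ forall i j, 0 <= P i j,
    forall i, \sum_j P i j = p i 0 & forall j, \sum_i P i j = q j 0].
Proof.
split=> -[P0 rP cP]; split=> //.
- by move=> i; rewrite -rP mul_onesE.
- by move=> j; rewrite -cP mul_onesE; apply: eq_bigr => i _; rewrite mxE.
- by apply/colP => i; rewrite mul_onesE.
- apply/colP => j; rewrite mul_onesE -cP.
  by apply: eq_bigr => i _; rewrite mxE.
Qed.

Lemma couplings_mass (R : realType) (n : nat) (p q : 'cV[R]_n) (P : 'M[R]_n) :
  couplings p q P -> \sum_i \sum_j P i j = \sum_i p i 0.
Proof. by move=> /couplingsP[_ rP _]; apply: eq_bigr => i _. Qed.

Lemma ler_mass (R : realType) (n : nat) (P : 'M[R]_n) i j :
  (forall i j, 0 <= P i j) -> P i j <= \sum_i \sum_j P i j.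
Proof.
move=> P0; rewrite (bigD1 i) //= (bigD1 j) //=.
by rewrite -addrA lerDl addr_ge0 ?sumr_ge0 // => k _; rewrite sumr_ge0.
Qed.

Lemma couplings_itv (R : realType) (n : nat) (p q : 'cV[R]_n) (P : 'M[R]_n) i j :
  simplex p -> couplings p q P -> 0 <= P i j <= 1.
Proof.
move=> [_ p1] cP; have [P0 _ _] := (iffLR (couplingsP _ _ _)) cP.
by rewrite P0 -p1 -(couplings_mass cP) ler_mass.
Qed.

Lemma couplings_nonempty (R : realType) (n : nat) (p q : 'cV[R]_n) :
  simplex p -> simplex q -> couplings p q (p *m q^T).
Proof.
move=> [p0 p1] [q0 q1]; have E i j : (p *m q^T) i j = p i 0 * q j 0.
  by rewrite mxE big_ord1 mxE.
apply/couplingsP; split=> [i j|i|j]; first by rewrite E mulr_ge0.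
  by rewrite (eq_bigr _ (fun j _ => E i j)) -mulr_sumr q1 mulr1.
by rewrite (eq_bigr _ (fun i _ => E i j)) -mulr_suml p1 mul1r.
Qed.

Lemma cvg_sumr (R : realType) (T : Type) (F : set_system T) (FF : Filter F)
    (I : Type) (r : seq I) (f : I -> T -> R) (a : I -> R) :
  (forall i, f i x @[x --> F] --> a i) ->
  (\sum_(i <- r) f i x) @[x --> F] --> \sum_(i <- r) a i.
Proof. by move=> H; apply: cvg_big => //; exact: add_continuous. Qed.

Lemma continuous_sumr (R : realType) (T : topologicalType)
    (I : Type) (r : seq I) (f : I -> T -> R) :
  (forall i, continuous (f i)) -> continuous (fun x => \sum_(i <- r) f i x).
Proof. by move=> H x; apply: (cvg_sumr (nbhs_filter x)) => i; exact: H. Qed.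

Lemma negxlnx_cvg (R : realType) (T : Type) (F : set_system T) (FF : Filter F)
    (f : T -> R) (a : R) : 0 <= a <= 1 ->
  f x @[x --> F] --> a -> negxlnx (f x) @[x --> F] --> negxlnx a.
Proof.
(* Passing to the positive part of [f x] changes nothing, since [ln] is 0 on nonpositive reals; the
   modulus asks for nonnegative arguments. *)
move=> ha fa; apply: (cvg_trans (G := negxlnx (Num.max 0 (f x)) @[x --> F])).
  apply: near_eq_cvg; near=> x; rewrite maxEle; case: ifPn => // /negbTE.
  by rewrite leNgt => /negbFE fx; rewrite /negxlnx !(@ln0 _ _^-1) ?mulr0 // invr_le0 ltW.
apply/cvgrPdist_le => e e0.
pose th := Num.min 1 (e / 2).
have th0 : 0 < th by rewrite lt_min ltr01 divr_gt0.
have th1 : th <= 1 by rewrite ge_min lexx.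
have the : th <= e / 2 by rewrite ge_min lexx orbT.
have L0 : 0 <= ln th^-1 by rewrite ln_ge0 // invf_ge1.
pose d := Num.min 1 (e / (2 * (ln th^-1 + 2))).
have d0 : 0 < d by rewrite lt_min ltr01 divr_gt0 //; lra.
have de : d * (ln th^-1 + 2) <= e / 2.
  apply: (@le_trans _ _ (e / (2 * (ln th^-1 + 2)) * (ln th^-1 + 2))).
    by rewrite ler_wpM2r ?ge_min ?lexx ?orbT //; lra.
  by rewrite invfM mulrA mulfVK ?le_refl //; lra.
move/cvgrPdist_le : fa => /(_ d d0).
apply: filterS => x hx.
have mx : `|a - Num.max 0 (f x)| <= `|a - f x|.
  rewrite maxEle; case: ifPn => // /negbTE; rewrite leNgt => /negbFE fx.
  by rewrite !ger0_norm; lra.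
have d1 : d <= 1 by rewrite ge_min lexx.
have m2 : 0 <= Num.max 0 (f x) <= 2.
  rewrite le_max lexx /=; move: mx hx; rewrite (ler_norml (a - f x)) => + /andP[].
  rewrite ge_max; lra.
apply: (le_trans (@negxlnx_modulus R a (Num.max 0 (f x)) th _ m2 _)); try lra.
apply: (@le_trans _ _ (d * (ln th^-1 + 2) + th)); last lra.
by rewrite lerD2r ler_wpM2r //; [lra | exact: le_trans mx hx].
Unshelve. all: by end_near. Qed.

Lemma objectiveE (R : realType) (n : nat) (M : 'M[R]_n) (eta : R) (P : 'M[R]_n) :
  objective M eta P =
  \sum_i \sum_j (M i j * P i j - eta^-1 * negxlnx (P i j)).
Proof.
rewrite /objective /entropy mulr_sumr -sumrB; apply: eq_bigr => i _.
by rewrite mulr_sumr -sumrB.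
Qed.

Lemma objective_cvg (R : realType) (n : nat) (M : 'M[R]_n) (eta : R) (T : Type)
    (F : set_system T) (FF : Filter F) (f : T -> 'M[R]_n) (P : 'M[R]_n) :
  (forall i j, 0 <= P i j <= 1) ->
  (forall i j, f x i j @[x --> F] --> P i j) ->
  objective M eta (f x) @[x --> F] --> objective M eta P.
Proof.
move=> P01 fP; rewrite objectiveE; under eq_cvg do rewrite objectiveE.
apply: cvg_sumr => i; apply: cvg_sumr => j; apply: cvgB; apply: cvgM => //.
- exact: cvg_cst.
- exact: cvg_cst.
- exact: negxlnx_cvg.
Qed.

Lemma P_eta_minimizes (R : realType) (n d : nat) (X : 'I_n -> 'cV[R]_d) (eta : R)
    (p q : 'cV[R]_n) : simplex p -> simplex q ->
  couplings p q (P_eta X eta p q) /\ forall Q, couplings p q Q ->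
    objective (cost_mx X) eta (P_eta X eta p q) <= objective (cost_mx X) eta Q.
Proof.
move=> sp sq; rewrite /P_eta; set S := [set P | _].
suff [P SP] : S !=set0 by have := @xgetPex _ (0 : 'M[R]_n) S (ex_intro _ P SP); apply.
(* Couplings are seen as row vectors so that [bounded_closed_compact] applies. *)
pose A : set 'rV[R]_(n * n) := [set v | couplings p q (vec_mx v)].
have ccv i j : continuous (fun v : 'rV[R]_(n * n) => (vec_mx v : 'M[R]_n) i j).
  rewrite (_ : (fun v => _) = fun v : 'rV[R]_(n * n) => v 0 (mxvec_index i j)).
    by move=> v; exact: coord_continuous.
  by apply/funext => v; rewrite mxE.
have cA : compact A.
  apply: bounded_closed_compact.
    exists 1; split=> // x x1 v Av; apply: le_trans (ltW x1).
    rewrite [leLHS]/Num.Def.normr /= mx_normrE; apply: bigmax_le => // -[i k] _ /=.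
    rewrite ord1; case/mxvec_indexP: k => a b.
    have := couplings_itv a b sp Av; rewrite mxE => h; rewrite ger0_norm; lra.
  have -> : A = (\bigcap_i \bigcap_j
       ((fun v => (vec_mx v : 'M[R]_n) i j) @^-1` [set x | 0 <= x])) `&`
     ((\bigcap_i ((fun v => \sum_j (vec_mx v : 'M[R]_n) i j) @^-1`
                   [set x | x = p i 0])) `&`
      (\bigcap_j ((fun v => \sum_i (vec_mx v : 'M[R]_n) i j) @^-1`
                   [set x | x = q j 0]))).
    apply/seteqP; split=> v /=.
      move=> /couplingsP[v0 rv cv]; split=> [i _ j _|]; first exact: v0.
      by split=> [i _|j _]; [exact: rv | exact: cv].
    move=> [v0 [rv cv]]; apply/couplingsP; split=> [i j|i|j].
    - exact: (v0 i I j I).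
    - exact: (rv i I).
    - exact: (cv j I).
  apply: closedI; last apply: closedI.
  - apply: closed_bigI => i _; apply: closed_bigI => j _.
    by apply: closed_comp; [move=> v _; exact: ccv | exact: closed_ge].
  - apply: closed_bigI => i _; apply: closed_comp; last exact: closed_eq.
    by move=> v _; apply: continuous_sumr => j; exact: ccv.
  - apply: closed_bigI => j _; apply: closed_comp; last exact: closed_eq.
    by move=> v _; apply: continuous_sumr => i; exact: ccv.
have A0 : A !=set0.
  by exists (mxvec (p *m q^T)); rewrite /A /= mxvecK; exact: couplings_nonempty.
(* Continuity is claimed within [A] only: there the limit has entries in [0, 1], as [negxlnx_cvg]
   asks. *)
have cf : {within A, continuous
    (fun v => objective (cost_mx X) eta (vec_mx v : 'M[R]_n))}.
  apply: continuous_in_subspaceT => v; rewrite inE => Av.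
  apply: (@objective_cvg R n _ eta _ (nbhs v) (nbhs_filter v) (fun v => vec_mx v) (vec_mx v)) => [i j|i j]; first exact: couplings_itv sp Av.
  exact: ccv.
have [v vA vmin] := compact_EVT_min A0 cA cf.
exists (vec_mx v); split; first by rewrite inE in vA.
by move=> Q cQ; rewrite -(mxvecK Q); apply: vmin; rewrite inE /A /= mxvecK.
Qed.

(** * Strong convexity of the objective and relative entropy to its minimizer *)

Lemma ler_sumr2 (R : realType) (m n : nat) (f g : 'I_m -> 'I_n -> R) :
  (forall i j, f i j <= g i j) -> \sum_i \sum_j f i j <= \sum_i \sum_j g i j.
Proof. by move=> H; apply: ler_sum => i _; apply: ler_sum => j _. Qed.

Lemma ln_ratio_ge (R : realType) (b m : R) : 0 <= b -> 0 <= m -> (0 < b -> 0 < m) ->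
  b - m <= b * ln (b / m).
Proof.
move=> b0 m0 H; case: (ltrgt0P b) b0 => [bp|//|->] _; last by rewrite mul0r; lra.
have mp := H bp; have := @mul_ln_ratio_le R b m (ltW bp) mp.
by rewrite !ln_div ?posrE //; lra.
Qed.

(* Strong concavity of [negxlnx] along a segment: the relative-entropy gain at
   the end [b] is kept, the one at the end [a] is bounded below. *)
Lemma negxlnx_segment (R : realType) (a b t : R) : 0 <= a -> 0 <= b -> 0 < t <= 1 ->
  let m := a + t * (b - a) in
  (1 - t) * negxlnx a + t * negxlnx b + t * (b * ln (b / m))
    + (1 - t) * (t * (a - b)) <= negxlnx m.
Proof.
move=> a0 b0 ht /=; set m := a + t * (b - a); have mE : m = (1 - t) * a + t * b by rewrite /m; ring.
have m0 : 0 <= m by rewrite mE addr_ge0 // mulr_ge0 //; lra.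
have tb0 : 0 <= t * b by rewrite mulr_ge0 //; lra.
have ta0 : 0 <= (1 - t) * a by rewrite mulr_ge0 //; lra.
have E x : 0 <= x -> (0 < x -> 0 < m) -> negxlnx x = x * ln (m / x) - x * ln m.
  move=> x0 H; rewrite /negxlnx; case: (ltrgt0P x) x0 => [xp|//|->] _; last by rewrite !mul0r; ring.
  by rewrite ln_div ?posrE ?H // lnV ?posrE //; ring.
have bm : 0 < b -> 0 < m.
  move=> bp; have tb : 0 < t * b by rewrite mulr_gt0 //; lra.
  by rewrite mE; lra.
have Eb : b * ln (b / m) = - (b * ln (m / b)).
  case: (ltrgt0P b) b0 => [bp|//|->] _; last by rewrite !mul0r; ring.
  by rewrite !ln_div ?posrE ?bm //; ring.
have [t1|t1] := eqVneq t 1.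
  have mb : m = b by rewrite /m t1; ring.
  rewrite Eb (E b b0 bm) mb t1.
  case: (ltrgt0P b) b0 => [bp|//|->] _; last by rewrite /negxlnx !mul0r; lra.
  have lb : ln b^-1 = - ln b by rewrite lnV ?posrE.
  by rewrite divff ?gt_eqF // ln1 /negxlnx lb; lra.
have t1' : 0 < 1 - t by rewrite subr_gt0 lt_neqAle t1; lra.
have am : 0 < a -> 0 < m.
  move=> ap; have ta : 0 < (1 - t) * a by rewrite mulr_gt0.
  by rewrite mE; lra.
have Em : negxlnx m = - (m * ln m).
  rewrite /negxlnx; case: (ltrgt0P m) m0 => [mp|//|->] _; last by rewrite !mul0r; ring.
  by rewrite lnV ?posrE //; ring.
rewrite Em Eb (E a a0 am) (E b b0 bm).
have Ha : a * ln (m / a) <= m - a.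
  case: (ltrgt0P a) a0 => [ap|//|->] _; last by rewrite mul0r; lra.
  by apply: mul_ln_ratio_le; [lra | exact: am].
have := ler_wpM2l (ltW t1') Ha.
have -> : (1 - t) * (m - a) = (1 - t) * (t * (b - a)) by rewrite /m; ring.
have -> : m * ln m = (1 - t) * (a * ln m) + t * (b * ln m) by rewrite {1}mE; ring.
lra.
Qed.

(** Minimality of [Q] against [Z = Q + t (P - Q)], whose objective [negxlnx_segment] bounds by the
    convex combination minus [t / eta] times the relative entropy of [P] to [Z]. The linear terms
    cancel because [P] and [Q] have equal mass, and dividing by [t] leaves the claim. *)
Lemma KL_segment_le (R : realType) (n : nat) (M : 'M[R]_n) (eta t : R)
    (p q : 'cV[R]_n) (P Q : 'M[R]_n) :
  0 < eta -> 0 < t <= 1 ->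
  couplings p q Q -> (forall Q', couplings p q Q' ->
    objective M eta Q <= objective M eta Q') -> couplings p q P ->
  \sum_i \sum_j P i j * ln (P i j / (Q i j + t * (P i j - Q i j)))
   <= eta * (objective M eta P - objective M eta Q).
Proof.
move=> e0 ht cQ minQ cP.
have [Q0 rQ lQ] := (iffLR (couplingsP _ _ _)) cQ.
have [P0 rP lP] := (iffLR (couplingsP _ _ _)) cP.
pose Z : 'M[R]_n := Q + t *: (P - Q).
have ZE i j : Z i j = Q i j + t * (P i j - Q i j) by rewrite !mxE.
have cZ : couplings p q Z.
  apply/couplingsP; split=> [i j|i|j].
  - have -> : Z i j = (1 - t) * Q i j + t * P i j by rewrite ZE; ring.
    by rewrite addr_ge0 // mulr_ge0 //; lra.
  - rewrite (eq_bigr _ (fun j _ => ZE i j)) big_split -mulr_sumr sumrB /=.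
    by rewrite rQ rP subrr mulr0 addr0.
  - rewrite (eq_bigr _ (fun i _ => ZE i j)) big_split -mulr_sumr sumrB /=.
    by rewrite lQ lP subrr mulr0 addr0.
have mass : \sum_i \sum_j (Q i j - P i j) = 0.
  rewrite big1 // => i _; by rewrite sumrB rQ rP subrr.
have step : objective M eta Z <= \sum_i \sum_j
   ((1 - t) * (M i j * Q i j - eta^-1 * negxlnx (Q i j)) +
    t * (M i j * P i j - eta^-1 * negxlnx (P i j)) -
    eta^-1 * t * (P i j * ln (P i j / Z i j)) -
    eta^-1 * (1 - t) * t * (Q i j - P i j)).
  rewrite objectiveE; apply: ler_sumr2 => i j.
  have := @negxlnx_segment R (Q i j) (P i j) t (Q0 i j) (P0 i j) ht.
  have ei0 : 0 < eta^-1 by rewrite invr_gt0.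
  rewrite /= -ZE => /(ler_wpM2l (ltW ei0)) h.
  have -> : M i j * Z i j = (1 - t) * (M i j * Q i j) + t * (M i j * P i j).
    by rewrite ZE; ring.
  lra.
have := minQ _ cZ => /le_trans/(_ step).
under eq_bigr do rewrite !big_split /= !sumrN -!mulr_sumr.
rewrite !big_split /= !sumrN -!mulr_sumr mass mulr0 subr0 -!objectiveE.
under [X in eta^-1 * t * X]eq_bigr do under eq_bigr do rewrite ZE.
set KK := \sum_i _ => h.
have {h} : eta^-1 * t * KK <= t * (objective M eta P - objective M eta Q) by lra.
have -> : eta^-1 * t * KK = t * (eta^-1 * KK) by ring.
rewrite ler_pM2l; last by lra.
by rewrite ler_pdivrMl.
Qed.

Lemma P_eta_KL_le (R : realType) (n : nat) (M : 'M[R]_n) (eta : R)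
    (p q : 'cV[R]_n) (P Q : 'M[R]_n) :
  0 < eta ->
  couplings p q Q -> (forall Q', couplings p q Q' ->
    objective M eta Q <= objective M eta Q') -> couplings p q P ->
  (KL P Q <= (eta * (objective M eta P - objective M eta Q))%:E)%E.
Proof.
move=> e0 cQ minQ cP.
have [Q0 rQ lQ] := (iffLR (couplingsP _ _ _)) cQ.
have [P0 rP lP] := (iffLR (couplingsP _ _ _)) cP.
have mass : \sum_i \sum_j (P i j - Q i j) = 0.
  rewrite big1 // => i _; by rewrite sumrB rQ rP subrr.
set c := eta * _.
have seg t (ht : 0 < t <= 1) := KL_segment_le e0 ht cQ minQ cP.
have Zp t i j : 0 < t <= 1 -> 0 < P i j -> 0 < Q i j + t * (P i j - Q i j).
  move=> ht Pp; have -> : Q i j + t * (P i j - Q i j) = (1 - t) * Q i j + t * P i j by ring.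
  by rewrite ltr_wpDl ?mulr_gt0 ?mulr_ge0 //; lra.
have Z0 t i j : 0 < t <= 1 -> 0 <= Q i j + t * (P i j - Q i j).
  move=> ht; have -> : Q i j + t * (P i j - Q i j) = (1 - t) * Q i j + t * P i j by ring.
  by rewrite addr_ge0 // mulr_ge0 //; lra.
(* An entry with [Q i j = 0 < P i j] contributes [P i j * ln (1 / t)] in [KL_segment_le], which is
   unbounded as [t] tends to 0; the other entries are bounded below because the masses agree. *)
have supp i j : Q i j = 0 -> P i j = 0.
  move=> Qij; apply/eqP; rewrite eq_le P0 andbT leNgt; apply/negP => Pp.
  (* With [t = exp (- K)] the logarithm of this entry is [K]; the value of [K] makes
     [P i j * (K - 1)] exceed [c]. *)
  pose K := `|c| / P i j + 2; have K0 : 0 <= K.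
    by rewrite addr_ge0 // divr_ge0.
  pose t := expR (- K).
  have ht : 0 < t <= 1 by rewrite expR_gt0 expR_le1 oppr_le0.
  have : P i j * (K - 1) <= c.
    have E0 : \sum_i \sum_j (1 - t) * (P i j - Q i j) = 0.
      by under eq_bigr do rewrite -mulr_sumr; rewrite -mulr_sumr mass mulr0.
    apply: le_trans (seg t ht); rewrite -[leLHS]add0r -[X in X + _]E0.
    rewrite (bigD1 i) //= (bigD1 j) //= [leRHS](bigD1 i) //= [X in _ <= X + _](bigD1 j) //=.
    have term k l : (1 - t) * (P k l - Q k l) <=
        P k l * ln (P k l / (Q k l + t * (P k l - Q k l))).
      apply: le_trans (ln_ratio_ge (P0 k l) (Z0 t k l ht) (Zp t k l ht)).
      by rewrite le_eqVlt; apply/orP; left; apply/eqP; ring.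
    have e1 : \sum_(l < n | l != j) (1 - t) * (P i l - Q i l) <=
      \sum_(l < n | l != j) P i l * ln (P i l / (Q i l + t * (P i l - Q i l))).
      by apply: ler_sum => l _.
    have e2 : \sum_(k < n | k != i) \sum_j (1 - t) * (P k j - Q k j) <=
      \sum_(k < n | k != i) \sum_j P k j * ln (P k j / (Q k j + t * (P k j - Q k j))).
      by apply: ler_sum => k _; apply: ler_sum => l _.
    have e3 : P i j * ln (P i j / (Q i j + t * (P i j - Q i j))) = P i j * K.
      rewrite Qij add0r subr0 -[X in X / _]mul1r -mulf_div divff ?gt_eqF // mulr1.
      by rewrite div1r /t -expRN opprK expRK.
    rewrite e3 Qij subr0.
    have tP : 0 <= t * P i j by rewrite mulr_ge0 //; lra.
    lra.
  have -> : P i j * (K - 1) = `|c| + P i j.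
    rewrite /K -addrA mulrDr mulrCA mulfV ?gt_eqF //; ring.
  by have := ler_norm c; lra.
rewrite /KL; case: ifPn => [/existsP[i /existsP[j /andP[/eqP Pij /eqP Qij]]]|_].
  by case: Pij; exact: supp.
rewrite lee_fin; apply/ler_addgt0Pr => e ep.
(* [t * B] is the price of replacing the point [Z] of the segment by [Q] in the denominators:
   [ln (Z / Q) <= t * P / Q] entrywise. *)
pose B := \sum_i \sum_j P i j ^+ 2 / Q i j.
have B0 : 0 <= B.
  by do 2!apply: sumr_ge0 => ? _; rewrite divr_ge0 ?sqr_ge0.
pose t := Num.min 1 (e / (B + 1)).
have t0 : 0 < t by rewrite lt_min ltr01 divr_gt0 //; lra.
have ht : 0 < t <= 1 by rewrite t0 ge_min lexx.
have tB : t * B <= e.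
  apply: (@le_trans _ _ (e / (B + 1) * (B + 1))); last by rewrite divfK ?gt_eqF //; lra.
  by apply: ler_pM; rewrite ?ge_min ?lexx ?orbT //; lra.
apply: le_trans (lerD (seg t ht) tB).
rewrite /B mulr_sumr -big_split /=; under [leRHS]eq_bigr do rewrite mulr_sumr -big_split /=.
apply: ler_sumr2 => i j.
case: (ltrgt0P (P i j)) (P0 i j) => [Pp|//|->] _; last by rewrite !expr0n /= !mul0r mulr0 addr0.
have Qp : 0 < Q i j.
  by rewrite lt0r Q0 andbT; apply/eqP => /supp E; rewrite E ltxx in Pp.
have Zij := Zp t i j ht Pp.
rewrite !ln_div ?posrE //.
have -> : t * (P i j ^+ 2 / Q i j) = P i j * (t * P i j / Q i j) by ring.
rewrite -mulrDr; apply: ler_wpM2l; first exact: ltW.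
have := @ln_le_subr1 R ((Q i j + t * (P i j - Q i j)) / Q i j) (divr_gt0 Zij Qp).
rewrite ln_div ?posrE // mulrDl divff ?gt_eqF //.
have -> : t * (P i j - Q i j) / Q i j = t * P i j / Q i j - t.
  by field; rewrite gt_eqF.
lra.
Qed.

(** * Rounding to a coupling *)

Section Rounding.
Variables (R : realType) (n : nat) (F : 'M[R]_n) (p q : 'cV[R]_n).

Definition round_row i : R := Num.min (p i 0 / \sum_j F i j) 1.
Definition round_col j : R := Num.min (q j 0 / \sum_i round_row i * F i j) 1.
Definition round_core : 'M[R]_n := \matrix_(i, j) (round_row i * F i j * round_col j).
Definition round_er i : R := p i 0 - \sum_j round_core i j.
Definition round_ec j : R := q j 0 - \sum_i round_core i j.
Definition round_defect : R := \sum_i `|round_er i|.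
Definition round_ef j : R := if round_defect <= 0 then 0 else round_ec j / round_defect.
Definition rounding : 'M[R]_n := \matrix_(i, j) (round_core i j +
  round_er i * round_ef j).

Hypothesis F0 : forall i j, 0 <= F i j.
Hypothesis p0 : forall i, 0 <= p i 0.
Hypothesis q0 : forall j, 0 <= q j 0.
Hypothesis pq : \sum_i p i 0 = \sum_j q j 0.

(** Covers [r = 0] too: then [a / r = 0], and a zero row or column stays zero. *)
Let min_ratio_mul (a r : R) : 0 <= a -> 0 <= r -> Num.min (a / r) 1 * r = Num.min a r.
Proof.
move=> a0; rewrite le_eqVlt => /predU1P[<-|r0].
  by rewrite mulr0; apply/esym/min_idPr.
by rewrite minr_pMl ?ltW // divfK ?gt_eqF // mul1r.
Qed.

Let min_ratio_itv (a r : R) : 0 <= a -> 0 <= r -> 0 <= Num.min (a / r) 1 <= 1.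
Proof. by move=> a0 r0; rewrite le_min ge_min lexx orbT divr_ge0 ?ler01. Qed.

Let x01 i : 0 <= round_row i <= 1.
Proof. by apply: min_ratio_itv => //; apply: sumr_ge0. Qed.

Let F'0 i j : 0 <= round_row i * F i j.
Proof. by rewrite mulr_ge0 //; case/andP: (x01 i). Qed.

Let y01 j : 0 <= round_col j <= 1.
Proof. by apply: min_ratio_itv => //; apply: sumr_ge0 => i _. Qed.

Let core_ge0 i j : 0 <= round_core i j.
Proof. by rewrite mxE mulr_ge0 //; case/andP: (y01 j). Qed.

Let core_le i j : round_core i j <= round_row i * F i j.
Proof. by rewrite mxE ler_piMr //; case/andP: (y01 j). Qed.

Let row_le i j : round_row i * F i j <= F i j.
Proof. by rewrite ler_piMl //; case/andP: (x01 i). Qed.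

Let row_sum i : \sum_j round_row i * F i j = Num.min (p i 0) (\sum_j F i j).
Proof. by rewrite -mulr_sumr min_ratio_mul // sumr_ge0. Qed.

Let col_sum j : \sum_i round_core i j =
  Num.min (q j 0) (\sum_i round_row i * F i j).
Proof.
under eq_bigr do rewrite mxE.
by rewrite -mulr_suml mulrC min_ratio_mul // sumr_ge0.
Qed.

Let er0 i : 0 <= round_er i.
Proof.
rewrite subr_ge0 (@le_trans _ _ (\sum_j round_row i * F i j)) //.
  by apply: ler_sum => j _; exact: core_le.
by rewrite row_sum ge_min lexx.
Qed.

Let ec0 j : 0 <= round_ec j.
Proof. by rewrite subr_ge0 col_sum ge_min lexx. Qed.

Let er_sum : round_defect = \sum_i p i 0 - \sum_i \sum_j round_core i j.
Proof. by rewrite -sumrB; apply: eq_bigr => i _; rewrite ger0_norm. Qed.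

Let ec_sum : \sum_j round_ec j = round_defect.
Proof. by rewrite er_sum sumrB pq exchange_big. Qed.

Let defect0 : 0 <= round_defect. Proof. exact: sumr_ge0. Qed.

Let er_defect : round_defect <= 0 -> forall i, round_er i = 0.
Proof.
move=> d0 i; have : round_defect == 0 by rewrite eq_le d0 defect0.
rewrite psumr_eq0 // => /allP /(_ i); rewrite mem_index_enum => /(_ isT).
by rewrite /= normr_eq0 => /eqP.
Qed.

(** After both shrinkings the missing row and column masses are nonnegative and have the same total,
    since [p] and [q] do. The rank-one term therefore has row sums [round_er] and column sums
    [round_ec]. *)
Lemma rounding_coupling : couplings p q rounding.
Proof.
apply/couplingsP; split=> [i j|i|j].
- rewrite mxE addr_ge0 // mulr_ge0 // /round_ef; case: ifP => // _.
  by rewrite divr_ge0.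
- under eq_bigr do rewrite mxE.
  rewrite big_split /=; rewrite -[X in _ + X]mulr_sumr /round_ef; case: (boolP (round_defect <= 0)) => d0 /=.
    by rewrite [X in _ * X]big1 // mulr0 addr0; apply/eqP; rewrite eq_sym -subr_eq0; apply/eqP; exact: er_defect.
  rewrite -mulr_suml ec_sum divff ?mulr1; last by rewrite gt_eqF // ltNge.
  by rewrite /round_er addrC subrK.
- under eq_bigr do rewrite mxE.
  rewrite big_split /= -[X in _ + X]mulr_suml /round_ef; case: (boolP (round_defect <= 0)) => d0 /=.
    rewrite mulr0 addr0; apply/eqP; rewrite eq_sym -subr_eq0; apply/eqP.
    have : \sum_j round_ec j == 0 by rewrite ec_sum eq_le d0 defect0.
    rewrite psumr_eq0 // => /allP /(_ j); rewrite mem_index_enum => /(_ isT).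
    by move=> /eqP.
  have -> : \sum_i round_er i = round_defect.
    by apply: eq_bigr => i _; rewrite ger0_norm.
  rewrite mulrC divfK; last by rewrite gt_eqF // ltNge.
  by rewrite /round_ec addrC subrK.
Qed.

(** Shrinking the rows removes exactly the row excess of [F], shrinking the columns at most its
    column excess, and the rank-one term adds back the mass missing from [p]. An excess is half of
    the absolute error plus half of the signed error, and the signed errors sum to a difference of
    masses. *)
Lemma rounding_dist : \sum_i \sum_j `|rounding i j - F i j| <=
  2 * (\sum_i `|\sum_j F i j - p i 0| + \sum_j `|\sum_i F i j - q j 0|).
Proof.
have corr : \sum_i \sum_j round_er i * round_ef j <= round_defect.
  rewrite /round_ef; case: (boolP (round_defect <= 0)) => d0 /=.
    by rewrite big1 // => i _; rewrite big1 // => j _; rewrite mulr0.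
  under eq_bigr do rewrite -mulr_sumr.
  rewrite -mulr_suml -mulr_suml ec_sum divff ?mulr1; last by rewrite gt_eqF // ltNge.
  by apply: ler_sum => i _; exact: ler_norm.
have shrink (a r : R) : r - Num.min a r = (`|r - a| + r - a) / 2.
  by case: (lerP a r) => h; lra.
have dist : \sum_i \sum_j `|rounding i j - F i j| <=
    \sum_i \sum_j F i j - \sum_i \sum_j round_core i j + round_defect.
  apply: le_trans (lerD (lexx _) corr).
  rewrite -sumrB -big_split; apply: ler_sum => i _ /=.
  rewrite -sumrB -big_split; apply: ler_sum => j _ /=.
  rewrite [rounding _ _]mxE addrAC; apply: le_trans (ler_normD _ _) _.
  rewrite distrC ger0_norm ?subr_ge0; last exact: le_trans (core_le _ _) (row_le _ _).
  by rewrite lerD2l ger0_norm // mulr_ge0 // /round_ef; case: ifP => // _; rewrite divr_ge0.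
have rows : \sum_i \sum_j F i j - \sum_i \sum_j round_row i * F i j =
    (\sum_i `|\sum_j F i j - p i 0| + \sum_i \sum_j F i j - \sum_i p i 0) / 2.
  rewrite -sumrB -big_split /= -sumrB mulr_suml; apply: eq_bigr => i _.
  by rewrite row_sum shrink.
have cols : \sum_i \sum_j round_row i * F i j - \sum_i \sum_j round_core i j <=
    (\sum_j `|\sum_i F i j - q j 0| + \sum_i \sum_j F i j - \sum_j q j 0) / 2.
  rewrite exchange_big [X in _ - X <= _]exchange_big [X in _ + X - _]exchange_big /=.
  rewrite -sumrB -big_split /= -sumrB mulr_suml; apply: ler_sum => j _.
  rewrite col_sum -shrink.
  have le : \sum_i round_row i * F i j <= \sum_i F i j.
    by apply: ler_sum => i _; exact: row_le.
  by case: (leP (q j 0) (\sum_i F i j)) => h1;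
     case: (leP (q j 0) (\sum_i round_row i * F i j)) => h2; lra.
have mass : \sum_i \sum_j F i j - \sum_i p i 0 <= \sum_i `|\sum_j F i j - p i 0|.
  by rewrite -sumrB; apply: ler_sum => i _; exact: ler_norm.
have D0 : 0 <= \sum_j `|\sum_i F i j - q j 0| by apply: sumr_ge0.
rewrite er_sum in dist.
(* Here [a], [b], [c] are the masses of [F], of the row-shrunk matrix and of the core, [e] and [f]
   the row and column errors, [g] the mass of [p], [h] the distance. *)
suff H (a b c e f g h : R) : a - b = (e + a - g) / 2 -> b - c <= (f + a - g) / 2 ->
    a - g <= e -> 0 <= f -> h <= a - c + (g - c) -> h <= 2 * (e + f).
  by rewrite pq in rows mass dist; exact: H rows cols mass D0 dist.
by move=> *; lra.
Qed.

End Rounding.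

(** * Optimality of scaled matrices *)

Lemma scaledE (R : realType) (n : nat) (K : 'M[R]_n) (d1 d2 : 'cV[R]_n) i j :
  scaled K (d1, d2) i j = d1 i 0 * K i j * d2 j 0.
Proof. by rewrite /scaled mul_mx_diag mxE mul_diag_mx !mxE. Qed.

(** The linear part costs at most [b] per unit of l1 distance; [negxlnx_modulus] accounts for the
    rest, its additive [th] being paid for all [n ^ 2] entries. *)
Lemma objective_modulus (R : realType) (n : nat) (M : 'M[R]_n)
    (eta b th be : R) (P Q : 'M[R]_n) :
  0 < eta -> 0 < th <= 1 -> (forall i j, `|eta * M i j| <= b) ->
  (forall i j, 0 <= P i j <= 2) -> (forall i j, 0 <= Q i j <= 2) ->
  \sum_i \sum_j `|P i j - Q i j| <= be -> 0 <= b ->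
  eta * `|objective M eta P - objective M eta Q| <=
    be * (b + ln th^-1 + 2) + n%:R ^+ 2 * th.
Proof.
move=> e0 ht Mb P2 Q2 hPQ b0.
have L0 : 0 <= ln th^-1 by rewrite ln_ge0 // invf_ge1; lra.
have -> : eta * `|objective M eta P - objective M eta Q| =
   `|\sum_i \sum_j (eta * M i j * (P i j - Q i j) - (negxlnx (P i j) - negxlnx (Q i j)))|.
  rewrite -{1}(gtr0_norm e0) -normrM !objectiveE; congr `|_|.
  rewrite -sumrB mulr_sumr; apply: eq_bigr => i _.
  rewrite -sumrB mulr_sumr; apply: eq_bigr => j _.
  by field; rewrite gt_eqF.
have -> : n%:R ^+ 2 * th = \sum_(i < n) \sum_(j < n) th.
  by rewrite !sumr_const card_ord -mulrnA -[RHS]mulr_natl natrM expr2.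
apply: le_trans (lerD (ler_wpM2r _ hPQ) (lexx _)); last lra.
rewrite mulr_suml -big_split /=; apply: le_trans (ler_norm_sum _ _ _) _.
apply: ler_sum => i _; rewrite mulr_suml -big_split /=.
apply: le_trans (ler_norm_sum _ _ _) _; apply: ler_sum => j _.
apply: le_trans (ler_normB _ _) _; rewrite normrM.
have := negxlnx_modulus (P2 i j) (Q2 i j) ht.
have := ler_wpM2r (normr_ge0 (P i j - Q i j)) (Mb i j).
move=> h1 h2; have -> : `|P i j - Q i j| * (b + ln th^-1 + 2) + th =
  b * `|P i j - Q i j| + (`|P i j - Q i j| * (ln th^-1 + 2) + th) by ring.
exact: lerD.
Qed.

Lemma objective_cost_close (R : realType) (n : nat) (M N : 'M[R]_n)
    (eta e : R) (p q : 'cV[R]_n) (P : 'M[R]_n) :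
  0 < eta -> (forall i j, `|eta * M i j - eta * N i j| <= e) ->
  simplex p -> couplings p q P ->
  eta * `|objective M eta P - objective N eta P| <= e.
Proof.
move=> e0 MN [_ p1] cP.
have [P0 _ _] := (iffLR (couplingsP _ _ _)) cP.
have -> : eta * `|objective M eta P - objective N eta P| =
   `|\sum_i \sum_j (eta * M i j - eta * N i j) * P i j|.
  rewrite -{1}(gtr0_norm e0) -normrM !objectiveE; congr `|_|.
  rewrite -sumrB mulr_sumr; apply: eq_bigr => i _.
  rewrite -sumrB mulr_sumr; apply: eq_bigr => j _; ring.
have -> : e = \sum_i \sum_j e * P i j.
  under eq_bigr do rewrite -mulr_sumr.
  by rewrite -mulr_sumr (couplings_mass cP) p1 mulr1.
apply: le_trans (ler_norm_sum _ _ _) _; apply: ler_sum => i _.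
apply: le_trans (ler_norm_sum _ _ _) _; apply: ler_sum => j _.
by rewrite normrM (ger0_norm (P0 i j)) ler_wpM2r.
Qed.

Section Gibbs.
Variables (R : realType) (n : nat) (K : 'M[R]_n) (eta : R) (d1 d2 : 'cV[R]_n).
Hypothesis eta0 : 0 < eta.
Hypothesis K0 : forall i j, 0 < K i j.
Hypothesis d10 : forall i, 0 < d1 i 0.
Hypothesis d20 : forall j, 0 < d2 j 0.

Let P := scaled K (d1, d2).
(** The cost whose Gibbs kernel [exp (- eta * M)] is [K]. *)
Definition log_cost : 'M[R]_n := \matrix_(i, j) (- eta^-1 * ln (K i j)).

Let Ppos i j : 0 < P i j. Proof. by rewrite scaledE !mulr_gt0. Qed.

Let lnP i j : ln (P i j) = ln (d1 i 0) + ln (K i j) + ln (d2 j 0).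
Proof. by rewrite scaledE !lnM ?posrE ?mulr_gt0. Qed.

Let linear (Q : 'M[R]_n) :
  \sum_i \sum_j Q i j * (ln (d1 i 0) + ln (d2 j 0)) =
  \sum_i ln (d1 i 0) * \sum_j Q i j + \sum_j ln (d2 j 0) * \sum_i Q i j.
Proof.
have -> : \sum_j ln (d2 j 0) * \sum_i Q i j = \sum_i \sum_j Q i j * ln (d2 j 0).
  rewrite exchange_big; apply: eq_bigr => j _.
  by rewrite mulrC mulr_suml.
rewrite -big_split; apply: eq_bigr => i _ /=.
rewrite mulrC mulr_suml -big_split; apply: eq_bigr => j _ /=; ring.
Qed.

(** As [ln P] is [ln K] plus the two log-scalings, cost and entropy cancel up to these potentials.
    The right-hand side is the value that Sinkhorn returns. *)
Lemma objective_scaled : objective log_cost eta P =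
  eta^-1 * (\sum_i ln (d1 i 0) * \sum_j P i j + \sum_j ln (d2 j 0) * \sum_i P i j).
Proof.
rewrite -linear objectiveE mulr_sumr; apply: eq_bigr => i _.
rewrite mulr_sumr; apply: eq_bigr => j _.
by rewrite mxE /negxlnx lnV ?posrE // lnP; ring.
Qed.

(** Gibbs variational principle: with equal marginals, the potentials contribute equally to [P] and
    [Q], and [eta] times the difference of objectives is the relative entropy of [Q] to [P]. *)
Lemma scaled_minimizes (Q : 'M[R]_n) : (forall i j, 0 <= Q i j) ->
  (forall i, \sum_j Q i j = \sum_j P i j) ->
  (forall j, \sum_i Q i j = \sum_i P i j) ->
  objective log_cost eta P <= objective log_cost eta Q.
Proof.
move=> Q0 rQ cQ; rewrite objective_scaled.
under eq_bigr do rewrite -rQ.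
under [X in _ + X]eq_bigr do rewrite -cQ.
rewrite -linear objectiveE -ler_pdivlMl ?invr_gt0 // invrK.
(* The added terms [Q i j - P i j] sum to 0; with them the inequality holds entry by entry, through
   [ln_ratio_ge]. *)
have -> : \sum_i \sum_j Q i j * (ln (d1 i 0) + ln (d2 j 0)) =
   \sum_i \sum_j (Q i j * (ln (d1 i 0) + ln (d2 j 0)) + (Q i j - P i j)).
  rewrite [RHS](eq_bigr (fun i => \sum_j Q i j * (ln (d1 i 0) + ln (d2 j 0)))) //.
  by move=> i _; rewrite big_split /= sumrB rQ subrr addr0.
rewrite mulr_sumr; apply: ler_sum => i _; rewrite mulr_sumr; apply: ler_sum => j _.
have := ln_ratio_ge (Q0 i j) (ltW (Ppos i j)) (fun=> Ppos i j).
have -> : eta * (log_cost i j * Q i j - eta^-1 * negxlnx (Q i j)) =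
    - (ln (K i j) * Q i j) - negxlnx (Q i j).
  by rewrite mxE; field; rewrite gt_eqF.
rewrite /negxlnx.
case: (ltrgt0P (Q i j)) (Q0 i j) => [Qp|//|->] _; last by rewrite !(mul0r, mulr0); lra.
rewrite ln_div ?posrE // lnV ?posrE // lnP => h.
lra.
Qed.

End Gibbs.

(** * Accuracy of a rounded scaling *)

Lemma ler_chain3 (R : realDomainType) (x y z w D e : R) :
  y - z <= D -> z - w <= e -> x <= y -> x - w <= D + e.
Proof. by move=> *; lra. Qed.

(** Up to the factor [eta]: [w] is the value of the scaling for its own cost, [v] the optimum, [h]
    the value of the rounded plan. *)
Lemma ler_bracket (R : realDomainType) (w v h D e : R) :
  w - v <= D + e -> h - w <= D + e -> v <= h ->
  h - v <= 2 * D + 2 * e /\ `|w - v| <= 2 * D + 2 * e.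
Proof. by rewrite ler_norml => *; split; [|apply/andP; split]; lra. Qed.

Section Accuracy.
Variables (R : realType) (n d : nat) (X : 'I_n -> 'cV[R]_d).
Variables (K : 'M[R]_n) (eta b e th : R) (d1 d2 p q : 'cV[R]_n).
Hypothesis eta0 : 0 < eta.
Hypothesis K01 : forall i j, 0 < K i j <= 1.
Hypothesis d10 : forall i, 0 < d1 i 0.
Hypothesis d20 : forall j, 0 < d2 j 0.
Hypothesis sp : simplex p.
Hypothesis sq : simplex q.
Hypothesis e01 : 0 <= e <= 1.
Hypothesis hth : 0 < th <= 1.
Hypothesis lK : forall i j, `|eta * cost_mx X i j + ln (K i j)| <= e.
Hypothesis cb : forall i j, eta * cost_mx X i j <= b.

Let P := scaled K (d1, d2).
Hypothesis marg :
  \sum_i `|\sum_j P i j - p i 0| + \sum_j `|\sum_i P i j - q j 0| <= e.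

Let M := log_cost K eta.
Let V := objective (cost_mx X) eta.
Let W := objective M eta.
Let Q := P_eta X eta p q.
(** The modulus of [W] at l1 distance [2 * e], twice the marginal error; [b + e] bounds
    [eta * log_cost]. *)
Let D := 2 * e * (b + e + ln th^-1 + 2) + n%:R ^+ 2 * th.

Let Ppos i j : 0 < P i j.
Proof. by rewrite scaledE !mulr_gt0 //; case/andP: (K01 i j). Qed.

Let P0 i j : 0 <= P i j. Proof. exact: ltW. Qed.

Let pmass : \sum_i p i 0 = 1. Proof. by case: sp. Qed.

Let qmass : \sum_i q i 0 = 1. Proof. by case: sq. Qed.

Let Pmass : \sum_i \sum_j P i j <= 2.
Proof.
have h1 : \sum_i \sum_j P i j - \sum_i p i 0 <= \sum_i `|\sum_j P i j - p i 0|.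
  by rewrite -sumrB; apply: ler_sum => i _; exact: ler_norm.
have h2 : 0 <= \sum_j `|\sum_i P i j - q j 0| by apply: sumr_ge0.
have h3 : \sum_i \sum_j P i j - \sum_i p i 0 <= e.
  by apply: le_trans marg; rewrite -[leLHS]addr0 lerD.
by rewrite pmass lerBlDr in h3; apply: le_trans h3 _; have [_ e1] := andP e01; lra.
Qed.

Let mass_itv (A : 'M[R]_n) : (forall i j, 0 <= A i j) ->
  \sum_i \sum_j A i j <= 2 -> forall i j, 0 <= A i j <= 2.
Proof. by move=> A0 A2 i j; rewrite A0 (le_trans (ler_mass i j A0)). Qed.

Let cost0 i j : 0 <= cost_mx X i j. Proof. by rewrite mxE sqr_ge0. Qed.

Let etaM i j : eta * M i j = - ln (K i j).
Proof. by rewrite mxE mulrA mulrN divff ?gt_eqF // mulN1r. Qed.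

Let b0 : (0 < n)%N -> 0 <= b.
Proof.
by move=> n0; apply: le_trans (cb (Ordinal n0) (Ordinal n0)); rewrite mulr_ge0 // ltW.
Qed.

Let n0 : (0 < n)%N.
Proof.
rewrite lt0n; apply/eqP => nE; have := pmass.
rewrite big1 => [/esym/eqP|i _]; first by rewrite oner_eq0.
by exfalso; have := leq_ltn_trans (leq0n i) (ltn_ord i); rewrite nE.
Qed.

Let Mb i j : `|eta * M i j| <= b + e.
Proof.
rewrite etaM normrN.
have -> : ln (K i j) = (eta * cost_mx X i j + ln (K i j)) - eta * cost_mx X i j by ring.
apply: le_trans (ler_normB _ _) _; rewrite addrC lerD //.
by rewrite ger0_norm // mulr_ge0 // ltW.
Qed.

Let close (A B : 'M[R]_n) :
  (forall i j, 0 <= A i j <= 2) -> (forall i j, 0 <= B i j <= 2) ->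
  \sum_i \sum_j `|A i j - B i j| <= 2 * e -> eta * `|W A - W B| <= D.
Proof.
move=> A2 B2 AB; have be0 : 0 <= b + e by rewrite addr_ge0 ?b0 //; case/andP: e01.
exact: (objective_modulus eta0 hth Mb A2 B2 AB be0).
Qed.

Let VW (A : 'M[R]_n) : couplings p q A -> eta * `|V A - W A| <= e.
Proof.
apply: objective_cost_close => // i j; rewrite etaM opprK; exact: lK.
Qed.

Let Qmin := P_eta_minimizes X eta sp sq.

(* [W P <= W Z] for a rounding [Z] of the minimizer to the marginals of [P],
   because [P] minimizes [W] for its own marginals. *)
Let lower : eta * (W P - V Q) <= D + e.
Proof.
have [cQ minQ] := Qmin; have [Q0 rQ lQ] := (iffLR (couplingsP _ _ _)) cQ.
pose pr : 'cV[R]_n := \col_i \sum_j P i j; pose pc : 'cV[R]_n := \col_j \sum_i P i j.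
have pr0 i : 0 <= pr i 0 by rewrite mxE sumr_ge0.
have pc0 j : 0 <= pc j 0 by rewrite mxE sumr_ge0.
have prc : \sum_i pr i 0 = \sum_j pc j 0.
  by under eq_bigr do rewrite mxE; under [RHS]eq_bigr do rewrite mxE; exact: exchange_big.
pose Z := rounding Q pr pc.
have cZ : couplings pr pc Z by exact: rounding_coupling.
have [Z0 rZ lZ] := (iffLR (couplingsP _ _ _)) cZ.
have Zmass : \sum_i \sum_j Z i j <= 2.
  rewrite (couplings_mass cZ); under eq_bigr do rewrite mxE; exact: Pmass.
have PZ : W P <= W Z.
  apply: scaled_minimizes => // [i j|i|j]; first by case/andP: (K01 i j).
  - by rewrite rZ mxE.
  - by rewrite lZ mxE.
have Qmass : \sum_i \sum_j Q i j <= 2 by rewrite (couplings_mass cQ) pmass; lra.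
have ZQ : eta * `|W Z - W Q| <= D.
  apply: close; [exact: mass_itv|exact: mass_itv|].
  apply: le_trans (rounding_dist Q0 pr0 pc0 prc) _.
  apply: ler_wpM2l => //; apply: le_trans marg; apply: lerD.
    by apply: ler_sum => i _; rewrite rQ mxE distrC.
  by apply: ler_sum => j _; rewrite lQ mxE distrC.
have h1 := VW cQ.
have h2 : eta * (W Z - W Q) <= D by apply: le_trans ZQ; rewrite ler_pM2l // ler_norm.
have h3 : eta * (W Q - V Q) <= e.
  by apply: le_trans h1; rewrite ler_pM2l // distrC ler_norm.
have h4 : eta * W P <= eta * W Z by rewrite ler_pM2l.
by rewrite mulrBr; rewrite mulrBr in h2; rewrite mulrBr in h3; exact: ler_chain3 h2 h3 h4.
Qed.

Let Phat := rounding P p q.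

Let cPhat : couplings p q Phat.
Proof.
by apply: rounding_coupling => //; [case: sp|case: sq|rewrite pmass qmass].
Qed.

Let upper : eta * (V Phat - W P) <= D + e.
Proof.
have [H0 rH lH] := (iffLR (couplingsP _ _ _)) cPhat.
have Hmass : \sum_i \sum_j Phat i j <= 2 by rewrite (couplings_mass cPhat) pmass; lra.
have HP : eta * `|W Phat - W P| <= D.
  apply: close; [exact: mass_itv|exact: mass_itv|].
  have pq : \sum_i p i 0 = \sum_i q i 0 by rewrite pmass qmass.
  have [p0 _] := sp; have [q0 _] := sq.
  apply: le_trans (rounding_dist P0 p0 q0 pq) _.
  exact: ler_wpM2l.
have h1 := VW cPhat.
have h2 : eta * (W Phat - W P) <= D by apply: le_trans HP; rewrite ler_pM2l // ler_norm.
have h3 : eta * (V Phat - W Phat) <= e.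
  by apply: le_trans h1; rewrite ler_pM2l // ler_norm.
by rewrite mulrBr [leRHS]addrC; rewrite mulrBr in h2; rewrite mulrBr in h3; exact: ler_chain3 h3 h2 (lexx _).
Qed.

(** The returned value is [W P], by [objective_scaled]; [lower], [upper] and [V Q <= V Phat] enclose
    both errors. *)
Lemma rounding_near_optimal :
  [/\ couplings p q Phat, 0 <= V Phat - W_eta X eta p q,
      eta * (V Phat - W_eta X eta p q) <= 2 * D + 2 * e &
      eta * `|eta^-1 * (\sum_i ln (d1 i 0) * \sum_j P i j +
               \sum_j ln (d2 j 0) * \sum_i P i j) - W_eta X eta p q|
        <= 2 * D + 2 * e].
Proof.
have [cQ minQ] := Qmin.
have m : V Q <= V Phat by exact: minQ.
have l := lower; have u := upper.
have m' : eta * V Q <= eta * V Phat by rewrite ler_pM2l.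
rewrite mulrBr in l; rewrite mulrBr in u.
have [hV hW] := ler_bracket l u m'; split=> //; first by rewrite subr_ge0.
  by rewrite mulrBr.
rewrite -(objective_scaled eta _ d10 d20); last by move=> i j; case/andP: (K01 i j).
by rewrite -{1}(gtr0_norm eta0) -normrM mulrBr.
Qed.

End Accuracy.

(** * Calibration of [eps'] and of the threshold [theta] *)

Lemma ln_mul (R : realType) (x y : R) : 0 < x -> 0 < y -> ln (x * y) = ln x + ln y.
Proof. by move=> x0 y0; rewrite lnM ?posrE. Qed.

(** With [e * L <= eta * eps / 50], [ln th^-1 <= 2 * L] and [L >= 4], the inner parenthesis is at
    most [4 * L]. The total is then at most [16 * e * L + eta * eps / 25 + 2 * e], below [19 / 50]
    of [eta * eps]. *)
Lemma budget_le (R : realType) (n : nat) (Rad eta eps : R) :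
  (2 <= n)%N -> 1 <= Rad -> 1 <= eta <= n%:R -> 0 < eps < 1 ->
  let e := eps_prime n Rad eta eps in
  let th := eta * eps / (50 * n%:R ^+ 2) in
  [/\ 0 < e <= 1, 0 < th <= 1 &
    2 * (2 * e * (4 * Rad ^+ 2 * eta + e + ln th^-1 + 2) + n%:R ^+ 2 * th) + 2 * e
      <= eta * eps].
Proof.
move=> n2 R1 he heps /=.
have n2' : 2 <= n%:R :> R by rewrite (ler_nat _ 2).
have ee0 : 0 < eta * eps by rewrite mulr_gt0; lra.
have een : eta * eps <= n%:R.
  by apply: (@le_trans _ _ eta); [rewrite ler_piMr; lra|lra].
have R2 : 1 <= Rad ^+ 2 by rewrite expr_ge1 //; lra.
have Re : eta <= Rad ^+ 2 * eta by rewrite ler_peMl; lra.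
set l := ln (n%:R / (eta * eps)).
have l0 : 0 <= l.
  by rewrite ln_ge0 // ler_pdivlMr // mul1r.
set L := 4 * Rad ^+ 2 * eta + l.
have L4 : 4 * eta <= L by rewrite /L; lra.
have e0 : 0 < eps_prime n Rad eta eps.
  rewrite lt_min ltr01 /= divr_gt0 //; first by rewrite mulrC.
  rewrite -/l -/L; lra.
have e1 : eps_prime n Rad eta eps <= 1 by rewrite ge_min lexx.
have eL : eps_prime n Rad eta eps * L <= eta * eps / 50.
  apply: (@le_trans _ _ (eps * eta / (50 * L) * L)).
    by apply: ler_wpM2r; [lra|rewrite ge_min lexx orbT].
  rewrite le_eqVlt; apply/orP; left; apply/eqP; field.
  by apply/lt0r_neq0; lra.
set e := eps_prime n Rad eta eps in e0 e1 eL *.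
have nn0 : 0 < n%:R :> R by lra.
have th0 : 0 < eta * eps / (50 * n%:R ^+ 2) by rewrite divr_gt0 // mulr_gt0 // exprn_gt0.
have th1 : eta * eps / (50 * n%:R ^+ 2) <= 1.
  rewrite ler_pdivrMr ?mul1r; last by rewrite mulr_gt0 // exprn_gt0.
  have nn : n%:R <= n%:R * n%:R :> R by rewrite ler_peMr; lra.
  by apply: le_trans een _; rewrite expr2; lra.
have lth : ln (eta * eps / (50 * n%:R ^+ 2))^-1 <= 2 * L.
  (* One factor [n] is written [n / eta * eta], because [ln (n / eta) <= l] and [ln eta <= eta - 1]
     are both controlled by [L]. *)
  have -> : (eta * eps / (50 * n%:R ^+ 2))^-1 =
     50 * ((n%:R / eta) * eta) * (n%:R / (eta * eps)).
    by field; rewrite !gt_eqF //; lra.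
  have ne0 : 0 < n%:R / eta by rewrite divr_gt0 //; lra.
  have nl0 : 0 < n%:R / (eta * eps) by rewrite divr_gt0.
  have eta0 : 0 < eta by lra.
  have -> : ln (50 * ((n%:R / eta) * eta) * (n%:R / (eta * eps))) =
      ln 50 + (ln (n%:R / eta) + ln eta) + l.
    have nn1 : 0 < n%:R / eta * eta by rewrite mulr_gt0.
    have nn2 : 0 < 50 * (n%:R / eta * eta) by rewrite mulr_gt0.
    by rewrite (ln_mul nn2 nl0) ln_mul // ln_mul.
  have h50 : ln 50 <= 6 :> R.
    have : ln 50 <= ln (2 ^+ 6) :> R by rewrite ler_ln ?posrE // -natrX ler_nat.
    rewrite lnXn // => /le_trans; apply.
    have := @ln_le_subr1 R 2 ltac:(by []); lra.
  have h1 : ln (n%:R / eta) <= l.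
    by rewrite ler_ln ?posrE ?divr_gt0 // ler_pM2l // lef_pV2 ?posrE // ler_piMr; lra.
  have h2 : ln eta <= eta - 1 by apply: ln_le_subr1; lra.
  have LE : L = 4 * Rad ^+ 2 * eta + l by [].
  lra.
split; [by rewrite e0 e1|by rewrite th0 th1|].
have -> : n%:R ^+ 2 * (eta * eps / (50 * n%:R ^+ 2)) = eta * eps / 50.
  by field; rewrite gt_eqF.
have h : e * (4 * Rad ^+ 2 * eta + e + ln (eta * eps / (50 * n%:R ^+ 2))^-1 + 2) <= e * (4 * L).
  by apply: ler_wpM2l; [exact: ltW|rewrite /L in L4 lth *; lra].
have h' : e * 4 <= e * L by apply: ler_wpM2l; lra.
lra.
Qed.

(** * Positive semidefiniteness and the Nystrom residual *)

Definition psd (R : realType) (n : nat) (A : 'M[R]_n) : Prop :=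
  forall v : 'cV[R]_n, 0 <= (v^T *m A *m v) 0 0.

Lemma quadE (R : realType) (n : nat) (A : 'M[R]_n) (v : 'cV[R]_n) :
  (v^T *m A *m v) 0 0 = \sum_i \sum_j v i 0 * v j 0 * A i j.
Proof.
rewrite mxE; under eq_bigr do rewrite mxE mulr_suml.
rewrite exchange_big; apply: eq_bigr => i _; apply: eq_bigr => j _.
by rewrite mxE; ring.
Qed.

Lemma psd_congr (R : realType) (n m : nat) (A : 'M[R]_n) (M : 'M[R]_(n, m)) :
  psd A -> psd (M^T *m A *m M).
Proof. by move=> A0 v; have := A0 (M *m v); rewrite trmx_mul !mulmxA. Qed.

Lemma psd_gram (R : realType) (n m : nat) (M : 'M[R]_(m, n)) : psd (M^T *m M).
Proof.
rewrite -{1}[M^T]mulmx1; apply: psd_congr => v.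
by rewrite mulmx1 mxE sumr_ge0 // => i _; rewrite mxE -expr2 sqr_ge0.
Qed.

Lemma psd_diag (R : realType) (n : nat) (A : 'M[R]_n) i : psd A -> 0 <= A i i.
Proof.
move=> A0; have := A0 (delta_mx i 0); rewrite trmx_delta -rowE -colE.
by rewrite !mxE.
Qed.

(** The form at [e_i + e_j] and at [e_i - e_j] gives [2 * |A i j| <= A i i + A j j]. *)
Lemma psd_entry_le (R : realType) (n : nat) (A : 'M[R]_n) (t : R) i j :
  A^T = A -> psd A -> A i i <= t -> A j j <= t -> `|A i j| <= t.
Proof.
move=> sA A0 hi hj.
pose w c : 'cV[R]_n := delta_mx i 0 + c *: delta_mx j 0.
have quad c : ((w c)^T *m A *m w c) 0 0 =
    A i i + c * (A i j + A j i) + c ^+ 2 * A j j.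
  have -> : (w c)^T = delta_mx 0 i + c *: delta_mx 0 j.
    by rewrite linearD /= linearZ /= !trmx_delta.
  rewrite mulmxDl -scalemxAl mulmxDr -scalemxAr.
  by rewrite !mulmxDl -!scalemxAl -!rowE -!colE !mxE; ring.
have sij : A j i = A i j by rewrite -{1}sA mxE.
have h1 := A0 (w 1).
have h2 := A0 (w (-1)).
by rewrite !quad sij in h1 h2; rewrite ler_norml; apply/andP; split; lra.
Qed.

(** Schur product argument: the form of the power [k + 1] at [v] is the sum, over the columns [Y_a]
    of [Y], of the forms of the power [k] at the entrywise products of [v] and [Y_a]. *)
Lemma psd_gram_power (R : realType) (n d : nat) (Y : 'M[R]_(n, d)) k :
  psd (\matrix_(i, j) (Y *m Y^T) i j ^+ k).
Proof.
elim: k => [|k IH] v.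
  rewrite quadE; under eq_bigr do under eq_bigr do rewrite mxE expr0 mulr1.
  under eq_bigr do rewrite -mulr_sumr.
  by rewrite -mulr_suml -expr2 sqr_ge0.
pose G k : 'M[R]_n := \matrix_(i, j) (Y *m Y^T) i j ^+ k.
pose w a : 'cV[R]_n := \col_i (v i 0 * Y i a).
have wE a i : w a i 0 = v i 0 * Y i a by rewrite mxE.
have GE i j : G k.+1 i j = (\sum_a Y i a * Y j a) * G k i j.
  rewrite !mxE exprS; congr (_ * _).
  by apply: eq_bigr => a _; rewrite mxE.
rewrite -/(G k.+1); have -> : (v^T *m G k.+1 *m v) 0 0 =
  \sum_a ((w a)^T *m G k *m w a) 0 0.
  under [RHS]eq_bigr do rewrite quadE.
  rewrite quadE [RHS]exchange_big /=; apply: eq_bigr => i _.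
  rewrite [RHS]exchange_big /=; apply: eq_bigr => j _.
  rewrite GE mulr_suml mulr_sumr; apply: eq_bigr => a _; rewrite !wE; ring.
by apply: sumr_ge0 => a _; exact: IH.
Qed.

Lemma expR_cvg (R : realType) (x : R) : series (exp_coeff x) @ \oo --> expR x.
Proof. exact: is_cvg_series_exp_coeff. Qed.

(** The form is the limit of partial sums of the exponential series, nonnegative combinations of the
    forms of [psd_gram_power]. *)
Lemma psd_exp_gram (R : realType) (n d : nat) (Y : 'M[R]_(n, d)) :
  psd (\matrix_(i, j) expR ((Y *m Y^T) i j)).
Proof.
move=> v; pose u N := \sum_i \sum_j v i 0 * v j 0 * series (exp_coeff ((Y *m Y^T) i j)) N.
have cu : u N @[N --> \oo] --> \sum_i \sum_j v i 0 * v j 0 * expR ((Y *m Y^T) i j).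
  apply: cvg_sumr => i; apply: cvg_sumr => j; apply: cvgM; first exact: cvg_cst.
  exact: expR_cvg.
have u0 N : 0 <= u N.
  have -> : u N = \sum_(0 <= k < N) k`!%:R^-1 *
     (v^T *m (\matrix_(i, j) (Y *m Y^T) i j ^+ k) *m v) 0 0.
    under [RHS]eq_bigr do rewrite quadE mulr_sumr.
    rewrite exchange_big; apply: eq_bigr => i _ /=.
    under [RHS]eq_bigr do rewrite mulr_sumr.
    rewrite exchange_big; apply: eq_bigr => j _ /=.
    rewrite /series /= mulr_sumr; apply: eq_bigr => k _.
    by rewrite /exp_coeff /= [in RHS]mxE; ring.
  apply: sumr_ge0 => k _; rewrite mulr_ge0 ?invr_ge0 //; exact: psd_gram_power.
rewrite quadE; under eq_bigr do under eq_bigr do rewrite mxE.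
rewrite -(cvg_lim (@Rhausdorff R) cu); apply: limr_ge; first by apply/cvg_ex; eexists; exact: cu.
by apply: nearW.
Qed.

Lemma norm2_sqr (R : realType) (d : nat) (x : 'cV[R]_d) :
  norm2 x ^+ 2 = \sum_k x k 0 ^+ 2.
Proof. by rewrite sqr_sqrtr // sumr_ge0 // => k _; rewrite sqr_ge0. Qed.

Lemma gaussC (R : realType) (d : nat) (eta : R) (x y : 'cV[R]_d) :
  gauss eta x y = gauss eta y x.
Proof.
rewrite /gauss !norm2_sqr; congr (expR (_ * _)); apply: eq_bigr => k _.
by rewrite !mxE; ring.
Qed.

Lemma kernel_sym (R : realType) (n d : nat) (X : 'I_n -> 'cV[R]_d) (eta : R) :
  (kernel_mx X eta)^T = kernel_mx X eta.
Proof. by apply/matrixP => i j; rewrite !mxE gaussC. Qed.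

Lemma kernel_diag (R : realType) (n d : nat) (X : 'I_n -> 'cV[R]_d) (eta : R) i :
  kernel_mx X eta i i = 1.
Proof.
rewrite mxE /gauss norm2_sqr big1 ?mulr0 ?expR0 // => k _.
by rewrite !mxE subrr expr0n.
Qed.

(** Expanding the square, [K] is the entrywise exponential of the Gram matrix of the points scaled
    by [sqrt (2 * eta)], multiplied on both sides by a diagonal matrix. *)
Lemma kernel_psd (R : realType) (n d : nat) (X : 'I_n -> 'cV[R]_d) (eta : R) :
  0 <= eta -> psd (kernel_mx X eta).
Proof.
move=> e0; pose Y : 'M[R]_(n, d) := \matrix_(i, k) (Num.sqrt (2 * eta) * X i k 0).
pose D : 'M[R]_n := diag_mx (\row_i expR (- eta * norm2 (X i) ^+ 2)).
have -> : kernel_mx X eta = D^T *m (\matrix_(i, j) expR ((Y *m Y^T) i j)) *m D.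
  apply/matrixP => i j; rewrite /D tr_diag_mx mul_mx_diag mxE mul_diag_mx !mxE.
  rewrite -!expRD /gauss; congr expR; rewrite !norm2_sqr.
  rewrite !mulr_sumr -!big_split; apply: eq_bigr => k _ /=; rewrite !mxE.
  have := @sqr_sqrtr R (2 * eta) ltac:(by rewrite mulr_ge0).
  rewrite expr2 => h.
  have -> : Num.sqrt (2 * eta) * X i k 0 * (Num.sqrt (2 * eta) * X j k 0) =
     (Num.sqrt (2 * eta) * Num.sqrt (2 * eta)) * (X i k 0 * X j k 0) by ring.
  by rewrite h; ring.
by apply: psd_congr; exact: psd_exp_gram.
Qed.

Section Nystrom.
Variables (R : realType) (n d : nat) (X : 'I_n -> 'cV[R]_d) (eta : R).
Variables (s : nat) (F : nys_factor R n).
Hypothesis eta0 : 0 <= eta.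
Hypothesis nysF : nystrom_factor X eta s F.

Let m := size (pts F).
Let K := kernel_mx X eta.
(** Columns are the basis vectors of the selected points, so that [V = K sel] and
    [A = sel^T K sel]. *)
Let sel : 'M[R]_(n, m) := \matrix_(i, j) (i == tnth (in_tuple (pts F)) j)%:R.
Let A : 'M[R]_m := fL F *m (fL F)^T.

Let mul_sel (k : nat) (B : 'M[R]_(k, n)) i j :
  (B *m sel) i j = B i (tnth (in_tuple (pts F)) j).
Proof.
rewrite mxE (bigD1 (tnth (in_tuple (pts F)) j)) //= mxE eqxx mulr1 big1 ?addr0 //.
by move=> a aj; rewrite mxE (negbTE aj) mulr0.
Qed.

Let V_sel : fV F = K *m sel.
Proof. by rewrite (nf_V nysF); apply/matrixP => i j; rewrite mul_sel !mxE. Qed.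

Let A_sel : A = sel^T *m K *m sel.
Proof.
rewrite /A (nf_chol nysF); apply/matrixP => i j; rewrite mul_sel.
have -> : sel^T *m K = (K *m sel)^T by rewrite trmx_mul kernel_sym.
by rewrite mxE [RHS]mxE mul_sel mxE gaussC.
Qed.

Lemma cholesky_unit : fL F \in unitmx.
Proof.
rewrite unitmxE (det_trig (nf_trig nysF)) unitfE.
by apply/prodf_neq0 => j _; rewrite gt_eqF // (nf_diag nysF).
Qed.

Let A_unit : A \in unitmx.
Proof. by rewrite unitmx_mul unitmx_tr cholesky_unit. Qed.

Let A_sym : A^T = A. Proof. by rewrite /A trmx_mul trmxK. Qed.

Let KtE : Ktilde F = K *m sel *m invmx A *m (sel^T *m K).
Proof. by rewrite /Ktilde -/A V_sel trmx_mul kernel_sym. Qed.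

Lemma Ktilde_sym : (Ktilde F)^T = Ktilde F.
Proof. by rewrite KtE !trmx_mul trmxK kernel_sym trmx_inv A_sym !mulmxA. Qed.

Lemma Ktilde_gram :
  Ktilde F = (invmx (fL F) *m (fV F)^T)^T *m (invmx (fL F) *m (fV F)^T).
Proof.
have Lu := cholesky_unit; have LTu : (fL F)^T \in unitmx by rewrite unitmx_tr.
rewrite /Ktilde trmx_mul trmxK !mulmxA trmx_inv; congr (_ *m _).
rewrite -!mulmxA; congr (_ *m _).
have h : (fL F *m (fL F)^T) *m (invmx (fL F)^T *m invmx (fL F)) = 1%:M.
  by rewrite mulmxA mulmxK // mulmxV.
by rewrite -[LHS]mulmx1 -h mulKmx.
Qed.

Lemma Ktilde_psd : psd (Ktilde F).
Proof. by rewrite Ktilde_gram; exact: psd_gram. Qed.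

(* The residual is the Schur complement of the selected block. *)
Lemma Ktilde_residual_psd : psd (K - Ktilde F).
Proof.
(* [K M] is the residual and [sel^T K M = 0], so the correction in [M^T] vanishes and
   [M^T K M = K M]. *)
pose M := 1%:M - sel *m invmx A *m (sel^T *m K).
suff -> : K - Ktilde F = M^T *m K *m M by apply: psd_congr; exact: kernel_psd.
have MT : M^T = 1%:M - K *m sel *m invmx A *m sel^T.
  by rewrite /M linearB /= trmx1 !trmx_mul trmxK kernel_sym trmx_inv A_sym !mulmxA.
have KM : K *m M = K - Ktilde F by rewrite KtE /M mulmxBr mulmx1 !mulmxA.
have sKM : sel^T *m (K *m M) = 0.
  rewrite KM mulmxBr KtE !mulmxA -A_sel mulmxV // mul1mx subrr //.
by rewrite -mulmxA MT mulmxBl mul1mx -!mulmxA sKM !mulmx0 subr0 KM.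
Qed.

Let sel_Kt_sel : sel^T *m Ktilde F *m sel = A.
Proof. by rewrite KtE !mulmxA -A_sel mulmxV // mul1mx -A_sel. Qed.

(** The selected block of [Ktilde] is [A], invertible by its Cholesky factor. This justifies
    returning the number of selected points as the rank. *)
Lemma Ktilde_rank : \rank (Ktilde F) = m.
Proof.
apply/eqP; rewrite eqn_leq; apply/andP; split.
  by rewrite KtE; exact: mulmx_max_rank.
have <- : \rank A = m by rewrite mxrank_unit.
rewrite -sel_Kt_sel; apply: leq_trans (mxrankM_maxl _ _) _.
exact: mxrankM_maxr.
Qed.

Lemma Ktilde_selected j : Ktilde F (tnth (in_tuple (pts F)) j)
  (tnth (in_tuple (pts F)) j) = 1.
Proof.
have := congr1 (fun B : 'M[R]_m => B j j) sel_Kt_sel => /=.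
have E : sel^T *m Ktilde F = (Ktilde F *m sel)^T by rewrite trmx_mul Ktilde_sym.
rewrite mul_sel E mxE mul_sel => ->.
by rewrite /A (nf_chol nysF) mxE -(kernel_diag X eta (tnth (in_tuple (pts F)) j)) mxE.
Qed.

(** [n] distinct indices exhaust all points, and [Ktilde] interpolates the diagonal at selected
    points. The doubling loop stops for this reason. *)
Lemma Ktilde_diag_full : (n <= s)%N -> forall i, Ktilde F i i = 1.
Proof.
move=> ns i; have iF : i \in pts F.
  have := nf_size nysF; rewrite (minn_idPr ns) => sz.
  have := uniq_leq_size (nf_uniq nysF) (fun x _ => mem_enum 'I_n x).
  have [_ ->] := uniq_min_size (nf_uniq nysF) (fun x _ => mem_enum 'I_n x)
                   ltac:(by rewrite size_enum_ord sz).
  by rewrite mem_enum.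
have := Ktilde_selected (Ordinal (etrans (index_mem i (pts F)) iF)).
by rewrite (tnth_nth i) /= nth_index.
Qed.

Lemma Ktilde_diag_le1 i : Ktilde F i i <= 1.
Proof.
have := psd_diag i Ktilde_residual_psd.
by rewrite mxE kernel_diag mxE subr_ge0.
Qed.

(** The bound by 1 comes from [Ktilde] itself being positive semidefinite with diagonal at most 1;
    [sinkhorn_rate] asks for it. *)
Lemma Ktilde_entries (tau : R) : (forall i, 1 - Ktilde F i i <= tau) ->
  forall i j, `|K i j - Ktilde F i j| <= tau /\ Ktilde F i j <= 1.
Proof.
move=> ht i j; split.
  have h k : (K - Ktilde F) k k <= tau by rewrite mxE kernel_diag mxE.
  have := psd_entry_le _ Ktilde_residual_psd (h i) (h j).
  rewrite !mxE; apply.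
  by rewrite linearB /= kernel_sym Ktilde_sym.
have := psd_entry_le Ktilde_sym Ktilde_psd (Ktilde_diag_le1 i) (Ktilde_diag_le1 j).
exact: le_trans (ler_norm _).
Qed.

End Nystrom.

(** * Effective dimension *)

Section Splitting.
Import complex.
Local Open Scope complex_scope.

(** Over [R[i]] the matrix is Hermitian, hence unitarily diagonalizable with real diagonal. The
    factorization descends to [R] by injectivity of the embedding on polynomials. *)
Lemma symmetric_char_poly_splits (R : rcfType) (n : nat) (A : 'M[R]_n) :
  A^T = A -> exists s : seq R, char_poly A = \prod_(x <- s) ('X - x%:P).
Proof.
move=> sA; pose toC := real_complex R; pose B : 'M[R[i]]_n := map_mx toC A.
have Breal : B \is a mxOver Num.real.
  by apply/mxOverP => i j; rewrite mxE; apply/complex_realP; exists (A i j).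
have Bsym : B \is symmetricmx.
  by apply/is_hermitianmxP; rewrite expr0 scale1r; apply/matrixP => i j; rewrite !mxE -[in LHS]sA mxE.
have Bherm := realsym_hermsym Bsym Breal.
have /orthomx_spectralP BE := hermitian_normalmx Bherm.
have /mxOverP dreal := hermitian_spectral_diag_real Bherm.
set P := spectralmx B in BE; set sp := spectral_diag B in BE dreal.
have Pu : P \in unitmx by rewrite unitarymx_unit // spectral_unitarymx.
pose s := [seq Re (sp 0 i) | i <- enum 'I_n].
exists s; apply: (map_poly_inj toC); rewrite map_char_poly -/B.
have -> : char_poly B = char_poly (diag_mx sp).
  rewrite /char_poly /char_poly_mx.
  have XE : 'X%:M - map_mx polyC B = map_mx polyC (invmx P) *m
      ('X%:M - map_mx polyC (diag_mx sp)) *m map_mx polyC P.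
    rewrite mulmxBr mulmxBl -!map_mxM -BE; congr (_ - _).
    by rewrite mul_mx_scalar -scalemxAl -map_mxM mulVmx // map_mx1 scalemx1.
  by rewrite XE !det_mulmx mulrC mulrA -det_mulmx -map_mxM mulmxV // map_mx1 det1 mul1r.
rewrite char_poly_trig ?diag_mx_is_trig // rmorph_prod /= /s big_map big_enum /=.
apply: eq_bigr => i _; rewrite rmorphB /= map_polyX map_polyC mxE eqxx mulr1n /=.
have /complex_realP[k kE] := dreal 0 i.
by rewrite kE.
Qed.

End Splitting.

Lemma eigenvaluesP (R : realType) (n : nat) (A : 'M[R]_n) : A^T = A ->
  char_poly A = \prod_(x <- eigenvalues A) ('X - x%:P).
Proof.
move=> sA; have [s sE] := symmetric_char_poly_splits sA.
suff : [set s : seq R | sorted >=%R s /\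
    char_poly A = \prod_(x <- s) ('X - x%:P)] (eigenvalues A) by case.
apply: xgetPex; exists (sort >=%R s); split.
  by apply: sort_sorted => x y; exact: ge_total.
by rewrite sE; apply: perm_big; rewrite perm_sym perm_sort.
Qed.

Lemma psd_eigenvalue_ge0 (R : realType) (n : nat) (A : 'M[R]_n) x : A^T = A ->
  psd A -> x \in eigenvalues A -> 0 <= x.
Proof.
move=> sA A0 xA; have : root (char_poly A) x.
  by rewrite eigenvaluesP // root_prod_XsubC.
rewrite -eigenvalue_root_char => /eigenvalueP[v vA v0].
have := A0 v^T; rewrite trmxK vA -scalemxAl mxE.
have v2 : 0 < (v *m v^T) 0 0.
  rewrite mxE lt0r psumr_neq0; last by move=> i _; rewrite mxE -expr2 sqr_ge0.
  apply/andP; split; last by apply: sumr_ge0 => i _; rewrite mxE -expr2 sqr_ge0.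
  apply/hasP; have /rV0Pn[i vi] := v0; exists i; first exact: mem_index_enum.
  by rewrite /= mxE -expr2 exprn_even_gt0.
by rewrite pmulr_lge0.
Qed.

(** Both sides are, up to sign, the coefficient below the leading one in the characteristic
    polynomial. *)
Lemma sum_eigenvalues (R : realType) (n : nat) (A : 'M[R]_n) : A^T = A ->
  (0 < n)%N -> \sum_(x <- eigenvalues A) x = \tr A.
Proof.
move=> sA n0; have cE := eigenvaluesP sA; have := char_poly_trace A n0.
have sz : size (eigenvalues A) = n.
  by have := size_char_poly A; rewrite cE size_prod_XsubC => -[].
have := @coefPn_prod_XsubC R (eigenvalues A); rewrite sz -lt0n n0 => /(_ isT) cP.
by rewrite cE cP => /eqP; rewrite eqr_opp => /eqP.
Qed.

(** Each eigenvalue is at most the trace [n], so every denominator can be raised to [n + tau * n];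
    the numerators sum to [n]. *)
Lemma d_eff_ge (R : realType) (n d : nat) (X : 'I_n -> 'cV[R]_d) (eta tau : R) :
  0 <= eta -> (0 < n)%N -> 0 < tau -> (1 + tau)^-1 <= d_eff X eta tau.
Proof.
move=> eta0 n0 tau0; rewrite /d_eff.
have sK := kernel_sym X eta; have K0 := kernel_psd X eta0.
set s := eigenvalues _; have s0 x : x \in s -> 0 <= x.
  exact: psd_eigenvalue_ge0.
have n0' : 0 < n%:R :> R by rewrite ltr0n.
have ssum : \sum_(x <- s) x = n%:R.
  rewrite sum_eigenvalues // /mxtrace; under eq_bigr do rewrite kernel_diag.
  by rewrite sumr_const card_ord.
have -> : (1 + tau)^-1 = \sum_(x <- s) x / (n%:R + tau * n%:R).
  by rewrite -mulr_suml ssum -[X in _ / (X + _)]mul1r -mulrDl invfM mulrCA mulfV ?mulr1 // gt_eqF.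
rewrite big_seq [leRHS]big_seq; apply: ler_sum => x xs.
have x0 := s0 x xs; have tn : 0 < tau * n%:R by rewrite mulr_gt0.
apply: ler_wpM2l => //; rewrite lef_pV2 ?posrE; try lra.
rewrite lerD2r -ssum (big_rem x) //= lerDl big_seq; apply: sumr_ge0 => y ys.
by apply: s0; exact: mem_rem ys.
Qed.

(** * Values computed by the subroutines *)

(* Unlike [simpl], leaves the calls of [csum], [tab] etc. folded. *)
Ltac cost :=
  cbn [bind ctime cspace cval ret radd rsub rmul rdiv rmin rabs rln rexp rle rlt];
  unfold words, words_sk_state, words_factor, words_pair, words_real, words_bool,
    words_mx, words;
  cbn [fst snd].

Lemma sum_ord_leq (n t : nat) (f : 'I_n -> nat) :
  (forall i, (f i <= t)%N) -> (\sum_i f i <= n * t)%N.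
Proof.
move=> ft; apply: (@leq_trans (\sum_(i < n) t)); first by apply: leq_sum => i _.
by rewrite sum_nat_const card_ord.
Qed.

Lemma tab_time (R : realType) (n t : nat) (f : 'I_n -> timed R) :
  (forall i, (ctime (f i) <= t)%N) -> (ctime (tab f) <= n * t)%N.
Proof. exact: sum_ord_leq. Qed.

Lemma tab_space (R : realType) (n s : nat) (f : 'I_n -> timed R) :
  (forall i, (cspace (f i) <= s)%N) -> (cspace (tab f) <= s.+1)%N.
Proof. by move=> fs; apply/bigmax_leqP => i _; rewrite ltnS. Qed.

Lemma csum_time (R : realType) (n t : nat) (f : 'I_n -> timed R) :
  (forall i, (ctime (f i) <= t)%N) -> (ctime (csum f) <= n * t.+1)%N.
Proof. by move=> ft; apply: sum_ord_leq => i; rewrite ltnS. Qed.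

Lemma csum_space (R : realType) (n s : nat) (f : 'I_n -> timed R) :
  (forall i, (cspace (f i) <= s)%N) -> (cspace (csum f) <= s.+1)%N.
Proof. by move=> fs; apply/bigmax_leqP => i _; rewrite ltnS. Qed.

Lemma cmin1_time (R : realType) (n t : nat) (f : 'I_n -> timed R) :
  (forall i, (ctime (f i) <= t)%N) -> (ctime (cmin1 f) <= n * t.+1)%N.
Proof. by move=> ft; apply: sum_ord_leq => i; rewrite ltnS. Qed.

Lemma cmin1_space (R : realType) (n s : nat) (f : 'I_n -> timed R) :
  (forall i, (cspace (f i) <= s)%N) -> (cspace (cmin1 f) <= s.+1)%N.
Proof. by move=> fs; apply/bigmax_leqP => i _; rewrite ltnS. Qed.

(** * Triangular solves by substitution *)

Lemma mul_set_entry (R : realType) (m : nat) (M : 'M[R]_m) (b : 'cV[R]_m) j x i :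
  (M *m set_entry b j x) i 0 = (M *m b) i 0 + M i j * (x - b j 0).
Proof.
rewrite !mxE (bigD1 j) //= [in RHS](bigD1 j) //= mxE eqxx.
rewrite (eq_bigr (fun k => M i k * b k 0)); first ring.
by move=> k kj; rewrite mxE (negbTE kj).
Qed.

(** Loop invariant. Unknowns still to be computed are 0, so the product with a full row sees only
    the solved ones; [pairwise] says that later updates do not affect rows already solved. The
    second conjunct carries this through the induction. *)
Lemma trsolve_rows (R : realType) (m : nat) (M : 'M[R]_m) (a b : 'cV[R]_m) l :
  (forall j, M j j != 0) -> uniq l -> pairwise (fun i j => M i j == 0) l ->
  (forall j, j \in l -> b j 0 = 0) ->
  let b' := cval (cfold (fun (j : 'I_m) (b : 'cV[R]_m) =>
    let$ s := csum (fun k => rmul (M j k) (b k 0)) in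
    let$ t := rsub (a j 0) s in
    let$ x := rdiv t (M j j) in
    ret (set_entry b j x)) l b) in
  (forall j, j \in l -> (M *m b') j 0 = a j 0) /\
  (forall i, (forall j, j \in l -> M i j = 0) -> (M *m b') i 0 = (M *m b) i 0).
Proof.
move=> M0; elim: l b => [b|j l IH b]; first by split.
move=> /= /andP[jl ul] /andP[/allP Mj pl] b0.
set x := (a j 0 - _) / _.
have [k kl|rows old] := IH (set_entry b j x) ul pl.
  rewrite mxE ifN ?b0 ?inE ?kl ?orbT //.
  by apply: contraNneq jl => <-.
split=> [i|i Mi].
  rewrite inE => /predU1P[->|/rows//].
  rewrite old => [|k /Mj/eqP//].
  rewrite mul_set_entry b0 ?mem_head // subr0 /x mulrC divfK //.
  by rewrite [(M *m b) j 0]mxE addrC subrK.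
rewrite old => [|k kl]; last by rewrite Mi // inE kl orbT.
by rewrite mul_set_entry Mi ?mem_head // mul0r addr0.
Qed.

Lemma trsolveE (R : realType) (m : nat) (M : 'M[R]_m) (a : 'cV[R]_m) l :
  (forall j, M j j != 0) -> uniq l -> pairwise (fun i j => M i j == 0) l ->
  (forall j, j \in l) -> M *m cval (trsolve M l a) = a.
Proof.
move=> M0 ul pl lT.
have [|rows _] := @trsolve_rows R m M a 0 l M0 ul pl; first by move=> j _; rewrite mxE.
by apply/colP => j; exact: rows (lT j).
Qed.

Lemma pairwise_enum_ord (m : nat) :
  pairwise (fun i j : 'I_m => (i < j)%N) (enum 'I_m).
Proof.
rewrite -(pairwise_map val ltn) val_enum_ord -sorted_pairwise ?iota_ltn_sorted //.
exact: ltn_trans.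
Qed.

Lemma forwardE (R : realType) (m : nat) (L : 'M[R]_m) (a : 'cV[R]_m) :
  is_trig_mx L -> (forall j, 0 < L j j) -> L *m cval (forward L a) = a.
Proof.
move=> /is_trig_mxP tL dL; apply: trsolveE.
- by move=> j; rewrite gt_eqF.
- exact: enum_uniq.
- by apply: sub_pairwise (pairwise_enum_ord m) => i j /tL ->.
- by move=> j; rewrite mem_enum.
Qed.

Lemma backwardE (R : realType) (m : nat) (L : 'M[R]_m) (a : 'cV[R]_m) :
  is_trig_mx L -> (forall j, 0 < L j j) -> L^T *m cval (backward L a) = a.
Proof.
move=> /is_trig_mxP tL dL; apply: trsolveE.
- by move=> j; rewrite mxE gt_eqF.
- by rewrite rev_uniq enum_uniq.
- have : pairwise (fun i j : 'I_m => (j < i)%N) (rev (enum 'I_m)).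
    rewrite -sorted_pairwise; last by move=> x y z /= h1 h2; exact: ltn_trans h2 h1.
    rewrite rev_sorted sorted_pairwise; first exact: pairwise_enum_ord.
    by move=> x y z /= h1 h2; exact: ltn_trans h1 h2.
  by apply: sub_pairwise => i j /tL; rewrite mxE => ->.
- by move=> j; rewrite mem_rev mem_enum.
Qed.

Lemma cfold_time (I St : Type) (SSt : Sized St) (body : I -> St -> timed St)
    (t : nat) l st :
  (forall i st, ctime (body i st) <= t)%N -> (ctime (cfold body l st) <= size l * t)%N.
Proof.
move=> bt; elim: l st => [//|i l IH] st /=.
by rewrite mulSn; apply: leq_add.
Qed.

Lemma cfold_space (I St : Type) (SSt : Sized St) (body : I -> St -> timed St)
    (w c : nat) l st :
  (forall st, words st <= w)%N -> (forall i st, cspace (body i st) <= c)%N ->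
  (cspace (cfold body l st) <= 2 * w + c)%N.
Proof.
move=> sw bc; elim: l st => [|i l IH] st /=.
  by rewrite (leq_trans (sw st)) //; lia.
rewrite geq_max IH andbT mul2n -addnn.
by rewrite leq_add // leq_add.
Qed.

Lemma trsolve_time (R : realType) (m : nat) (M : 'M[R]_m) l (a : 'cV[R]_m) :
  (ctime (trsolve M l a) <= size l * (2 * m + 2))%N.
Proof.
apply: cfold_time => j b.
have h := @csum_time R m 1 (fun k => rmul (M j k) (b k 0)) (fun=> leqnn _).
by cost; lia.
Qed.

Lemma trsolve_space (R : realType) (m : nat) (M : 'M[R]_m) l (a : 'cV[R]_m) :
  (cspace (trsolve M l a) <= 2 * m + 3)%N.
Proof.
apply: cfold_space => [b|j b]; first by rewrite /words /words_mx muln1.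
have h := @csum_space R m 0 (fun k => rmul (M j k) (b k 0)) (fun=> leqnn _).
by cost; lia.
Qed.

Section Factor.
Variables (R : realType) (n : nat) (F : nys_factor R n).
Hypothesis trigF : is_trig_mx (fL F).
Hypothesis diagF : forall j, 0 < fL F j j.

Let m := size (pts F).

Lemma matvecE (v : 'cV[R]_n) : cval (matvec F v) = Ktilde F *m v.
Proof.
rewrite /matvec; cost.
set a := cval (tab (fun j : 'I_(size (pts F)) => _)); set b := cval (forward _ _); set c := cval (backward _ _).
have aE : a = (fV F)^T *m v.
  by apply/colP => j; rewrite !mxE; apply: eq_bigr => i _; rewrite mxE.
have bE : fL F *m b = a by exact: forwardE.
have cE : (fL F)^T *m c = b by exact: backwardE.
have Lu : fL F \in unitmx.
  by rewrite unitmxE (det_trig trigF) unitfE; apply/prodf_neq0 => j _; rewrite gt_eqF.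
have LLu : fL F *m (fL F)^T \in unitmx by rewrite unitmx_mul unitmx_tr Lu.
have c'E : c = invmx (fL F *m (fL F)^T) *m a.
  by rewrite -bE -cE mulmxA mulKmx.
rewrite /Ktilde -!mulmxA -aE -c'E.
by apply/colP => i; rewrite !mxE.
Qed.

(** As [A = L L^T], a diagonal entry of [Ktilde] is the squared norm of [L^-1 v], with [v] the
    corresponding row of [V]; one forward substitution per point computes it. *)
Lemma stop_testE (tau : R) : 0 <= tau -> (cval (stop_test F tau) = true) <->
  forall i, 1 - Ktilde F i i <= tau.
Proof.
move=> tau0; rewrite /stop_test /=.
have E i : \sum_k cval (forward (fL F) (row i (fV F))^T) k 0 *
      cval (forward (fL F) (row i (fV F))^T) k 0 = Ktilde F i i.
  set b := cval _; have bE : fL F *m b = (row i (fV F))^T by exact: forwardE.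
  have Lu : fL F \in unitmx.
    by rewrite unitmxE (det_trig trigF) unitfE; apply/prodf_neq0 => j _; rewrite gt_eqF.
  have LTu : (fL F)^T \in unitmx by rewrite unitmx_tr.
  have LLu : fL F *m (fL F)^T \in unitmx by rewrite unitmx_mul LTu Lu.
  have : (b^T *m b) 0 0 = Ktilde F i i.
    have -> : Ktilde F i i = (row i (fV F) *m invmx (fL F *m (fL F)^T) *m (row i (fV F))^T) 0 0.
      rewrite /Ktilde [LHS]mxE [RHS]mxE; apply: eq_bigr => k _.
      by rewrite -row_mul !mxE.
    have LL : invmx (fL F *m (fL F)^T) *m fL F = invmx (fL F)^T.
      by rewrite -{3}(mulmxK LTu (fL F)) mulKmx.
    have -> : row i (fV F) = (fL F *m b)^T by rewrite bE trmxK.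
    by rewrite trmxK trmx_mul !mulmxA -(mulmxA _ _ (fL F)) LL mulmxK.
  by rewrite mxE => <-; apply: eq_bigr => k _; rewrite mxE.
under eq_bigr do rewrite E.
split=> [h i|h].
  apply: le_trans h; rewrite lerD2l lerN2.
  by apply: bigmin_le.
(* The accumulator of [cmin1] starts at 1, which is harmless as [1 - 1 <= tau]. *)
rewrite lerBlDr -lerBlDl; apply/bigmin_geP; split; first by lra.
by move=> i _; have := h i; lra.
Qed.

End Factor.

(** * Cost of the subroutines *)

Section Costs.
Variables (R : realType) (n : nat) (F : nys_factor R n).
Let m := size (pts F).
Hypothesis m0 : (0 < m)%N.
Hypothesis mn : (m <= n)%N.

Let nm1 : (0 < n)%N. Proof. exact: leq_trans mn. Qed.
(** These bounds let [lia], to which products are atoms, compare all costs with [n * m]. *)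
Let nm_n : (n <= n * m)%N. Proof. by rewrite -{1}[n]muln1 leq_mul2l m0 orbT. Qed.
Let nm_m : (m <= n * m)%N. Proof. by rewrite -{1}[m]mul1n leq_mul2r nm1 orbT. Qed.
Let nm_mm : (m * m <= n * m)%N. Proof. by rewrite leq_mul2r mn orbT. Qed.

Lemma forward_time (a : 'cV[R]_m) : (ctime (forward (fL F) a) <= m * (2 * m + 2))%N.
Proof. by rewrite /forward; have := trsolve_time (fL F) (enum 'I_m) a; rewrite size_enum_ord. Qed.

Lemma backward_time (a : 'cV[R]_m) : (ctime (backward (fL F) a) <= m * (2 * m + 2))%N.
Proof.
rewrite /backward; have := trsolve_time (fL F)^T (rev (enum 'I_m)) a.
by rewrite size_rev size_enum_ord.
Qed.

Lemma matvec_time (v : 'cV[R]_n) : (ctime (matvec F v) <= 12 * (n * m))%N.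
Proof.
rewrite /matvec; cost.
set f1 := fun j => csum _; set a := cval (tab f1); set b := cval (forward _ a).
set c := cval (backward _ b); set f2 := fun i => csum _.
have h1 : (ctime (tab f1) <= m * (n * 2))%N by apply: tab_time => i; apply: csum_time.
have h2 : (ctime (tab f2) <= n * (m * 2))%N by apply: tab_time => i; apply: csum_time.
have h3 := forward_time a; have h4 := backward_time b.
rewrite -/m in h1 h2 h3 h4 *; nia.
Qed.

Lemma matvec_space (v : 'cV[R]_n) : (cspace (matvec F v) <= 8 * n)%N.
Proof.
rewrite /matvec; cost.
set f1 := fun j => csum _; set a := cval (tab f1); set b := cval (forward _ a).
set c := cval (backward _ b); set f2 := fun i => csum _.
have h1 : (cspace (tab f1) <= 2)%N by apply: tab_space => i; apply: csum_space.
have h2 : (cspace (tab f2) <= 2)%N by apply: tab_space => i; apply: csum_space.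
have h3 : (cspace (forward (fL F) a) <= 2 * m + 3)%N := trsolve_space _ _ a.
have h4 : (cspace (backward (fL F) b) <= 2 * m + 3)%N := trsolve_space _ _ b.
rewrite -/m in h1 h2 h3 h4 *; lia.
Qed.

Lemma marginal_time (d1 d2 : 'cV[R]_n) : (ctime (marginal F d1 d2) <= 13 * (n * m))%N.
Proof.
rewrite /marginal; cost; have h1 := matvec_time d2.
set f := fun i => _; have h2 : (ctime (tab f) <= n * 1)%N by exact: tab_time.
lia.
Qed.

Lemma marginal_space (d1 d2 : 'cV[R]_n) : (cspace (marginal F d1 d2) <= 9 * n)%N.
Proof.
rewrite /marginal; cost; have h1 := matvec_space d2.
set f := fun i => _; have h2 : (cspace (tab f) <= 1)%N by exact: tab_space.
lia.
Qed.

Local Opaque matvec marginal.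

Lemma dist1_time (u v : 'cV[R]_n) : (ctime (dist1 u v) <= n * 3)%N.
Proof. exact: csum_time. Qed.

Lemma dist1_space (u v : 'cV[R]_n) : (cspace (dist1 u v) <= 2)%N.
Proof. exact: csum_space. Qed.

Let if_time (b : bool) (x y : R) : (ctime (if b then ret 0%R else rdiv x y) <= 2)%N.
Proof. by case: b. Qed.

Let if_space (b : bool) (x y : R) : (cspace (if b then ret 0%R else rdiv x y) <= 1)%N.
Proof. by case: b. Qed.

(* Replaces the costs of the subroutines by variables bounded by the lemmas
   above, so that [lia] does not have to compare these large terms. *)
Ltac abstract_costs := repeat match goal with
  | |- context [ctime (marginal F ?a ?b)] =>
      generalize (marginal_time a b); generalize (ctime (marginal F a b)); intros ? ?
  | |- context [cspace (marginal F ?a ?b)] =>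
      generalize (marginal_space a b); generalize (cspace (marginal F a b)); intros ? ?
  | |- context [ctime (dist1 ?a ?b)] =>
      generalize (dist1_time a b); generalize (ctime (dist1 a b)); intros ? ?
  | |- context [cspace (dist1 ?a ?b)] =>
      generalize (dist1_space a b); generalize (cspace (dist1 a b)); intros ? ?
  | |- context [ctime (matvec F ?a)] =>
      generalize (matvec_time a); generalize (ctime (matvec F a)); intros ? ?
  | |- context [cspace (matvec F ?a)] =>
      generalize (matvec_space a); generalize (cspace (matvec F a)); intros ? ?
  | |- context [ctime (tab ?f)] =>
      let h := fresh in
      assert (h : (ctime (tab f) <= n * 2)%N)
        by (apply: tab_time; intros ?; first [exact: isT | exact: if_time]);
      move: h; generalize (ctime (tab f)); intros ? ?
  | |- context [ctime (csum ?f)] =>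
      let h := fresh in
      assert (h : (ctime (csum f) <= n * 3)%N) by (apply: csum_time; intros ?; exact: isT);
      move: h; generalize (ctime (csum f)); intros ? ?
  | |- context [cspace (tab ?f)] =>
      let h := fresh in
      assert (h : (cspace (tab f) <= 2)%N)
        by (apply: tab_space; intros ?; first [exact: isT | exact: if_space]);
      move: h; generalize (cspace (tab f)); intros ? ?
  | |- context [cspace (csum ?f)] =>
      let h := fresh in
      assert (h : (cspace (csum f) <= 2)%N) by (apply: csum_space; intros ?; exact: isT);
      move: h; generalize (cspace (csum f)); intros ? ?
  end.


Lemma sk_test_time p' q' delta0 st : (ctime (sk_test F p' q' delta0 st) <= 35 * (n * m))%N.
Proof.
case: st => -[d1 d2] b; rewrite /sk_test; cost; abstract_costs; lia.
Qed.

Lemma sk_test_space p' q' delta0 st : (cspace (sk_test F p' q' delta0 st) <= 16 * n)%N.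
Proof.
case: st => -[d1 d2] b; rewrite /sk_test; cost; abstract_costs; lia.
Qed.

Lemma sk_body_time p' q' st : (ctime (sk_body F p' q' st) <= 14 * (n * m))%N.
Proof.
by case: st => -[d1 d2] []; rewrite /sk_body; cost; abstract_costs; lia.
Qed.

Lemma sk_body_space p' q' st : (cspace (sk_body F p' q' st) <= 10 * n)%N.
Proof.
by case: st => -[d1 d2] []; rewrite /sk_body; cost; abstract_costs; lia.
Qed.

Lemma sk_value_time eta d1 d2 : (ctime (sk_value F eta d1 d2) <= 34 * (n * m))%N.
Proof.
rewrite /sk_value; cost; abstract_costs; lia.
Qed.

Lemma sk_value_space eta d1 d2 : (cspace (sk_value F eta d1 d2) <= 16 * n)%N.
Proof.
rewrite /sk_value; cost; abstract_costs; lia.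
Qed.

Lemma csmooth_time t (p : 'cV[R]_n) : (ctime (csmooth t p) <= 4 * n)%N.
Proof.
rewrite /csmooth; cost; abstract_costs; lia.
Qed.

Lemma csmooth_space t (p : 'cV[R]_n) : (cspace (csmooth t p) <= 4 * n)%N.
Proof.
rewrite /csmooth; cost; abstract_costs; lia.
Qed.

Lemma stop_test_time tau : (ctime (stop_test F tau) <= 9 * (n * (m * m)))%N.
Proof.
rewrite /stop_test; cost; set f := fun i => _.
have h3 : (ctime (cmin1 f) <= n * (m * (2 * m + 2) + m * 2).+1)%N.
  apply: cmin1_time => i; rewrite /f; cost; apply: leq_add; first exact: forward_time.
  exact: csum_time.
have h4 : (n * m <= n * (m * m))%N by rewrite leq_mul2l -{1}[m]muln1 leq_mul2l m0 !orbT.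
nia.
Qed.

Lemma stop_test_space tau : (cspace (stop_test F tau) <= 9 * n)%N.
Proof.
rewrite /stop_test; cost; set f := fun i => _.
have h3 : (cspace (cmin1 f) <= (3 * m + 3).+1)%N.
  apply: cmin1_space => i; rewrite /f; cost.
  move: (trsolve_space (fL F) (enum 'I_m) (row i (fV F))^T : cspace (forward _ _) <= 2 * m + 3)%N.
  by abstract_costs; rewrite -/m; lia.
lia.
Qed.

Lemma round_plan_time d1 d2 p q : (ctime (round_plan F d1 d2 p q) <= 70 * (n * m))%N.
Proof.
rewrite /round_plan; cost; abstract_costs; lia.
Qed.

Lemma round_plan_space d1 d2 p q : (cspace (round_plan F d1 d2 p q) <= 26 * n)%N.
Proof.
rewrite /round_plan; cost; abstract_costs; lia.
Qed.

Local Transparent matvec marginal.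

End Costs.

(** * Bounded loops along a known sequence of states *)

Section While.
Variables (St : Type) (SSt : Sized St) (test : St -> timed bool) (body : St -> timed St).
Variables (st : nat -> St) (tt tb w S : nat).
Hypothesis stS : forall k, cval (body (st k)) = st k.+1.
Hypothesis test_time : forall x, (ctime (test x) <= tt)%N.
Hypothesis body_time : forall x, (ctime (body x) <= tb)%N.
Hypothesis words_le : forall x : St, (words x <= w)%N.
(** The strict inequality leaves one word for the boolean. *)
Hypothesis test_space : forall x, (cspace (test x) < S)%N.
Hypothesis body_space : forall x, (w + cspace (body x) <= S)%N.

Lemma while_some k fuel i : ~~ cval (test (st (i + k))) -> (k < fuel)%N ->
  exists c, while test body fuel (st i) = Some c.
Proof.
elim: k fuel i => [|k IH] [|fuel] i //= stop kf.
  by rewrite addn0 in stop; rewrite (negbTE stop); eexists.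
case: ifP => _; last by eexists.
rewrite stS; have [||c ->] := IH fuel i.+1 => //; first by rewrite addSnnS.
by eexists.
Qed.

(** The loop stops at or before [i + k]; [j] counts the iterations performed, with one test more
    than bodies. *)
Lemma while_result k fuel i c : ~~ cval (test (st (i + k))) ->
  while test body fuel (st i) = Some c ->
  exists j, [/\ (j <= k)%N, cval c = st (i + j), ~~ cval (test (st (i + j))),
    (ctime c <= j.+1 * tt + j * tb)%N & (cspace c <= w + S)%N].
Proof.
elim: fuel k i c => [//|fuel IH] k i c stop /=.
case: ifPn => [go|go].
  case: k stop => [|k] stop; first by rewrite addn0 go in stop.
  rewrite stS; case E: (while _ _ _ _) => [c'|//] /= [<-] /=.
  have [|j [jk cE tj ct cs]] := IH k i.+1 c' _ E; first by rewrite addSnnS.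
  exists j.+1; rewrite -addSnnS; split=> //.
    have h1 := test_time (st i); have h2 := body_time (st i).
    rewrite !mulSn in ct *; lia.
  rewrite geq_max cs andbT; apply: leq_add => //.
  rewrite geq_max; apply/andP; split; first by rewrite /words /words_bool add1n.
  by apply: leq_trans (body_space (st i)); rewrite leq_add2r.
case=> <-; exists 0%N; rewrite addn0; split=> //=.
  by rewrite mul1n mul0n addn0.
by apply: leq_add => //; rewrite /words /words_bool add1n.
Qed.

End While.

(** * Sinkhorn and Round *)

Section Algorithm.
Variables (R : realType) (n : nat) (F : nys_factor R n).
Let m := size (pts F).
Hypothesis m0 : (0 < m)%N.
Hypothesis mn : (m <= n)%N.
Hypothesis trigF : is_trig_mx (fL F).
Hypothesis diagF : forall j, 0 < fL F j j.
Hypothesis symK : (Ktilde F)^T = Ktilde F.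

Let K := Ktilde F.

Let symKE i j : K i j = K j i. Proof. by rewrite /K -{1}symK mxE. Qed.

Lemma marginalE d1 d2 i :
  cval (marginal F d1 d2) i 0 = \sum_j scaled K (d1, d2) i j.
Proof.
rewrite /marginal; cost; rewrite mxE; cost; rewrite matvecE // mxE mulr_sumr.
by apply: eq_bigr => j _; rewrite scaledE mulrA.
Qed.

Lemma marginal_colE d1 d2 j :
  cval (marginal F d2 d1) j 0 = \sum_i scaled K (d1, d2) i j.
Proof.
rewrite marginalE; apply: eq_bigr => i _; rewrite !scaledE symKE; ring.
Qed.

Lemma csmoothE t (p : 'cV[R]_n) : cval (csmooth t p) = smooth t p.
Proof.
by rewrite /csmooth; cost; apply/colP => i; rewrite !mxE /= mulr1.
Qed.

Lemma round_planE d1 d2 p q :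
  plan_mx (cval (round_plan F d1 d2 p q)) = rounding (scaled K (d1, d2)) p q.
Proof.
set P := scaled K (d1, d2).
pose u := cval (marginal F d1 d2).
pose x := cval (tab (fun i => bind (SA := @words_real R) (rdiv (p i 0) (u i 0)) (fun z => rmin z 1))).
pose l := cval (tab (fun i => rmul (x i 0) (d1 i 0))).
pose v := cval (marginal F d2 l).
pose y := cval (tab (fun j => bind (SA := @words_real R) (rdiv (q j 0) (v j 0)) (fun z => rmin z 1))).
pose r := cval (tab (fun j => rmul (d2 j 0) (y j 0))).
pose u'' := cval (marginal F l r).
pose er := cval (tab (fun i => rsub (p i 0) (u'' i 0))).
pose v'' := cval (marginal F r l).
pose ec := cval (tab (fun j => rsub (q j 0) (v'' j 0))).
pose s := cval (csum (fun i => rabs (er i 0))).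
pose f := cval (tab (fun j => if s <= 0 then ret 0 else rdiv (ec j 0) s)).
have -> : cval (round_plan F d1 d2 p q) = Plan F l r er f by [].
rewrite /plan_mx; cbn [gF gl gr ge gf].
have xE i : x i 0 = round_row P p i by rewrite mxE; cost; rewrite /u marginalE.
have lE i : l i 0 = round_row P p i * d1 i 0 by rewrite mxE; cost; rewrite xE.
have yE j : y j 0 = round_col P p q j.
  rewrite mxE; cost; rewrite /v marginal_colE /round_col; congr (Num.min (_ / _) _).
  by apply: eq_bigr => i _; rewrite !scaledE lE !mulrA.
have rE j : r j 0 = d2 j 0 * round_col P p q j by rewrite mxE; cost; rewrite yE.
have coreE i j : scaled K (l, r) i j = round_core P p q i j.
  by rewrite scaledE [RHS]mxE scaledE lE rE; ring.
have erE i : er i 0 = round_er P p q i.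
  rewrite mxE; cost; rewrite /u'' marginalE /round_er; congr (_ - _).
  by apply: eq_bigr => j _; rewrite coreE.
have ecE j : ec j 0 = round_ec P p q j.
  rewrite mxE; cost; rewrite /v'' marginal_colE /round_ec; congr (_ - _).
  by apply: eq_bigr => i _; rewrite coreE.
have sE : s = round_defect P p q by apply: eq_bigr => i _; cost; rewrite erE.
have fE j : f j 0 = round_ef P p q j.
  by rewrite mxE /round_ef sE; case: ifP => // _; cost; rewrite ecE.
apply/matrixP => i j; rewrite [LHS]mxE [RHS]mxE -coreE; congr (_ + _).
by rewrite mxE big_ord1 [X in _ * X = _]mxE erE fE.
Qed.

Section Sinkhorn.
Variables (eta delta0 : R) (p q : 'cV[R]_n).
Let p' := smooth (delta0 / 8) p.
Let q' := smooth (delta0 / 8) q.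
Let D := sinkhorn_iter K p' q'.
(** The flag is true at even [k], when [sinkhorn_iter] updates the rows. *)
Let st k : sk_state R n := ((D k).1, (D k).2, ~~ odd k).

Lemma sk_testE k : cval (sk_test F p' q' delta0 (st k)) =
  (delta0 / 2 < sinkhorn_err K p' q' (D k)).
Proof.
rewrite /sk_test /st; cost; congr (_ < _); rewrite /sinkhorn_err /normL1.
congr (_ + _); apply: eq_bigr => i _; cost; congr `|_|.
  rewrite marginalE -surjective_pairing [RHS]mxE mul_onesE; congr (_ + _).
  by rewrite [RHS]mxE.
rewrite marginal_colE -surjective_pairing [RHS]mxE mul_onesE; congr (_ + _); last by rewrite [RHS]mxE.
by apply: eq_bigr => j _; rewrite [RHS]mxE.
Qed.

Lemma sk_bodyE k : cval (sk_body F p' q' (st k)) = st k.+1.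
Proof.
rewrite /st /D; cbn [sinkhorn_iter]; rewrite -/D oddS; case: (odd k); cbn [negb].
  rewrite /sk_body; cost; congr (_, _, _); apply/colP => j.
  by rewrite [LHS]mxE [RHS]mxE; cost; rewrite matvecE // symK.
rewrite /sk_body; cost; congr (_, _, _); apply/colP => i.
by rewrite [LHS]mxE [RHS]mxE; cost; rewrite matvecE.
Qed.

Lemma sk_valueE d1 d2 : cval (sk_value F eta d1 d2) =
  eta^-1 * (\sum_i ln (d1 i 0) * (\sum_j scaled K (d1, d2) i j) +
            \sum_j ln (d2 j 0) * (\sum_i scaled K (d1, d2) i j)).
Proof.
rewrite /sk_value; cost; rewrite mulrC; congr (_ * _).
congr (_ + _); apply: eq_bigr => i _ /=; first by rewrite marginalE.
by rewrite marginal_colE.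
Qed.

Hypothesis n2 : (1 < n)%N.

(** [k] is any index of small error and only bounds the cost; the loop may stop at an earlier [j],
    whose error is small by the test itself. *)
Lemma sinkhorn_result k : sinkhorn_err K p' q' (D k) <= delta0 / 2 ->
  (forall fuel, (k < fuel)%N -> exists c, sinkhorn fuel F eta p q delta0 = Some c) /\
  forall fuel c, sinkhorn fuel F eta p q delta0 = Some c ->
    exists j, [/\ cval c = ((D j).1, (D j).2, cval (sk_value F eta (D j).1 (D j).2)),
      sinkhorn_err K p' q' (D j) <= delta0 / 2,
      (ctime c <= 100 * (k.+1 * (n * m)))%N & (cspace c <= 40 * n)%N].
Proof.
move=> errk.
have stop : ~~ cval (sk_test F p' q' delta0 (st (0 + k))).
  by rewrite sk_testE -leNgt.
split=> [fuel kf|fuel c]; rewrite /sinkhorn /pbind; cbn [cval rdiv]; rewrite !csmoothE.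
  have [c E] := @while_some _ (@words_sk_state R n) _ _ st sk_bodyE k fuel 0 stop kf.
  rewrite -/p' -/q' (_ : (ones R n, ones R n, true) = st 0) // E /=.
  by case: (cval c) => -[d1 d2] b; eexists.
rewrite -/p' -/q' (_ : (ones R n, ones R n, true) = st 0) //.
case E: (while _ _ _ _) => [c'|//].
have [j [jk c'E tj ct cs]] := @while_result _ (@words_sk_state R n) _ _ st
  (35 * (n * m)) (14 * (n * m)) (2 * n + 1) (17 * n) sk_bodyE
  (sk_test_time m0 mn p' q' delta0) (sk_body_time m0 mn p' q')
  ltac:(move=> x; cost; lia)
  ltac:(move=> x; have := sk_test_space m0 mn p' q' delta0 x; lia)
  ltac:(move=> x; have := sk_body_space m0 mn p' q' x; lia) k fuel 0%N c' stop E.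
rewrite c'E add0n /=.
case=> <-; exists j; split=> //.
- by rewrite add0n sk_testE -leNgt in tj.
- have nm1 : (n <= n * m)%N by rewrite -{1}[n]muln1 leq_mul2l m0 orbT.
  have hj : (j * (n * m) <= k * (n * m))%N by rewrite leq_mul2r jk orbT.
  have hv x y : (ctime (sk_value F eta x y) <= 34 * (n * m))%N by exact: sk_value_time.
  cost; repeat match goal with |- context [ctime (csmooth ?t ?x)] =>
    move: (csmooth_time m0 mn t x); generalize (ctime (csmooth t x)); let h := fresh "cost_le" in intros ? h end.
  match goal with |- context [ctime (sk_value F eta ?x ?y)] =>
    move: (hv x y); generalize (ctime (sk_value F eta x y)); let h := fresh "cost_le" in intros ? h end.
  lia.
- cost; repeat match goal with |- context [cspace (csmooth ?t ?x)] =>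
    move: (csmooth_space m0 mn t x); generalize (cspace (csmooth t x)); let h := fresh "cost_le" in intros ? h end.
  match goal with |- context [cspace (sk_value F eta ?x ?y)] =>
    move: (sk_value_space m0 mn eta x y); generalize (cspace (sk_value F eta x y)); let h := fresh "cost_le" in intros ? h end.
  lia.
Qed.

End Sinkhorn.
End Algorithm.

(** * AdaptiveNystrom *)

Section Adaptive.
Variables (R : realType) (n d : nat) (X : 'I_n -> 'cV[R]_d) (eta tau : R).
Variables (ny : nat -> timed (nys_factor R n)) (N : nat).
Hypothesis n2 : (1 < n)%N.
Hypothesis eta0 : 0 <= eta.
Hypothesis tau0 : 0 <= tau.
Hypothesis nyF : forall s, (0 < s)%N -> nystrom_factor X eta s (cval (ny s)).
Hypothesis nyT : forall s, (0 < s)%N -> (ctime (ny s) <= N * (n * s ^ 2 + s ^ 3))%N.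
Hypothesis nyS : forall s, (0 < s)%N -> (cspace (ny s) <= N * (n * (s + d)))%N.

Definition accepts s : Prop := forall i, 1 - Ktilde (cval (ny s)) i i <= tau.

Lemma accepts_test s : (0 < s)%N ->
  cval (stop_test (cval (ny s)) tau) = true <-> accepts s.
Proof. by move=> s0; have [_ _ _ tF dF _] := nyF s0; exact: stop_testE. Qed.

Lemma accepts_full s : (n <= s)%N -> accepts s.
Proof.
move=> ns i; have s0 : (0 < s)%N by apply: leq_trans ns; apply: ltnW.
by rewrite (Ktilde_diag_full (nyF s0)) // subrr.
Qed.

Lemma size_pts s : (0 < s)%N -> (0 < size (pts (cval (ny s))) <= n)%N.
Proof.
by move=> s0; rewrite (nf_size (nyF s0)) leq_min geq_minr s0 (ltnW n2).
Qed.

Lemma adaptive_some k s fuel : (0 < s)%N -> (n <= 2 ^ k * s)%N -> (k < fuel)%N ->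
  exists c, adaptive_nystrom ny tau fuel s = Some c.
Proof.
elim: k s fuel => [|k IH] s [|fuel] // s0 ns kf; cbn [adaptive_nystrom]; cost.
  rewrite (iffRL (accepts_test s0)); first by eexists.
  by apply: accepts_full; rewrite expn0 mul1n in ns.
case: ifP => _; first by eexists.
have [|||c ->] := IH (2 * s)%N fuel => //; first by rewrite muln_gt0.
  by rewrite mulnA -expnSr.
by eexists.
Qed.

Let step s := let$ F := ny s in let$ b := stop_test F tau in ret (F, b).

(** As [s <= 2 * n], the term [s ^ 3] is at most [2 * n * s ^ 2]. *)
Let step_time s : (0 < s)%N -> (s <= 2 * n)%N ->
  (ctime (step s) <= (3 * N + 9) * (n * s ^ 2))%N.
Proof.
move=> s0 sn; have /andP[m0 mn] := size_pts s0.
have ms : (size (pts (cval (ny s))) <= s)%N by rewrite (nf_size (nyF s0)) geq_minl.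
rewrite /step; cost.
have := nyT s0; have := stop_test_time m0 mn tau.
set m := size _ in m0 mn ms *.
generalize (ctime (ny s)) (ctime (stop_test (cval (ny s)) tau)) => a b hb ha.
have h1 : (n * (m * m) <= n * s ^ 2)%N by rewrite expnS expn1 leq_mul // leq_mul.
have h2 : (s ^ 3 <= 2 * (n * s ^ 2))%N by rewrite expnS mulnA leq_mul.
have h3 : (N * s ^ 3 <= N * (2 * (n * s ^ 2)))%N by rewrite leq_mul2l h2 orbT.
by rewrite mulnDr in ha; lia.
Qed.

Let step_space s : (0 < s)%N ->
  (words (cval (step s)) + cspace (step s) <= (N + 20) * (n * (s + d)))%N.
Proof.
move=> s0; have /andP[m0 mn] := size_pts s0.
have ms : (size (pts (cval (ny s))) <= s)%N by rewrite (nf_size (nyF s0)) geq_minl.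
rewrite /step; cost.
have := nyS s0; have := stop_test_space m0 mn tau.
set m := size _ in m0 mn ms *.
generalize (cspace (ny s)) (cspace (stop_test (cval (ny s)) tau)) => a b hb ha.
have h1 : (m * m <= n * s)%N by rewrite leq_mul.
have h2 : (n * m <= n * s)%N by rewrite leq_mul.
have h3 : (n <= n * s)%N by rewrite -{1}[n]muln1 leq_mul.
by lia.
Qed.

(** Doubling [s] multiplies the step cost by 4, so the last step dominates; the extra summand in the
    time bound makes the induction close. Space is a maximum, since each attempt is released.
    Minimality of [sf] among accepted sizes is kept for the rank bound. *)
Lemma adaptive_result fuel s c : (0 < s)%N -> (s <= 2 * n)%N ->
  adaptive_nystrom ny tau fuel s = Some c ->
  exists2 sf, [/\ (s <= sf)%N, (sf <= 2 * n)%N, accepts sf,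
      (exists j, sf = 2 ^ j * s)%N & forall i, accepts (2 ^ i * s) -> (sf <= 2 ^ i * s)%N] &
    [/\ cval c = cval (ny sf),
     (ctime c + (3 * N + 9) * (n * s ^ 2) <= 2 * ((3 * N + 9) * (n * sf ^ 2)))%N &
     (cspace c <= (N + 20) * (n * (sf + d)))%N].
Proof.
elim: fuel s c => [//|fuel IH] s c s0 sn; cbn [adaptive_nystrom].
have st := step_time s0 sn; have ss := step_space s0.
rewrite -/(step s); case: ifPn => [acc|rej].
  case=> <-; exists s.
    split=> //; first by apply/accepts_test.
      by exists 0%N; rewrite mul1n.
    by move=> i _; rewrite leq_pmull // expn_gt0.
  rewrite /after; cbn [cval ctime cspace ret]; split=> //.
    by rewrite addn0 mul2n -addnn leq_add2r.
have sn' : (s < n)%N.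
  rewrite ltnNge; apply: contra rej => ns.
  by apply/accepts_test => //; exact: accepts_full.
case E: adaptive_nystrom => [c'|//] /= [<-].
have [||sf [ssf sfn accf [j jE] first] [cE ct cs]] := IH _ _ _ _ E.
- by rewrite muln_gt0.
- by rewrite leq_mul2l ltnW.
exists sf.
  split=> //; first by apply: leq_trans ssf; rewrite leq_pmull.
    by exists j.+1; rewrite expnSr -mulnA.
  move=> [|i]; last by rewrite expnSr -mulnA; exact: first.
  by rewrite mul1n => /(accepts_test s0) acc; case/negP: rej.
rewrite /after; cbn [cval ctime cspace]; split=> //.
  have e1 : ((3 * N + 9) * (n * (2 * s) ^ 2) = 4 * ((3 * N + 9) * (n * s ^ 2)))%N.
    by rewrite expnMn; ring.
  by rewrite e1 in ct; lia.
rewrite geq_max cs andbT; apply: leq_trans ss _.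
rewrite leq_mul2l leq_mul2l leq_add2r; apply/orP; right; apply/orP; right.
by apply: leq_trans ssf; rewrite leq_pmull.
Qed.

End Adaptive.

(** * Nys-Sink for a fixed seed *)

Section NysSink.
Variables (R : realType) (n d : nat) (X : 'I_n -> 'cV[R]_d) (Rad eta eps : R).
Variables (p q : 'cV[R]_n).
Variables (ny : nat -> timed (nys_factor R n)) (N : nat).
Hypothesis n2 : (1 < n)%N.
Hypothesis eta0 : 0 <= eta.
Hypothesis nyF : forall s, (0 < s)%N -> nystrom_factor X eta s (cval (ny s)).
Hypothesis nyT : forall s, (0 < s)%N -> (ctime (ny s) <= N * (n * s ^ 2 + s ^ 3))%N.
Hypothesis nyS : forall s, (0 < s)%N -> (cspace (ny s) <= N * (n * (s + d)))%N.

(** It is [n] times the argument at which [r_star] evaluates [d_eff]. *)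
Definition tolerance : R := eps_prime n Rad eta eps / 2 * expR (- 4 * eta * Rad ^+ 2).
Hypothesis tau0 : 0 <= tolerance.

Definition sk_iter s k := sinkhorn_iter (Ktilde (cval (ny s)))
  (smooth (eps_prime n Rad eta eps / 8) p) (smooth (eps_prime n Rad eta eps / 8) q) k.
Definition sk_small s k : Prop := sinkhorn_err (Ktilde (cval (ny s)))
  (smooth (eps_prime n Rad eta eps / 8) p) (smooth (eps_prime n Rad eta eps / 8) q)
  (sk_iter s k) <= eps_prime n Rad eta eps / 2.

Variable kb : R.
Hypothesis sk_stops : forall s, (0 < s)%N -> accepts tolerance ny s ->
  exists2 k : nat, k%:R <= kb & sk_small s k.

Lemma cepsE : cval (ceps n Rad eta eps) = eps_prime n Rad eta eps.
Proof.
by rewrite /ceps /eps_prime; cost; rewrite (mulrC eps) expr2 mulrA.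
Qed.

Lemma ctauE x : cval (ctau Rad eta x) = x / 2 * expR (- 4 * eta * Rad ^+ 2).
Proof. by rewrite /ctau; cost; rewrite expr2. Qed.

Let sym s : (0 < s)%N -> (Ktilde (cval (ny s)))^T = Ktilde (cval (ny s)).
Proof. by move=> s0; exact: Ktilde_sym (nyF s0). Qed.

Lemma ceps_cost : (ctime (ceps n Rad eta eps) = 10)%N /\
  (cspace (ceps n Rad eta eps) <= 20)%N.
Proof. by rewrite /ceps; cost; split. Qed.

Lemma ctau_cost x : (ctime (ctau Rad eta x) = 6)%N /\
  (cspace (ctau Rad eta x) <= 20)%N.
Proof. by rewrite /ctau; cost; split. Qed.

Let sn2 : (2 <= 2 * n)%N.
Proof. by rewrite leq_pmulr // ltnW. Qed.

Lemma nys_sink_some : exists c, nys_sink_returns d ny Rad eta eps p q c.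
Proof.
(* One bound for both loops: after [n] doublings all points are selected, and Sinkhorn stops within
   [kb] iterations. *)
pose fuel := maxn n.+1 (Num.truncn kb).+2.
have [cF EF] := @adaptive_some _ _ _ _ _ _ _ n2 tau0 nyF n 2 fuel isT
  ltac:(by rewrite (leq_trans (ltnW (ltn_expl n (ltnSn 1)))) // leq_pmulr)
  (leq_maxl _ _).
have [sf [s2 sfn acc _ _] [cE _ _]] := adaptive_result n2 eta0 tau0 nyF nyT nyS (ltn0Sn 1) sn2 EF.
have sf0 : (0 < sf)%N by exact: ltnW.
have /andP[m0 mn] := size_pts n2 nyF sf0.
have [_ _ _ tF dF _] := nyF sf0.
have [k kkb small] := sk_stops sf0 acc.
have kf : (k < fuel)%N.
  rewrite leq_max; apply/orP; right; rewrite ltnS.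
  by apply: ltnW; rewrite -(ltr_nat R); apply: le_lt_trans kkb _; rewrite truncnS_gt.
have [/(_ fuel kf)[cS ES] _] := sinkhorn_result m0 mn tF dF (sym sf0) eta n2 small.
suff [c cE'] : exists c, nys_sink d ny Rad eta eps p q fuel = Some c.
  by exists c, fuel.
rewrite /nys_sink /nys_sink_body /pbind cepsE ctauE -/tolerance EF cE ES.
by case: (cval cS) => -[d1 d2] W /=; eexists.
Qed.

Lemma nys_sink_result c : nys_sink_returns d ny Rad eta eps p q c ->
  exists2 sf, [/\ (2 <= sf)%N, accepts tolerance ny sf,
    (exists j, sf = 2 ^ j * 2)%N & forall i, accepts tolerance ny (2 ^ i * 2) -> (sf <= 2 ^ i * 2)%N] &
  exists2 j, sk_small sf j &
    let F := cval (ny sf) in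
    let D := sk_iter sf j in
    [/\ gF (out_plan (cval c)) = F, out_r (cval c) = size (pts F),
      plan_mx (out_plan (cval c)) = rounding (scaled (Ktilde F) D) p q,
      out_W (cval c) = eta^-1 * (\sum_i ln (D.1 i 0) * (\sum_j scaled (Ktilde F) D i j) +
            \sum_j ln (D.2 j 0) * (\sum_i scaled (Ktilde F) D i j)) &
      (exists2 k : nat, k%:R <= kb & (ctime c <= (24 * N + 300) *
         (n * out_r (cval c) * (out_r (cval c) + k.+1)))%N) /\
      (cspace c <= (2 * N + 200) * (n * (out_r (cval c) + d)))%N].
Proof.
move=> [fuel]; rewrite /nys_sink /nys_sink_body /pbind cepsE ctauE -/tolerance.
case EF: adaptive_nystrom => [cF|//].
have [sf [s2 sfn acc sfj first] [cE ctF csF]] :=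
  adaptive_result n2 eta0 tau0 nyF nyT nyS (ltn0Sn 1) sn2 EF.
have sf0 : (0 < sf)%N by exact: ltnW.
have /andP[m0 mn] := size_pts n2 nyF sf0.
have [szF _ _ tF dF _] := nyF sf0.
have [k kkb small] := sk_stops sf0 acc.
have [_ sk] := sinkhorn_result m0 mn tF dF (sym sf0) eta n2 small.
rewrite cE; case ES: sinkhorn => [cS|//].
have [j [cSE errj ctS csS]] := sk fuel cS ES.
rewrite cSE; cbn [omap obind oapp cval ret bind] => /Some_inj <-.
exists sf => //; exists j => //; cbn [cval ctime cspace bind out_plan out_r out_W fst snd]; split=> //.
- by rewrite (round_planE tF dF (sym sf0)) -surjective_pairing.
- by rewrite (sk_valueE tF dF (sym sf0)) -surjective_pairing.
(* The doubling never passes [2 * n] and the rank is [minn sf n], so costs in terms of [sf] become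
   costs in terms of the rank. *)
have sf2 : (sf <= 2 * size (pts (cval (ny sf))))%N.
  by rewrite szF; case: (leqP sf n) => h; [rewrite leq_pmull|].
have wF : words (cval cF) = (size (pts (cval (ny sf))) + n * size (pts (cval (ny sf))) +
    size (pts (cval (ny sf))) * size (pts (cval (ny sf))))%N by rewrite cE.
set m := size _ in m0 mn ctS csS sf2 wF *.
have nm_n : (n <= n * m)%N by rewrite -{1}[n]muln1 leq_mul2l m0 orbT.
have n1 : (0 < n)%N by apply: ltnW.
have nm_mm : (m * m <= n * m)%N by rewrite leq_mul2r mn orbT.
split.
  exists k => //.
  have [-> _] := ceps_cost; have [-> _] := ctau_cost (eps_prime n Rad eta eps).
  match goal with |- context [ctime (round_plan ?F ?a ?b p q)] =>
    have := round_plan_time m0 mn a b p q; rewrite -/m;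
    generalize (ctime (round_plan F a b p q)) => rt hrt end.
  have h1 : (n * sf ^ 2 <= 4 * (n * m * m))%N.
    have h0 : (sf ^ 2 <= (2 * m) ^ 2)%N by rewrite leq_sqr.
    have := leq_mul (leqnn n) h0.
    by rewrite !expnS !expn0 !muln1; lia.
  have h2 : (N * (n * sf ^ 2) <= N * (4 * (n * m * m)))%N by rewrite leq_mul2l h1 orbT.
  have h3 : (n * m <= n * m * m)%N by rewrite -{1}[(n * m)%N]muln1 leq_mul2l m0 orbT.
  move: ctF ctS h1 h2; generalize (ctime cF) (ctime cS) (n * sf ^ 2)%N => x y z.
  cbn [ctime ret]; clear -hrt h3 nm_n n1; lia.
have [_ hc1] := ceps_cost; have [_ hc2] := ctau_cost (eps_prime n Rad eta eps).
match goal with |- context [cspace (round_plan ?F ?a ?b p q)] =>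
  have := round_plan_space m0 mn a b p q;
  (have : words (cval (round_plan F a b p q)) = (words (cval cF) + n * 1 + n * 1 + n * 1 + n * 1)%N
    by rewrite cE);
  generalize (words (cval (round_plan F a b p q)));
  generalize (cspace (round_plan F a b p q)) => rs rw hrw hrs end.
have wS : words (cval cS) = (n * 1 + n * 1 + 1)%N by [].
have csF' : (cspace cF <= (N + 20) * (n * (2 * m + d)))%N.
  by apply: leq_trans csF _; rewrite leq_mul2l leq_mul2l leq_add2r sf2 !orbT.
move: hc1 hc2 csF' csS; rewrite wS wF in hrw *.
generalize (cspace (ceps n Rad eta eps)) (cspace (ctau Rad eta (eps_prime n Rad eta eps)))
  (cspace cF) (cspace cS) => x1 x2 x3 x4.
change (words (cval (ceps n Rad eta eps))) with 1%N.
change (words (cval (ctau Rad eta (eps_prime n Rad eta eps)))) with 1%N.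
cbn [cspace ret]; clear -hrw hrs nm_n nm_mm n1 mn m0 => *; lia.
Qed.

End NysSink.

(** * Parameters *)

Lemma ln_le_nat (R : realType) (k : nat) (x : R) : 0 < x <= 2 ^+ k -> ln x <= k%:R.
Proof.
move=> hx; apply: (@le_trans _ _ (ln (2 ^+ k : R))).
  by rewrite ler_ln ?posrE ?exprn_gt0 //; case/andP: hx.
rewrite lnXn // -[leLHS]mulr_natr ler_piMl //.
by have := @ln_le_subr1 R 2 ltac:(by []); lra.
Qed.

Section Magnitudes.
Variables (R : realType) (n : nat) (Rad eta eps : R).
Hypothesis n2 : (1 < n)%N.
Hypothesis R1 : 1 <= Rad.
Hypothesis heta : 1 <= eta <= n%:R.
Hypothesis heps : 0 < eps < 1.

Let e := eps_prime n Rad eta eps.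
Let Lg := 1 + ln Rad + ln eta + ln n%:R + ln eps^-1.

Let e01 : 0 < e <= 1.
Proof. by have [] := budget_le n2 R1 heta heps. Qed.

Let signs : [/\ 0 <= ln Rad, 0 <= ln eta, 0 <= ln n%:R :> R & 0 <= ln eps^-1].
Proof.
have := heps; have := heta => he hp; split; rewrite ln_ge0 //; try lra.
by rewrite invf_ge1; lra.
Qed.

Lemma log_ge1 : 1 <= Lg.
Proof. by have [h1 h2 h3 h4] := signs; rewrite /Lg; lra. Qed.

(** The inverse of the quotient in [eps_prime] is [200 * Rad^2 / eps + 50 * l / (eta * eps)] with
    [l <= Lg]; 251 is [200 + 50] with some slack. *)
Lemma inv_eps_prime_le : e^-1 <= 251 * (Lg * (Rad ^+ 2 / eps)).
Proof.
have hp := heps; have he := heta; have r1 := R1; have l1 := log_ge1.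
have [h1 h2 h3 h4] := signs.
have n0 : 0 < n%:R :> R by rewrite ltr0n ltnW.
have eta0 : 0 < eta by lra.
have eps0 : 0 < eps by lra.
have R2 : 1 <= Rad ^+ 2 by rewrite expr_ge1 //; lra.
have ei : 1 <= eps^-1 by rewrite invf_ge1; lra.
have etai : eta^-1 <= 1 by rewrite invf_le1; lra.
have etai0 : 0 <= eta^-1 by rewrite invr_ge0 ltW.
have X1 : 1 <= Rad ^+ 2 / eps by rewrite mulr_ege1.
have LX : Rad ^+ 2 / eps <= Lg * (Rad ^+ 2 / eps) by rewrite ler_peMl; lra.
set l := ln (n%:R / (eta * eps)).
have lE : l = ln n%:R - ln eta + ln eps^-1.
  by rewrite /l invfM mulrA ln_mul ?divr_gt0 ?invr_gt0 // ln_div ?posrE.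
have lL : l <= Lg by rewrite lE /Lg; lra.
have l0 : 0 <= l.
  rewrite ln_ge0 // ler_pdivlMr ?mulr_gt0 // mul1r.
  by apply: le_trans (proj2 (andP he)); rewrite ler_piMr; lra.
rewrite /e /eps_prime -/l minEle; case: ifPn => _; first by rewrite invr1; lra.
have Re : 0 < Rad ^+ 2 * eta by rewrite mulr_gt0 //; lra.
have Lpos : 0 < 50 * (4 * Rad ^+ 2 * eta + l) by lra.
have -> : (eps * eta / (50 * (4 * Rad ^+ 2 * eta + l)))^-1 =
   200 * (Rad ^+ 2 / eps) + 50 * (l * (eta^-1 * eps^-1)).
  by field; rewrite ?gt_eqF //; lra.
have : l * (eta^-1 * eps^-1) <= Lg * (Rad ^+ 2 / eps).
  apply: ler_pM => //; first by rewrite mulr_ge0 // invr_ge0 ltW.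
  by apply: ler_pM => //; [rewrite invr_ge0 ltW|lra].
lra.
Qed.

Lemma eps_div_le : eps / Rad ^+ 2 <= 251 * (Lg * e).
Proof.
have hp := heps; have r1 := R1; have /andP[e0 _] := e01.
have R2 : 0 < Rad ^+ 2 by rewrite exprn_gt0 //; lra.
have eps0 : 0 < eps by lra.
have := inv_eps_prime_le.
rewrite -(ler_pM2r (mulr_gt0 e0 (divr_gt0 eps0 R2))).
rewrite mulrA mulVf ?gt_eqF // mul1r => /le_trans; apply.
rewrite le_eqVlt; apply/orP; left; apply/eqP; field.
have R0 : 0 < Rad by lra.
by rewrite !gt_eqF.
Qed.

(** Uses [ln Lg <= Lg - 1] for the logarithmic factor in the bound on the inverse of [eps'], and
    [1 <= Lg] to absorb numerical constants. *)
Lemma log_iterations_le : ln (2 * n%:R / e) <= 13 * Lg.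
Proof.
have hp := heps; have r1 := R1; have /andP[e0 _] := e01; have l1 := log_ge1.
have [h1 h2 h3 h4] := signs.
have n0 : 0 < n%:R :> R by rewrite ltr0n ltnW.
have R0 : 0 < Rad by lra.
have R2 : 0 < Rad ^+ 2 by rewrite exprn_gt0.
have eps0 : 0 < eps by lra.
have L0 : 0 < Lg by lra.
have ei0 : 0 < e^-1 by rewrite invr_gt0.
rewrite !ln_mul ?mulr_gt0 //.
have Y0 : 0 < Lg * (Rad ^+ 2 / eps) by rewrite mulr_gt0 // divr_gt0.
have : ln e^-1 <= ln (251 * (Lg * (Rad ^+ 2 / eps))).
  by rewrite ler_ln ?posrE ?inv_eps_prime_le // mulr_gt0.
rewrite (ln_mul _ Y0) // (ln_mul L0) ?divr_gt0 // ln_mul ?invr_gt0 // lnXn //.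
have a1 : ln 251 <= 8 :> R by apply: (@ln_le_nat _ 8); rewrite ltr0n -natrX ler_nat.
have a2 : ln 2 <= 1 :> R by apply: (@ln_le_nat _ 1); rewrite expr1 lexx ltr0n.
have a3 := ln_le_subr1 L0.
have a4 : 2 * ln Rad + ln eps^-1 + ln n%:R <= 2 * Lg by rewrite /Lg; lra.
rewrite mulr2n; lra.
Qed.

(** The rate of [sinkhorn_rate] when all entries are at least [exp (- 4 * eta * Rad^2) / 2]; the
    absolute value allows [CS] of any sign. *)
Definition iteration_bound (CS : R) : R :=
  `|CS| * e^-1 * (ln (2 * n%:R / e) + 4 * eta * Rad ^+ 2).

(** One factor [Lg * Rad^2] comes from the inverse of [eps'], another from the logarithm of the
    smallest entry; [4267 = 251 * (13 + 4)]. *)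
Lemma iteration_bound_le (CS : R) : iteration_bound CS <=
  4267 * `|CS| * (Lg ^+ 2 * (eta * Rad ^+ 4 / eps)).
Proof.
have hp := heps; have he := heta; have r1 := R1; have /andP[e0 _] := e01; have l1 := log_ge1.
have R2 : 1 <= Rad ^+ 2 by rewrite expr_ge1 //; lra.
have eR : 1 <= eta * Rad ^+ 2 by rewrite mulr_ege1 //; lra.
have h1 : ln (2 * n%:R / e) + 4 * eta * Rad ^+ 2 <= 17 * (Lg * (eta * Rad ^+ 2)).
  have a1 := log_iterations_le.
  have a2 : Lg <= Lg * (eta * Rad ^+ 2) by rewrite ler_peMr //; lra.
  have a3 : eta * Rad ^+ 2 <= Lg * (eta * Rad ^+ 2) by rewrite ler_peMl //; lra.
  lra.
have l0 : 0 <= ln (2 * n%:R / e) + 4 * eta * Rad ^+ 2.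
  rewrite addr_ge0 //; last by lra.
  rewrite ln_ge0 // ler_pdivlMr // mul1r.
  have : 1 <= n%:R :> R by rewrite (ler_nat _ 1) ltnW.
  by have /andP[_ e1] := e01; lra.
have ei0 : 0 <= e^-1 by rewrite invr_ge0 ltW.
have h2 := ler_pM ei0 l0 inv_eps_prime_le h1.
have := ler_wpM2l (normr_ge0 CS) h2; rewrite mulrA -/(iteration_bound CS) => /le_trans; apply.
rewrite le_eqVlt; apply/orP; left; apply/eqP; field.
by rewrite gt_eqF //; lra.
Qed.

End Magnitudes.

(** * Accuracy for a fixed seed *)

Lemma cost_mx_le (R : realType) (n d : nat) (X : 'I_n -> 'cV[R]_d) (Rad : R) i j :
  (forall i, norm2 (X i) <= Rad) -> cost_mx X i j <= 4 * Rad ^+ 2.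
Proof.
move=> hX; have sq k : \sum_a X k a 0 ^+ 2 <= Rad ^+ 2.
  by rewrite -norm2_sqr ler_sqr ?nnegrE ?sqrtr_ge0 // (le_trans (sqrtr_ge0 _) (hX k)).
rewrite mxE norm2_sqr.
apply: (@le_trans _ _ (\sum_a (2 * X i a 0 ^+ 2 + 2 * X j a 0 ^+ 2))).
  apply: ler_sum => a _; rewrite !mxE.
  by have := sqr_ge0 (X i a 0 + X j a 0); nra.
rewrite big_split /= -!mulr_sumr.
by have := sq i; have := sq j; lra.
Qed.

Lemma smooth_simplex_dist (R : realType) (n : nat) (p : 'cV[R]_n) (t : R) :
  (0 < n)%N -> 0 <= t -> simplex p -> \sum_i `|smooth t p i 0 - p i 0| <= 2 * t.
Proof.
move=> n0 t0 [p0 p1].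
apply: (@le_trans _ _ (\sum_i (t * p i 0 + t / n%:R))).
  apply: ler_sum => i _; rewrite !mxE mulr1.
  have -> : (1 - t) * p i 0 + t / n%:R - p i 0 = t / n%:R - t * p i 0 by ring.
  apply: le_trans (ler_normB _ _) _.
  by rewrite !ger0_norm ?mulr_ge0 ?divr_ge0 // addrC.
rewrite big_split /= -mulr_sumr p1 sumr_const card_ord -[X in _ + X]mulr_natr divfK; first lra.
by rewrite pnatr_eq0 -lt0n.
Qed.

(** Smoothing the marginals is what provides positive targets; the Gibbs argument takes logarithms
    of the scalings. *)
Lemma sinkhorn_iter_gt0 (R : realType) (n : nat) (K : 'M[R]_n) (p q : 'cV[R]_n) k :
  (0 < n)%N -> (forall i j, 0 < K i j) -> (forall i, 0 < p i 0) -> (forall j, 0 < q j 0) ->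
  (forall i, 0 < (sinkhorn_iter K p q k).1 i 0) /\
  (forall j, 0 < (sinkhorn_iter K p q k).2 j 0).
Proof.
move=> n0 K0 p0 q0; pose z := Ordinal n0.
have pos (M : 'M[R]_n) (v : 'cV[R]_n) i : (forall i j, 0 < M i j) ->
    (forall j, 0 < v j 0) -> 0 < (M *m v) i 0.
  move=> M0 v0; rewrite mxE (bigD1 z) //= ltr_wpDr ?mulr_gt0 //.
  by apply: sumr_ge0 => j _; rewrite ltW // mulr_gt0.
elim: k => [|k [IH1 IH2]] /=; first by split=> i; rewrite mxE.
case: (odd k) => /=; split=> // i; rewrite mxE divr_gt0 // pos //.
by move=> a b; rewrite mxE.
Qed.

Section Seed.
Variables (R : realType) (n d : nat) (X : 'I_n -> 'cV[R]_d) (Rad eta eps : R).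
Variables (p q : 'cV[R]_n).
Variables (ny : nat -> timed (nys_factor R n)).
Hypothesis n2 : (1 < n)%N.
Hypothesis R1 : 1 <= Rad.
Hypothesis heta : 1 <= eta <= n%:R.
Hypothesis heps : 0 < eps < 1.
Hypothesis hX : forall i, norm2 (X i) <= Rad.
Hypothesis sp : simplex p.
Hypothesis sq : simplex q.
Hypothesis nyF : forall s, (0 < s)%N -> nystrom_factor X eta s (cval (ny s)).

Let e := eps_prime n Rad eta eps.
Let tau := tolerance n Rad eta eps.
Let kap := expR (- 4 * eta * Rad ^+ 2).

Let eta0 : 0 < eta. Proof. by have := heta; lra. Qed.
Let e0 : 0 < e.
Proof. by have [/andP[h _] _ _] := budget_le n2 R1 heta heps. Qed.
Let e1 : e <= 1.
Proof. by have [/andP[_ h] _ _] := budget_le n2 R1 heta heps. Qed.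
Let kap0 : 0 < kap. Proof. exact: expR_gt0. Qed.

Lemma tolerance_gt0 : 0 < tau.
Proof. by rewrite /tau /tolerance mulr_gt0 // divr_gt0. Qed.

Lemma tolerance_le1 : tau <= 1.
Proof.
have k1 : kap <= 1.
  have := heta; have R2 : 0 <= Rad ^+ 2 by rewrite sqr_ge0.
  move=> he; rewrite /kap expR_le1 !mulNr oppr_le0 mulr_ge0 // mulr_ge0 //; lra.
have := e1; have := e0 => h0 h1; rewrite /tau /tolerance -/e -/kap.
by apply: (@le_trans _ _ (1 * 1)); [apply: ler_pM => //; [lra|exact: ltW|lra]|lra].
Qed.

Lemma kernel_ge i j : kap <= kernel_mx X eta i j.
Proof.
rewrite mxE /kap /gauss ler_expR.
have := cost_mx_le i j hX; rewrite mxE => /(ler_wpM2l (ltW eta0)).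
by move=> h; rewrite !mulNr lerN2; apply: le_trans h _; rewrite mulrCA mulrA.
Qed.

Section Accepted.
Variable s : nat.
Hypothesis s0 : (0 < s)%N.
Hypothesis acc : accepts tau ny s.

Let F := cval (ny s).

Let entries i j : `|kernel_mx X eta i j - Ktilde F i j| <= tau /\ Ktilde F i j <= 1.
Proof. exact: (Ktilde_entries (ltW eta0) (nyF s0)). Qed.

(** The tolerance is [e * kap / 2], at most half of the smallest possible kernel entry. *)
Lemma accepted_ge i j : kap / 2 <= Ktilde F i j.
Proof.
have [h1 _] := entries i j; have h2 := kernel_ge i j.
have h3 : tau <= kap / 2.
  have -> : tau = e * (kap / 2) by rewrite /tau /tolerance -/e -/kap; ring.
  by rewrite ler_piMl ?divr_ge0 // ltW.
move: h1; rewrite ler_norml => /andP[_ h1].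
lra.
Qed.

Lemma accepted_itv i j : 0 < Ktilde F i j <= 1.
Proof.
have [_ ->] := entries i j; rewrite andbT (lt_le_trans _ (accepted_ge i j)) //.
by rewrite divr_gt0.
Qed.

(** The tolerance is [e] times [kap / 2], a lower bound of the entries of both matrices. Hence both
    ratios are at most [1 + e], and [ln x <= x - 1] applies to each. *)
Lemma accepted_log i j : `|eta * cost_mx X i j + ln (Ktilde F i j)| <= e.
Proof.
have [h1 _] := entries i j; have h2 := kernel_ge i j; have h3 := accepted_ge i j.
have k0 := kap0.
have K0 : 0 < kernel_mx X eta i j by exact: lt_le_trans h2.
have T0 : 0 < Ktilde F i j by case/andP: (accepted_itv i j).
have lnK : ln (kernel_mx X eta i j) = - (eta * cost_mx X i j).
  by rewrite mxE /gauss expRK mulNr mxE.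
have -> : eta * cost_mx X i j + ln (Ktilde F i j) =
  ln (Ktilde F i j) - ln (kernel_mx X eta i j) by rewrite lnK; ring.
have tauE : tau = e * (kap / 2) by rewrite /tau /tolerance -/e -/kap; ring.
move: h1; rewrite ler_norml => /andP[h1 h1'].
have h4 := @ln_le_subr1 R _ (divr_gt0 T0 K0).
have h5 := @ln_le_subr1 R _ (divr_gt0 K0 T0).
rewrite ln_div ?posrE // in h4; rewrite ln_div ?posrE // in h5.
have a1 : Ktilde F i j / kernel_mx X eta i j <= 1 + e.
  rewrite ler_pdivrMr // mulrDl mul1r.
  have : e * (kap / 2) <= e * kernel_mx X eta i j.
    by apply: ler_wpM2l; [exact: ltW e0|lra].
  by rewrite -tauE; lra.
have a2 : kernel_mx X eta i j / Ktilde F i j <= 1 + e.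
  rewrite ler_pdivrMr // mulrDl mul1r.
  have : e * (kap / 2) <= e * Ktilde F i j.
    by apply: ler_wpM2l; [exact: ltW e0|lra].
  by rewrite -tauE; lra.
by rewrite ler_norml; apply/andP; split; lra.
Qed.

Lemma accepted_stops (CS : R) : sinkhorn_rate CS ->
  exists2 k : nat, k%:R <= iteration_bound n Rad eta eps CS &
    sk_small Rad eta eps p q ny s k.
Proof.
move=> rate; have := rate n (Ktilde F) p q e n2 (fun i j => accepted_itv i j) sp sq.
have e01 : 0 < e <= 1 by rewrite e0 e1.
move=> /(_ e01) [k [kle small]]; exists k => //; apply: le_trans kle _.
set Km := \big[Num.min/1]_i _.
have k1 : kap <= 1.
  by rewrite -(kernel_diag X eta (Ordinal (ltnW n2))) kernel_ge.
have Kmge : kap / 2 <= Km.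
  apply/bigmin_geP; split=> [|i _]; first lra.
  by apply/bigmin_geP; split=> [|j _]; [lra|exact: accepted_ge].
have Km0 : 0 < Km by apply: lt_le_trans Kmge; rewrite divr_gt0.
have n0 : 0 < n%:R :> R by rewrite ltr0n ltnW.
have Kml : Km <= 1 by exact: bigmin_le_id.
have eKm1 : e * Km <= 1.
  by apply: (@le_trans _ _ (1 * 1)); [apply: ler_pM => //; exact: ltW|lra].
have l0 : 0 <= ln (n%:R / (e * Km)).
  rewrite ln_ge0 // ler_pdivlMr ?mulr_gt0 // mul1r; apply: le_trans eKm1 _.
  by rewrite (ler_nat _ 1) ltnW.
rewrite /iteration_bound -/e.
apply: (@le_trans _ _ (`|CS| * e^-1 * ln (n%:R / (e * Km)))).
  by rewrite ler_wpM2r // ler_wpM2r ?ler_norm // invr_ge0 ltW.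
apply: ler_wpM2l; first by rewrite mulr_ge0 // invr_ge0 ltW.
have -> : ln (2 * n%:R / e) + 4 * eta * Rad ^+ 2 = ln (n%:R / (e * (kap / 2))).
  have -> : n%:R / (e * (kap / 2)) = (2 * n%:R / e) * kap^-1.
    by field; rewrite !gt_eqF.
  have ne0 : 0 < 2 * n%:R / e by rewrite divr_gt0 // mulr_gt0.
  have ki0 : 0 < kap^-1 by rewrite invr_gt0.
  rewrite (ln_mul ne0 ki0).
  by rewrite lnV ?posrE // /kap expRK; congr (_ + _); ring.
rewrite ler_ln ?posrE ?divr_gt0 ?mulr_gt0 //.
rewrite ler_pM2l // lef_pV2 ?posrE ?mulr_gt0 ?divr_gt0 //.
by rewrite ler_pM2l.
Qed.

Lemma accepted_accurate j : sk_small Rad eta eps p q ny s j ->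
  let P := scaled (Ktilde F) (sk_iter Rad eta eps p q ny s j) in
  let d1 := (sk_iter Rad eta eps p q ny s j).1 in
  let d2 := (sk_iter Rad eta eps p q ny s j).2 in
  let W := W_eta X eta p q in
  [/\ couplings p q (rounding P p q),
    `|objective (cost_mx X) eta (rounding P p q) - W| <= eps,
    (KL (rounding P p q) (P_eta X eta p q) <= (eta * eps)%:E)%E &
    `|eta^-1 * (\sum_i ln (d1 i 0) * (\sum_j P i j) +
        \sum_j ln (d2 j 0) * (\sum_i P i j)) - W| <= eps].
Proof.
rewrite /sk_small /sk_iter -/e -/F.
set p' := smooth (e / 8) p; set q' := smooth (e / 8) q.
set D := sinkhorn_iter _ _ _ j => small /=.
set P := scaled (Ktilde F) D; set d1 := D.1; set d2 := D.2; set W := W_eta X eta p q.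
have n0 : (0 < n)%N by exact: ltnW.
have n0R : 0 < n%:R :> R by rewrite ltr0n.
have K01 := accepted_itv; have K0 i k : 0 < Ktilde F i k by case/andP: (K01 i k).
have t0 : 0 < e / 8 by rewrite divr_gt0.
have sm0 (v : 'cV[R]_n) : simplex v -> forall i, 0 < smooth (e / 8) v i 0.
  move=> [v0 _] i; rewrite !mxE mulr1 ltr_wpDl ?divr_gt0 // mulr_ge0 //.
  by have := e1; lra.
have [d10 d20] := sinkhorn_iter_gt0 j n0 K0 (sm0 p sp) (sm0 q sq).
have [_ hth bud] := budget_le n2 R1 heta heps.
have PE : P = scaled (Ktilde F) (d1, d2) by rewrite /d1 /d2 -surjective_pairing.
(* Sinkhorn leaves an error [e / 2], and smoothing moves each of [p] and [q] by at most
   [2 * (e / 8)], which makes [e] in all. *)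
have marg : \sum_i `|\sum_j P i j - p i 0| + \sum_j `|\sum_i P i j - q j 0| <= e.
  have m1 : \sum_i `|\sum_j P i j - p i 0| <=
      normL1 (P *m ones R n - p') + 2 * (e / 8).
    apply: le_trans (lerD (lexx _) (smooth_simplex_dist n0 (ltW t0) sp)).
    rewrite -big_split; apply: ler_sum => i _ /=.
    have -> : \sum_j P i j - p i 0 = (P *m ones R n - p') i 0 + (p' i 0 - p i 0).
      by rewrite [X in _ = X + _]mxE mul_onesE [X in _ + X + _]mxE; ring.
    exact: ler_normD.
  have m2 : \sum_j `|\sum_i P i j - q j 0| <=
      normL1 (P^T *m ones R n - q') + 2 * (e / 8).
    apply: le_trans (lerD (lexx _) (smooth_simplex_dist n0 (ltW t0) sq)).
    rewrite -big_split; apply: ler_sum => i _ /=.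
    have -> : \sum_j P j i - q i 0 = (P^T *m ones R n - q') i 0 + (q' i 0 - q i 0).
      rewrite [X in _ = X + _]mxE mul_onesE [X in _ + X + _]mxE.
      under [X in _ = X - _ + _]eq_bigr do rewrite mxE.
      ring.
    exact: ler_normD.
  rewrite /sinkhorn_err -/P in small.
  by have := e0; lra.
have e01 : 0 <= e <= 1 by rewrite ltW //= e1.
have cb i k : eta * cost_mx X i k <= 4 * Rad ^+ 2 * eta.
  by rewrite [leRHS]mulrC ler_pM2l // cost_mx_le.
rewrite PE in marg.
have [cP V0 Vle Wle] :=
  rounding_near_optimal eta0 K01 d10 d20 sp sq e01 hth accepted_log cb marg.
rewrite -PE in cP V0 Vle Wle.
have Ve : eta * (objective (cost_mx X) eta (rounding P p q) - W) <= eta * eps.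
  exact: le_trans Vle bud.
split=> //.
- by rewrite ger0_norm // -(ler_pM2l eta0).
- have [cQ minQ] := P_eta_minimizes X eta sp sq.
  apply: le_trans (P_eta_KL_le eta0 cQ minQ cP) _; rewrite lee_fin.
  exact: Ve.
- by rewrite -(ler_pM2l eta0); apply: le_trans bud.
Qed.

End Accepted.
End Seed.

(** * Probability bound *)

Lemma diag_le_opnorm (R : realType) (n : nat) (A : 'M[R]_n) i : A i i <= opnorm A.
Proof.
have norm1 (v : 'cV[R]_n) k : norm2 v <= 1 -> `|v k 0| <= 1.
  move=> v1; rewrite -sqrtr_sqr; apply: le_trans v1.
  rewrite ler_wsqrtr // (bigD1 k) //= lerDl sumr_ge0 // => a _; exact: sqr_ge0.
pose e : 'cV[R]_n := delta_mx i 0.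
have e1 : norm2 e = 1.
  rewrite /norm2 (bigD1 i) //= mxE !eqxx expr1n big1 ?addr0 ?sqrtr1 // => k ki.
  by rewrite mxE (negbTE ki) expr0n.
apply: (@le_trans _ _ (norm2 (A *m e))).
  apply: le_trans (ler_norm _) _; rewrite -sqrtr_sqr ler_wsqrtr //.
  rewrite (bigD1 i) //= -colE mxE lerDl sumr_ge0 // => a _; exact: sqr_ge0.
(* The supremum dominates its set only if that set is bounded above; the bound comes from the l1
   norms of the rows. *)
apply: ub_le_sup; last by exists e => //=; rewrite e1.
exists (Num.sqrt (\sum_k (\sum_j `|A k j|) ^+ 2)) => _ [v /= v1 <-].
rewrite ler_wsqrtr //; apply: ler_sum => k _.
rewrite -[leLHS]real_normK ?num_real // ler_sqr ?nnegrE ?sumr_ge0 // mxE.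
apply: le_trans (ler_norm_sum _ _ _) _; apply: ler_sum => j _.
by rewrite normrM ler_piMr // norm1.
Qed.

(** [V] and the product [L L^T] are functions of the selected points. The random matrix thus depends
    on the seed through a countable type. *)
Lemma Ktilde_of_pts (R : realType) (n d : nat) (X : 'I_n -> 'cV[R]_d) (eta : R) s
    (F G : nys_factor R n) : nystrom_factor X eta s F -> nystrom_factor X eta s G ->
  pts F = pts G -> Ktilde F = Ktilde G.
Proof.
case: F G => [l V L] [l' V' L'] [/= _ _ VE _ _ AE] [/= _ _ VE' _ _ AE'] ll'.
by subst l'; rewrite /Ktilde /= VE VE' AE AE'.
Qed.

Section Probability.
Variables (R : realType) (n d : nat) (X : 'I_n -> 'cV[R]_d) (eta : R).
Variables (disp : measure_display) (Om : measurableType disp).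
Variable ny : nat -> Om -> timed (nys_factor R n).
Hypothesis nyF : forall s w, (0 < s)%N -> nystrom_factor X eta s (cval (ny s w)).
Hypothesis nyM : forall s (l : seq 'I_n), (0 < s)%N ->
  measurable [set w | pts (cval (ny s w)) = l].

(** Countable union over the possible selections; given the selection, the second set is the whole
    space or empty, so [Q] can be arbitrary. *)
Lemma Ktilde_measurable s (Q : set 'M[R]_n) : (0 < s)%N ->
  measurable [set w | Q (Ktilde (cval (ny s w)))].
Proof.
move=> s0.
have -> : [set w | Q (Ktilde (cval (ny s w)))] = \bigcup_(l : seq 'I_n)
    ([set w | pts (cval (ny s w)) = l] `&`
     [set _ | exists2 w, pts (cval (ny s w)) = l & Q (Ktilde (cval (ny s w)))]).
  apply/seteqP; split=> w /=.
    by move=> Qw; exists (pts (cval (ny s w))) => //; split=> //; exists w.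
  move=> [l _ [/= wl [w' w'l]]].
  by rewrite (Ktilde_of_pts (nyF w s0) (nyF w' s0)) // wl w'l.
apply: countable_bigcupT_measurable; first exact: countableP.
move=> l; apply: measurableI; first exact: nyM.
have [H|H] := pselect (exists2 w, pts (cval (ny s w)) = l & Q (Ktilde (cval (ny s w)))).
  rewrite (_ : [set _ | _] = setT); first exact: measurableT.
  by apply/seteqP; split.
rewrite (_ : [set _ | _] = set0); first exact: measurable0.
by apply/seteqP; split.
Qed.

End Probability.

(** Take the least exponent: either it is 0, or the preceding power lies below [S]. *)
Lemma exists_pow2_ge (R : realType) (S : R) :
  exists i, S <= (2 ^ i * 2)%:R /\
    ((2 ^ i * 2)%:R <= 2 :> R \/ (2 ^ i * 2)%:R <= 2 * S).
Proof.
have ex : exists i, S <= (2 ^ i * 2)%:R.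
  exists (Num.truncn S); apply: le_trans (ltW (truncnS_gt S)) _.
  by rewrite ler_nat (leq_trans (ltn_expl _ (ltnSn 1))) // leq_pmulr.
pose i := ex_minn ex; exists i; rewrite /i; case: ex_minnP => {}i Si imin; split=> //.
case: i Si imin => [|i] Si imin; first by left.
right; rewrite leNgt; apply/negP => h.
have : S <= (2 ^ i * 2)%:R.
  by move: h; rewrite expnS -mulnA natrM; lra.
by move/imin; rewrite ltnn.
Qed.

(** [4000 = 2 * 400 * 5], the 5 absorbing [ln 3] into [ln (n / delta) >= 1 / 2]. The alternative
    bound 2 is absorbed since also [D >= 1 / 2]. *)
Lemma pow2_bound (R : realType) (n : nat) (delta D tau : R) i : (1 < n)%N ->
  0 < delta < 1 -> tau <= 1 -> 0 < tau -> (1 + tau)^-1 <= D ->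
  (2 ^ i * 2)%:R <= 2 :> R \/
    (2 ^ i * 2)%:R <= 2 * (400 * D * ln (3 * n%:R / delta)) ->
  (2 ^ i * 2)%:R <= 4000 * D * ln (n%:R / delta).
Proof.
move=> n2 hd t1 t0 hD.
have n2R : 2 <= n%:R :> R by rewrite (ler_nat _ 2).
have nd : 2 <= n%:R / delta by rewrite ler_pdivlMr; nra.
have D2 : 2^-1 <= D by apply: le_trans hD; rewrite lef_pV2 ?posrE //; lra.
have ln2 : 2^-1 <= ln 2 :> R.
  have := @ln_le_subr1 R 2^-1 ltac:(by rewrite invr_gt0).
  by rewrite lnV ?posrE //; lra.
have lnd : 2^-1 <= ln (n%:R / delta).
  by apply: le_trans ln2 _; rewrite ler_ln ?posrE //; lra.
have ln3 : ln (3 * n%:R / delta) <= 5 * ln (n%:R / delta).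
  rewrite -mulrA ln_mul //; last lra.
  have := @ln_le_subr1 R 3 ltac:(by []); lra.
case=> h; apply: le_trans h _.
  have : 2^-1 * 2^-1 <= D * ln (n%:R / delta) by apply: ler_pM => //; rewrite invr_ge0.
  by lra.
have : D * ln (3 * n%:R / delta) <= D * (5 * ln (n%:R / delta)) by apply: ler_wpM2l; lra.
lra.
Qed.

Lemma runtime_le (R : realType) (A c r k T L m : R) :
  0 <= A -> 0 <= c -> 1 <= r -> 0 <= T -> 1 <= L -> 0 <= m -> k <= c * (L * T) ->
  A * (m * r * (r + k + 1)) <= A * (2 + c) * (L * (m * r * (r + T))).
Proof.
move=> A0 c0 r1 T0 L1 m0 kT.
have -> : A * (2 + c) * (L * (m * r * (r + T))) = A * (m * r * ((2 + c) * (L * (r + T)))).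
  by ring.
apply: ler_wpM2l => //; apply: ler_wpM2l; first by rewrite mulr_ge0 //; lra.
have a1 : 2 * r <= 2 * (L * r) by rewrite ler_pM2l // ler_peMl //; lra.
have a2 : 0 <= c * (L * r) by rewrite mulr_ge0 // mulr_ge0 //; lra.
have a3 : 0 <= L * T by rewrite mulr_ge0 //; lra.
lra.
Qed.

Theorem theorem1 (R : realType) :
  exists c : R, forall CN CS : R, sinkhorn_rate CS ->
  exists (C : R) (k : nat),
  forall (n d : nat) (Rad eta eps delta : R) (X : 'I_n -> 'cV[R]_d)
    (p q : 'cV[R]_n)
    (disp : measure_display) (Om : measurableType disp) (Pr : probability Om R)
    (ny : nat -> Om -> timed (nys_factor R n)),
  (2 <= n)%N -> 1 <= Rad -> 1 <= eta <= n%:R -> 0 < eps < 1 -> 0 < delta < 1 ->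
  injective X -> (forall i, norm2 (X i) <= Rad) -> simplex p -> simplex q ->
  nystrom_guarantee X eta CN Pr ny ->
  let eps' := eps_prime n Rad eta eps in
  let run w := nys_sink_returns d (fun s => ny s w) Rad eta eps p q in
  [/\ eps / Rad ^+ 2 <= C * polylog k n Rad eta eps * eps',
      forall w, exists out, run w out,
      forall w out, run w out ->
        let Phat := plan_mx (out_plan (cval out)) in
        let What := out_W (cval out) in
        let r := out_r (cval out) in
        [/\ couplings p q Phat,
            r = \rank (Ktilde (gF (out_plan (cval out)))),
            (ctime out)%:R <= C * polylog k n Rad eta eps *
              (n%:R * r%:R * (r%:R + eta * Rad ^+ 4 / eps)),
            (cspace out)%:R <= C * (n * (r + d))%:R &
            [/\ `|objective (cost_mx X) eta Phat - W_eta X eta p q| <= eps,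
                (KL Phat (P_eta X eta p q) <= (eta * eps)%:E)%E &
                `|What - W_eta X eta p q| <= eps]] &
      let E := [set w | exists2 out, run w out &
        (out_r (cval out))%:R <= c * r_star X eta Rad eps' * ln (n%:R / delta)] in
      measurable E /\ ((1 - delta)%:E <= Pr E)%E].
Proof.
exists 4000 => CN CS rate.
(* A natural upper bound of [|CN|], since the cost recurrences are carried out in [nat]. *)
pose N := (Num.truncn `|CN|).+1.
have CN_N x : CN * x%:R <= (N * x)%:R.
  by rewrite natrM ler_wpM2r // (le_trans (ler_norm _)) // ltW // truncnS_gt.
pose C1 : R := (24 * N + 300)%:R * (2 + 4267 * `|CS|).
(* A sum dominating the three constants required: 251 for [eps'], [C1] for time, the last one for
   space. *)
pose C : R := 251 + C1 + (2 * N + 200)%:R.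
have CS0 : 0 <= `|CS| by exact: normr_ge0.
have C10 : 0 <= C1 by apply: mulr_ge0; [exact: ler0n|lra].
have N0 : 0 <= (2 * N + 200)%:R :> R by exact: ler0n.
have C251 : 251 <= C by rewrite /C; lra.
have C1C : C1 <= C by rewrite /C; lra.
have NC : (2 * N + 200)%:R <= C by rewrite /C; lra.
have C0 : 0 <= C by apply: le_trans C251; exact: ler0n.
clearbody C.
(* Degree 2 is that of [iteration_bound_le]. *)
exists C; exists 2%N.
move=> n d Rad eta eps delta X p q disp Om Pr ny n2 R1 heta heps hdelta _ hX sp sq ng.
move=> eps' run.
have eta0 : 0 < eta by case/andP: heta => h _; exact: lt_le_trans ltr01 h.
have eps0 : 0 < eps by case/andP: heps.
have [nyF nyT nyS nyM nyA] := ng.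
have nyT' w s : (0 < s)%N -> (ctime (ny s w) <= N * (n * s ^ 2 + s ^ 3))%N.
  by move=> s0; rewrite -(ler_nat R); apply: le_trans (nyT s w s0) (CN_N _).
have nyS' w s : (0 < s)%N -> (cspace (ny s w) <= N * (n * (s + d)))%N.
  by move=> s0; rewrite -(ler_nat R); apply: le_trans (nyS s w s0) (CN_N _).
have nyF' w s : (0 < s)%N -> nystrom_factor X eta s (cval (ny s w)) by exact: nyF.
have tau0 := tolerance_gt0 n2 R1 heta heps.
have stops w s (s0 : (0 < s)%N) (acc : accepts (tolerance n Rad eta eps) (ny^~ w) s) :=
  accepted_stops n2 R1 heta heps hX sp sq (nyF' w) s0 acc rate.
have result w out (r : run w out) := nys_sink_result n2 (ltW eta0) (nyF' w) (nyT' w) (nyS' w) (ltW tau0) (stops w) r.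
have Lg1 := log_ge1 R1 heta heps.
set Lg := 1 + ln Rad + _ + _ + _ in Lg1.
have plE : polylog 2 n Rad eta eps = Lg ^+ 2 by [].
have Lg2 : Lg <= Lg ^+ 2 by rewrite expr2 ler_peMl // (le_trans ler01 Lg1).
have e0 : 0 < eps' by have [/andP[h _] _ _] := budget_le n2 R1 heta heps.
split.
- rewrite plE; apply: le_trans (eps_div_le n2 R1 heta heps) _.
  rewrite -/Lg -/eps' mulrA ler_pM2r //.
  by apply: ler_pM C251 Lg2; [exact: ler0n|exact: le_trans ler01 Lg1].
- move=> w; have h := nys_sink_some n2 (ltW eta0) (nyF' w) (nyT' w) (nyS' w) (ltW tau0) (stops w).
  exact: h.
- move=> w out /result[sf [sf2 acc _ _] [j small [gFE rE planE WE [[k kle time] space]]]].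
  have sf0 : (0 < sf)%N by exact: ltnW.
  have [cP Ve KLe We] := accepted_accurate n2 R1 heta heps hX sp sq (nyF' w) sf0 acc small.
  rewrite /= planE WE gFE; split=> //.
  + by rewrite rE (Ktilde_rank (nyF' w sf sf0)).
  + move: time; rewrite -(ler_nat R) plE => /le_trans; apply.
    have := size_pts n2 (nyF' w) sf0; rewrite -rE => /andP[r0 _].
    move: r0; rewrite -(ler_nat R); set r := (out_r _)%:R => r1.
    set T := eta * Rad ^+ 4 / eps.
    have kT : k%:R <= 4267 * `|CS| * (Lg ^+ 2 * T).
      exact: le_trans kle (iteration_bound_le n2 R1 heta heps CS).
    have T0 : 0 <= T.
      by rewrite divr_ge0 ?mulr_ge0 ?exprn_ge0 ?(ltW eta0) ?(le_trans ler01 R1) ?(ltW eps0).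
    have Lsq : 1 <= Lg ^+ 2 by exact: le_trans Lg2.
    have -> : ((24 * N + 300) * (n * out_r (cval out) * (out_r (cval out) + k.+1)))%:R =
        (24 * N + 300)%:R * (n%:R * r * (r + k%:R + 1)) :> R.
      by rewrite natrM; congr (_ * _); rewrite !natrM natrD -natr1 addrA.
    have c0 : 0 <= 4267 * `|CS| by apply: mulr_ge0; [exact: ler0n|exact: CS0].
    apply: le_trans (runtime_le (ler0n _ _) c0 r1 T0 Lsq (ler0n _ n) kT) _.
    rewrite -/C1 -[leRHS]mulrA; apply: ler_wpM2r => //.
    rewrite mulr_ge0 ?(le_trans ler01 Lsq) // mulr_ge0 ?mulr_ge0 ?ler0n //.
    by rewrite addr_ge0 // (le_trans ler01 r1).
  + move: space; rewrite -(ler_nat R) => /le_trans; apply.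
    by rewrite natrM ler_wpM2r.
move=> E.
(* Because a run stops at its first accepted size, the rank is small exactly when some accepted
   power of two is within the bound. Each event on the right depends on a single call, which gives
   measurability. *)
have EE : E = \bigcup_i [set w | accepts (tolerance n Rad eta eps) (ny^~ w) (2 ^ i * 2) /\
    (minn (2 ^ i * 2) n)%:R <= 4000 * r_star X eta Rad eps' * ln (n%:R / delta)].
  apply/seteqP; split=> w /=.
    move=> [out /result[sf [sf2 acc [i iE] _] [j _ [_ rE _ _ _]]] le].
    exists i => //; rewrite -iE; split=> //.
    by rewrite -(nf_size (nyF' w sf (ltnW sf2))) -rE.
  move=> [i _ [acc le]].
  have [out ro] := nys_sink_some n2 (ltW eta0) (nyF' w) (nyT' w) (nyS' w) (ltW tau0) (stops w).
  exists out => //; apply: le_trans le.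
  have [sf [sf2 _ _ first] [j _ [_ rE _ _ _]]] := result w out ro.
  rewrite rE (nf_size (nyF' w sf (ltnW sf2))) ler_nat.
  rewrite leq_min geq_minr andbT (leq_trans (geq_minl _ _)) //; exact: first.
have pow0 i : (0 < 2 ^ i * 2)%N by rewrite muln_gt0 expn_gt0.
have mE : measurable E.
  rewrite EE; apply: bigcupT_measurable => i.
  exact: (Ktilde_measurable nyF nyM (fun K => (forall a, 1 - K a a <= _) /\ _) (pow0 i)).
split=> //.
pose tau := eps' / (2 * n%:R) * expR (- 4 * eta * Rad ^+ 2).
have nR0 : 0 < n%:R :> R by rewrite ltr0n ltnW.
have tn0 : 0 < tau by rewrite mulr_gt0 ?expR_gt0 // divr_gt0 // mulr_gt0.
have tauE : tau * n%:R = tolerance n Rad eta eps.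
  by rewrite /tau /tolerance -/eps'; field; rewrite gt_eqF.
have tau1 : tau <= 1.
  apply: le_trans (tolerance_le1 n2 R1 heta heps); rewrite -tauE ler_peMr ?(ltW tn0) //.
  by rewrite (ler_nat _ 1) ltnW.
have [i [Si hi]] := exists_pow2_ge (400 * d_eff X eta tau * ln (3 * n%:R / delta)).
have delta0 : 0 < delta by case/andP: hdelta.
apply: le_trans (nyA _ tau delta (pow0 i) tn0 delta0 Si) _.
apply: le_measure; rewrite ?inE.
- exact: (Ktilde_measurable nyF nyM (fun K => opnorm (kernel_mx X eta - K) <= tau * n%:R) (pow0 i)).
- exact: mE.
(* The run may have stopped at a smaller power; [EE] asks only for one accepted size within the
   bound. *)
move=> w /= hw; rewrite EE; exists i => //; split.
  move=> a; rewrite -tauE; apply: le_trans hw.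
  by have := diag_le_opnorm (kernel_mx X eta - Ktilde (cval (ny (2 ^ i * 2)%N w))) a; rewrite mxE kernel_diag mxE.
apply: (@le_trans _ _ (2 ^ i * 2)%:R); first by rewrite ler_nat geq_minl.
exact: (pow2_bound n2 hdelta tau1 tn0 (d_eff_ge X (ltW eta0) (ltnW n2) tn0) hi).
Qed.
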